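(* Let $\omega$ be an analytic self-map of $\mathbb{D}$ such that $\omega(\mathbb{D})$ has positive distance to $-1$, and set $\varphi:=T\circ\omega\circ I$, where $T(z)=\frac12+\frac{1-z}{1+z}$ and $I(s)=2^{-s}$. Then there exist positive constants $c$ and $A$ such that, if $n\ge 1$ and $Z=(z_j)$ is any finite sequence such that both $Z$ and $\omega(Z)$ consist of $n$ distinct points in $\mathbb{D}$, then $$c\,[M_{H^2(\mathbb{D})}(\omega(Z))]^{-A}\,\|\mu_{Z,H^2(\mathbb{D})}\|_{\mathcal{C},H^2(\mathbb{D})}^{-1/2}\inf_{1\le j\le n}\left(\frac{1-|z_j|^2}{1-|\omega(z_j)|^2}\right)^{1/2}\le a_n(C_\varphi)\le\|C_T\|\,a_n(C_\omega),$$ where $C_\varphi$ acts on $\mathcal{H}^2$, $C_\omega$ acts on $H^2(\mathbb{D})$, and $C_T:\mathcal{H}^2\to H^2(\mathbb{D})$. In particular, $C_\varphi$ is compact on $\mathcal{H}^2$ as soon as $C_\omega$ is compact on $H^2(\mathbb{D})$.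
   Context: $\mathbb{D}$ is the open unit disc and $H^2(\mathbb{D})$ the usual Hardy space. $\mathcal{H}^2$ is the Hilbert space of Dirichlet series $f(s)=\sum_{n\ge1} b_n n^{-s}$ with $\|f\|_{\mathcal{H}^2}^2=\sum_n |b_n|^2<\infty$, analytic in $\mathbb{C}_{1/2}=\{\operatorname{Re}s>1/2\}$. $T$ maps $\mathbb{D}$ conformally onto $\mathbb{C}_{1/2}$ and $I$ maps $\{\operatorname{Re}s>0\}$ onto $\mathbb{D}\setminus\{0\}$. Composition operators are defined by $C_\varphi f=f\circ\varphi$, $C_\omega f=f\circ\omega$, $C_Tf=f\circ T$; $C_T$ is a bounded operator from $\mathcal{H}^2$ to $H^2(\mathbb{D})$. The $n$th approximation number $a_n(S)$ of a bounded operator $S$ is the distance in operator norm to the operators of rank $<n$. For a finite sequence $Z=(z_j)$ of distinct points in $\mathbb{D}$, $\mu_{Z,H^2(\mathbb{D})}=\sum_j(1-|z_j|^2)\delta_{z_j}$, and $\|\mu_{Z,H^2(\mathbb{D})}\|_{\mathcal{C},H^2(\mathbb{D})}$ is the smallest $C$ such that $\sum_j(1-|z_j|^2)|f(z_j)|^2\le C\|f\|_{H^2(\mathbb{D})}^2$ for all $f\in H^2(\mathbb{D})$. For a finite sequence $W=(w_j)$ of distinct points in $\mathbb{D}$, the constant of interpolation $M_{H^2(\mathbb{D})}(W)$ is the smallest $C$ such that for all complex values $(a_j)$ there is $f\in H^2(\mathbb{D})$ with $f(w_j)=a_j$ for all $j$ and $\|f\|_{H^2(\mathbb{D})}\le C\left(\sum_j|a_j|^2(1-|w_j|^2)\right)^{1/2}$.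 *)

(* Defs.v *)
From Stdlib Require Import Reals Lra Lia FunctionalExtensionality ProofIrrelevance.
From Coquelicot Require Import Coquelicot.
Open Scope R_scope.

(** * The complex sequence space l^2 as a normed module over C *)

Record ell2 : Type := Ell2 {
  coef :> nat -> C;
  coef_summable : ex_series (fun n => Cmod (coef n) ^ 2) }.

Lemma ell2_ext (f g : ell2) : (forall n, coef f n = coef g n) -> f = g.
Proof.
destruct f as [f Hf], g as [g Hg]; simpl; intros H.
assert (E : f = g) by (apply functional_extensionality; exact H).
subst g; f_equal; apply proof_irrelevance.
Qed.

Lemma Cmod_plus_sqr_le (t : R) (x y : C) : 0 < t ->
  Cmod (x + y)%C ^ 2 <= (1 + t) * Cmod x ^ 2 + (1 + / t) * Cmod y ^ 2.
Proof.
intros Ht.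
assert (H1 := Cmod_triangle x y).
assert (H2 := Cmod_ge_0 (x + y)%C).
apply Rle_trans with ((Cmod x + Cmod y) ^ 2).
  apply pow_incr; lra.
assert (H3 : 0 <= / t * (t * Cmod x - Cmod y) ^ 2).
  apply Rmult_le_pos; [left; apply Rinv_0_lt_compat; lra | apply pow2_ge_0].
replace ((1 + t) * Cmod x ^ 2 + (1 + / t) * Cmod y ^ 2)
  with ((Cmod x + Cmod y) ^ 2 + / t * (t * Cmod x - Cmod y) ^ 2)
  by (field; lra).
lra.
Qed.

Lemma ell2_series_comb (f g : ell2) (u v : R) :
  is_series (fun n => u * Cmod (f n) ^ 2 + v * Cmod (g n) ^ 2)
    (u * Series (fun n => Cmod (f n) ^ 2) + v * Series (fun n => Cmod (g n) ^ 2)).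
Proof.
apply (is_series_plus (K := R_AbsRing) (V := R_NormedModule)
  (fun n => u * Cmod (f n) ^ 2) (fun n => v * Cmod (g n) ^ 2));
apply (is_series_scal (K := R_AbsRing) (V := R_NormedModule));
apply Series_correct, coef_summable.
Qed.

Lemma ex_series_dominated (a b : nat -> R) :
  (forall n, 0 <= a n <= b n) -> ex_series b -> ex_series a.
Proof.
intros H Hb; apply (ex_series_le (K := R_AbsRing) (V := R_CompleteNormedModule) a b); auto.
intros n; unfold norm; simpl; unfold abs; simpl.
rewrite Rabs_pos_eq; apply H.
Qed.

Lemma ell2_plus_summable (f g : ell2) :
  ex_series (fun n => Cmod (f n + g n)%C ^ 2).
Proof.
apply ex_series_dominated
  with (fun n => (1 + 1) * Cmod (f n) ^ 2 + (1 + / 1) * Cmod (g n) ^ 2).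
  intros n; split; [apply pow2_ge_0 | apply Cmod_plus_sqr_le; lra].
eexists; apply ell2_series_comb.
Qed.

Lemma ell2_scal_summable (c : C) (f : ell2) :
  ex_series (fun n => Cmod (c * f n)%C ^ 2).
Proof.
apply ex_series_ext with (fun n => Cmod c ^ 2 * Cmod (f n) ^ 2).
  intros n; rewrite Cmod_mult, Rpow_mult_distr; reflexivity.
apply (ex_series_scal (K := R_AbsRing) (V := R_NormedModule)), coef_summable.
Qed.

Lemma ell2_zero_summable : ex_series (fun _ : nat => Cmod 0 ^ 2).
Proof.
apply ex_series_ext with (fun n => 0 * (/ 2) ^ n).
  intros n; rewrite Cmod_0; simpl; ring.
apply (ex_series_scal (K := R_AbsRing) (V := R_NormedModule)), ex_series_geom.
rewrite Rabs_pos_eq; lra.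
Qed.

Definition ell2_plus (f g : ell2) : ell2 :=
  Ell2 (fun n => f n + g n)%C (ell2_plus_summable f g).
Definition ell2_scal (c : C) (f : ell2) : ell2 :=
  Ell2 (fun n => c * f n)%C (ell2_scal_summable c f).
Definition ell2_zero : ell2 := Ell2 (fun _ => RtoC 0) ell2_zero_summable.
Definition ell2_opp (f : ell2) : ell2 := ell2_scal (- (1))%C f.
Definition ell2_norm (f : ell2) : R := sqrt (Series (fun n => Cmod (f n) ^ 2)).

Lemma ell2_sum_ge0 (f : ell2) : 0 <= Series (fun n => Cmod (f n) ^ 2).
Proof.
rewrite <- (Rmult_0_l (Series (fun n => Cmod (f n) ^ 2))), <- Series_scal_l.
apply Series_le; [| apply coef_summable].
intros n; assert (H := pow2_ge_0 (Cmod (f n))); split; lra.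
Qed.

Lemma ell2_norm_sqr (f : ell2) :
  ell2_norm f ^ 2 = Series (fun n => Cmod (f n) ^ 2).
Proof. apply pow2_sqrt, ell2_sum_ge0. Qed.

Lemma ell2_coef_le_norm (f : ell2) (n : nat) : Cmod (f n) <= ell2_norm f.
Proof.
apply Rsqr_incr_0_var; [| apply sqrt_pos].
rewrite !Rsqr_pow2, ell2_norm_sqr.
rewrite (Series_incr_n _ (S n)); [| lia | apply coef_summable].
assert (H1 : 0 <= Series (fun k => Cmod (f (S n + k)%nat) ^ 2)).
  assert (Hs : ex_series (fun k => Cmod (f (S n + k)%nat) ^ 2)).
    apply (ex_series_incr_n (fun k => Cmod (f k) ^ 2) (S n)), coef_summable.
  exact (ell2_sum_ge0 (Ell2 (fun k => f (S n + k)%nat) Hs)).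
assert (H2 : 0 <= sum_f_R0 (fun k => Cmod (f k) ^ 2) n - Cmod (f n) ^ 2).
  destruct n as [|n]; cbn [sum_f_R0]; [lra|].
  assert (H := cond_pos_sum (fun k => Cmod (f k) ^ 2) n
    (fun k => pow2_ge_0 (Cmod (f k)))).
  lra.
cbn [pred]; lra.
Qed.

Lemma ell2_norm_eq0 (f : ell2) : ell2_norm f = 0 -> f = ell2_zero.
Proof.
intros H; apply ell2_ext; intros n; simpl; apply Cmod_eq_0.
apply Rle_antisym; [rewrite <- H; apply ell2_coef_le_norm | apply Cmod_ge_0].
Qed.

Lemma ell2_norm_triangle (f g : ell2) :
  ell2_norm (ell2_plus f g) <= ell2_norm f + ell2_norm g.
Proof.
assert (Hf : 0 <= ell2_norm f) by apply sqrt_pos.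
assert (Hg : 0 <= ell2_norm g) by apply sqrt_pos.
destruct (Req_dec (ell2_norm f) 0) as [Ef | Nf].
  apply ell2_norm_eq0 in Ef; subst f.
  replace (ell2_plus ell2_zero g) with g; [lra|].
  apply ell2_ext; intros n; simpl; ring.
destruct (Req_dec (ell2_norm g) 0) as [Eg | Ng].
  apply ell2_norm_eq0 in Eg; subst g.
  replace (ell2_plus f ell2_zero) with f; [lra|].
  apply ell2_ext; intros n; simpl; ring.
set (t := ell2_norm g / ell2_norm f).
assert (Ht : 0 < t) by (apply Rdiv_lt_0_compat; lra).
apply Rsqr_incr_0_var; [| lra].
rewrite !Rsqr_pow2, ell2_norm_sqr.
apply Rle_trans with
  (Series (fun n => (1 + t) * Cmod (f n) ^ 2 + (1 + / t) * Cmod (g n) ^ 2)).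
  apply Series_le.
    intros n; split; [apply pow2_ge_0 | apply (Cmod_plus_sqr_le t); exact Ht].
  eexists; apply ell2_series_comb.
rewrite (is_series_unique _ _ (ell2_series_comb f g (1 + t) (1 + / t))).
rewrite <- !ell2_norm_sqr.
right; unfold t; field; lra.
Qed.

Lemma ell2_norm_scal (c : C) (f : ell2) :
  ell2_norm (ell2_scal c f) = Cmod c * ell2_norm f.
Proof.
unfold ell2_norm at 1.
rewrite (Series_ext _ (fun n => Cmod c ^ 2 * Cmod (f n) ^ 2)).
  rewrite Series_scal_l, sqrt_mult, sqrt_pow2;
    [reflexivity | apply Cmod_ge_0 | apply pow2_ge_0 | apply ell2_sum_ge0].
intros n; simpl coef; rewrite Cmod_mult, Rpow_mult_distr; reflexivity.
Qed.

Definition ell2_AbelianMonoid_mixin : AbelianMonoid.mixin_of ell2.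
Proof.
apply (AbelianMonoid.Mixin ell2 ell2_plus ell2_zero);
  intros; apply ell2_ext; intros n; simpl; ring.
Defined.
Canonical ell2_AbelianMonoid := AbelianMonoid.Pack ell2 ell2_AbelianMonoid_mixin ell2.

Definition ell2_AbelianGroup_mixin : AbelianGroup.mixin_of ell2_AbelianMonoid.
Proof.
apply (AbelianGroup.Mixin ell2_AbelianMonoid ell2_opp);
  intros; apply ell2_ext; intros n; simpl; ring.
Defined.
Canonical ell2_AbelianGroup :=
  AbelianGroup.Pack ell2 (AbelianGroup.Class _ _ ell2_AbelianGroup_mixin) ell2.

Definition ell2_ModuleSpace_mixin : ModuleSpace.mixin_of C_Ring ell2_AbelianGroup.
Proof.
apply (ModuleSpace.Mixin C_Ring ell2_AbelianGroup ell2_scal);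
  intros; apply ell2_ext; intros n; simpl; unfold plus, mult, one; simpl; ring.
Defined.
Canonical ell2_ModuleSpace :=
  ModuleSpace.Pack C_Ring ell2 (ModuleSpace.Class _ _ _ ell2_ModuleSpace_mixin) ell2.

Definition ell2_ball (f : ell2) (e : R) (g : ell2) : Prop :=
  ell2_norm (minus g f) < e.

Definition ell2_UniformSpace_mixin : UniformSpace.mixin_of ell2.
Proof.
apply (UniformSpace.Mixin ell2 ell2_zero ell2_ball); unfold ell2_ball.
- intros f e.
  replace (minus f f) with (ell2_scal 0%C f).
    rewrite ell2_norm_scal, Cmod_0, Rmult_0_l; apply cond_pos.
  apply ell2_ext; intros n; simpl; ring.
- intros f g e H.
  replace (minus f g) with (ell2_scal (- (1))%C (minus g f)).
    rewrite ell2_norm_scal, Cmod_opp, Cmod_1, Rmult_1_l; exact H.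
  apply ell2_ext; intros n; simpl; ring.
- intros f g h e1 e2 H1 H2.
  replace (minus h f) with (ell2_plus (minus h g) (minus g f)).
    assert (H := ell2_norm_triangle (minus h g) (minus g f)); lra.
  apply ell2_ext; intros n; simpl; ring.
Defined.
Canonical ell2_UniformSpace := UniformSpace.Pack ell2 ell2_UniformSpace_mixin ell2.

Definition ell2_NormedModuleAux :=
  NormedModuleAux.Pack C_AbsRing ell2
    (NormedModuleAux.Class C_AbsRing ell2
      (ModuleSpace.class C_Ring ell2_ModuleSpace)
      (UniformSpace.class ell2_UniformSpace)) ell2.
Canonical ell2_NormedModuleAux.

Definition ell2_NormedModule_mixin :
  NormedModule.mixin_of C_AbsRing ell2_NormedModuleAux.
Proof.
apply (NormedModule.Mixin C_AbsRing ell2_NormedModuleAux ell2_norm 1).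
- exact ell2_norm_triangle.
- intros c f; right; exact (ell2_norm_scal c f).
- intros f g e H; exact H.
- intros f g e H; rewrite Rmult_1_l; exact H.
- exact ell2_norm_eq0.
Defined.
Canonical ell2_NormedModule :=
  NormedModule.Pack C_AbsRing ell2
    (NormedModule.Class _ _ _ ell2_NormedModule_mixin) ell2.

(** * Domains, analyticity, and the two Hilbert spaces of analytic functions *)

Definition unit_disc (z : C) : Prop := Cmod z < 1.
Definition half_plane (s : C) : Prop := / 2 < Re s.

Definition analytic_on (D : C -> Prop) (f : C -> C) : Prop :=
  forall z0, D z0 -> exists (a : nat -> C) (r : posreal), forall z,
    Cmod (z - z0) < r ->
    is_pseries (K := C_AbsRing) (V := C_NormedModule) a (z - z0)%C (f z).

(* Sum of a convergent complex series; all the series below converge absolutely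
   on the domains where they are used. *)
Definition CSeries (a : nat -> C) : C :=
  (Series (fun n => Re (a n)), Series (fun n => Im (a n))).

(* n^{-s} = e^{-s ln n}, for a positive integer n. *)
Definition inv_npow (n : nat) (s : C) : C :=
  let r := exp (- Re s * ln (INR n)) in
  let t := Im s * ln (INR n) in
  (r * cos t, - (r * sin t)).

(* The functions in H^2(D) are the sums of the power series with square-summable
   coefficients, normed by the l^2 norm of the coefficients.  The analogous
   Dirichlet series make up DirichletH2.  The elements of both spaces are given
   by their coefficients, which are determined by the function. *)
Definition HardyH2 : NormedModule C_AbsRing := ell2_NormedModule.
Definition DirichletH2 : NormedModule C_AbsRing := ell2_NormedModule.

Definition hardy_eval (f : HardyH2) (z : C) : C :=
  CSeries (fun k => (coef f k * z ^ k)%C).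

(* Coefficient number k belongs to (k+1)^{-s}. *)
Definition dirichlet_eval (f : DirichletH2) (s : C) : C :=
  CSeries (fun k => (coef f k * inv_npow (S k) s)%C).

Definition Tmap (z : C) : C := (/ 2 + (1 - z) / (1 + z))%C.
Definition Imap (s : C) : C := inv_npow 2 s.

(* S is the bounded operator f |-> f o psi, between spaces whose elements are
   evaluated by evU and evV, the elements of V being functions on D. *)
Definition is_composition_operator {U V : NormedModule C_AbsRing}
    (evU : U -> C -> C) (evV : V -> C -> C) (D : C -> Prop) (psi : C -> C)
    (S : U -> V) : Prop :=
  is_linear S /\ forall f z, D z -> evV (S f) z = evU f (psi z).

(** * Operator norm, approximation numbers, compactness *)

Definition infimum (E : R -> Prop) : R := real (Glb_Rbar E).

Definition operator_norm {U V : NormedModule C_AbsRing} (S : U -> V) : R :=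
  infimum (fun M => 0 <= M /\ forall x, norm (S x) <= M * norm x).

Definition rank_lt {U V : NormedModule C_AbsRing} (n : nat) (L : U -> V) : Prop :=
  exists (m : nat) (v : nat -> V), (m < n)%nat /\
    forall x, exists c : nat -> C, L x = sum_n_m (fun k => scal (c k) (v k)) 1 m.

Definition approximation_number {U V : NormedModule C_AbsRing} (n : nat)
    (S : U -> V) : R :=
  infimum (fun d => exists L : U -> V,
    is_linear L /\ rank_lt n L /\ d = operator_norm (fun x => minus (S x) (L x))).

Definition compact_operator {U V : NormedModule C_AbsRing} (S : U -> V) : Prop :=
  forall x : nat -> U, (forall k, norm (x k) <= 1) ->
  exists (sigma : nat -> nat) (y : V),
    (forall k, (sigma k < sigma (k + 1))%nat) /\
    filterlim (fun k => S (x (sigma k))) eventually (locally y).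

(** * Carleson norm and constant of interpolation for H^2(D)

    A finite sequence of length n is indexed by 1, ..., n.  Both infima below
    are attained. *)

Definition distinct_points (n : nat) (z : nat -> C) : Prop :=
  forall i j, (1 <= i <= n)%nat -> (1 <= j <= n)%nat -> z i = z j -> i = j.

Definition carleson_norm (n : nat) (z : nat -> C) : R :=
  infimum (fun M => forall f : HardyH2,
    sum_n_m (fun j => (1 - Cmod (z j) ^ 2) * Cmod (hardy_eval f (z j)) ^ 2) 1 n
    <= M * norm f ^ 2).

Definition interpolation_constant (n : nat) (w : nat -> C) : R :=
  infimum (fun M => forall a : nat -> C, exists f : HardyH2,
    (forall j, (1 <= j <= n)%nat -> hardy_eval f (w j) = a j) /\
    norm f <= M * sqrt (sum_n_m (fun j => Cmod (a j) ^ 2 * (1 - Cmod (w j) ^ 2)) 1 n)).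

(* Main.v *)
(* Everything is read off the adjoints on point evaluations: a finite sum
   [sum b_j f(w_j)] has squared norm [sum b_i conj b_j / (1 - w_i conj w_j)] on
   the Hardy space.  Writing [u = (1 - w)/(1 + w)], its pull-back to Dirichlet
   series is the exponential sum [G(x) = sum b_j exp(- u_j x)] sampled at the
   points [log n] with weights [1/n], whereas the norm above is the Sobolev norm
   of [G] on the half-line.  Comparing sum and integral block by block shows that
   [C_T] is bounded; [C_omega] is bounded by Pick's inequality, which is obtained
   from a discrete Cauchy formula.  [C_phi] is [C_omega C_T] followed by the
   isometry [z^k -> 2^(-ks)], whence the upper bound and the compactness.

   For the lower bound, a functional [sum b_j f(z_j)] annihilating the range of
   an operator of rank [< n] reduces the problem to bounding from below the
   samples of [G] at [log n], [n >= N].  By interpolation the integral of [|G|^2]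
   over [x >= log N] is large, and the samples reproduce it up to a relative error
   which is small as soon as [N] exceeds a power of the interpolation constant;
   this requires [sum (1 - |w_j|^2) <= C M^2], which follows by testing the
   interpolation property on the residues of the inverse Blaschke product. *)

Require Import Defs.
From Stdlib Require Import Reals Lra Lia List ClassicalEpsilon.
From Coquelicot Require Import Coquelicot.
Open Scope R_scope.

(** Neither boundary values nor integrals are taken, so a Hardy function has to be rebuilt from its
    point values. The tool is a membership criterion: h belongs to the space when finite
    combinations of its values are bounded by the norms of the corresponding kernel combinations.
    The coefficients are then limits of discrete Cauchy sums, and the same sums give uniqueness. For
    [C_omega] one must sum |sum b_j omega(w_j)^k|^2 over all k. Pick's inequality with the extra
    point 0 controls a defect at each k, and the defects telescope along the powers of omega. The
    distance from omega(D) to -1 confines the u_j to a disc |u| <= B. This is used twice: exp(- u x)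
    varies by O(B/m) between log m and log(m+1), and at x = log N it has not fallen below N^(-B).
    The second fact fixes the exponent: the sampling error needs N of order M^4, one M^2 from the
    Riesz bound and one from the sum of the 1 - |w_j|^2. The squared estimate then loses M^2 N^(2B),
    of order M^(2 + 8B), whence A = 1 + 4B. *)

Lemma Cconj_R (r : R) : Cconj r = r.
Proof. unfold Cconj, RtoC; simpl; f_equal; ring. Qed.

Lemma Cconj_0 : Cconj 0 = 0.
Proof. apply Cconj_R. Qed.

Lemma Cconj_1 : Cconj 1 = 1.
Proof. apply Cconj_R. Qed.

Lemma Cconj_neq0 (a : C) : a <> 0 -> Cconj a <> 0.
Proof. intros H E; apply H; rewrite <- (Cconj_conj a), E; apply Cconj_0. Qed.

Lemma RtoC_neq0 (r : R) : r <> 0 -> RtoC r <> 0.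
Proof. intros H E; apply H, RtoC_inj, E. Qed.

(** * Finite sums over lists *)

Definition csum {A : Type} (f : A -> C) (l : list A) : C :=
  fold_right (fun a s => (f a + s)%C) (RtoC 0) l.
Definition rsum {A : Type} (f : A -> R) (l : list A) : R :=
  fold_right (fun a s => f a + s) 0 l.

Lemma csum_ext_in {A} (f g : A -> C) l :
  (forall a, In a l -> f a = g a) -> csum f l = csum g l.
Proof.
induction l as [|a l IH]; simpl; intros H; [reflexivity|].
rewrite (H a), IH; auto.
Qed.

Lemma csum_ext {A} (f g : A -> C) l : (forall a, f a = g a) -> csum f l = csum g l.
Proof. intros H; apply csum_ext_in; auto. Qed.

Lemma rsum_ext_in {A} (f g : A -> R) l :
  (forall a, In a l -> f a = g a) -> rsum f l = rsum g l.
Proof.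
induction l as [|a l IH]; simpl; intros H; [reflexivity|].
rewrite (H a), IH; auto.
Qed.

Lemma rsum_ext {A} (f g : A -> R) l : (forall a, f a = g a) -> rsum f l = rsum g l.
Proof. intros H; apply rsum_ext_in; auto. Qed.

Lemma csum_app {A} (f : A -> C) l l' : csum f (l ++ l') = (csum f l + csum f l')%C.
Proof. induction l as [|a l IH]; simpl; [ring | rewrite IH; ring]. Qed.

Lemma rsum_app {A} (f : A -> R) l l' : rsum f (l ++ l') = rsum f l + rsum f l'.
Proof. induction l as [|a l IH]; simpl; [ring | rewrite IH; ring]. Qed.

Lemma csum_map {A B} (h : A -> B) (f : B -> C) l :
  csum f (map h l) = csum (fun a => f (h a)) l.
Proof. induction l as [|a l IH]; simpl; [ring | rewrite IH; ring]. Qed.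

Lemma rsum_map {A B} (h : A -> B) (f : B -> R) l :
  rsum f (map h l) = rsum (fun a => f (h a)) l.
Proof. induction l as [|a l IH]; simpl; [ring | rewrite IH; ring]. Qed.

Lemma csum_plus {A} (f g : A -> C) l :
  csum (fun a => (f a + g a)%C) l = (csum f l + csum g l)%C.
Proof. induction l as [|a l IH]; simpl; [ring | rewrite IH; ring]. Qed.

Lemma rsum_plus {A} (f g : A -> R) l :
  rsum (fun a => f a + g a) l = rsum f l + rsum g l.
Proof. induction l as [|a l IH]; simpl; [ring | rewrite IH; ring]. Qed.

Lemma csum_scal {A} (c : C) (f : A -> C) l :
  csum (fun a => (c * f a)%C) l = (c * csum f l)%C.
Proof. induction l as [|a l IH]; simpl; [ring | rewrite IH; ring]. Qed.

Lemma rsum_scal {A} (c : R) (f : A -> R) l :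
  rsum (fun a => c * f a) l = c * rsum f l.
Proof. induction l as [|a l IH]; simpl; [ring | rewrite IH; ring]. Qed.

Lemma csum_scal_r {A} (c : C) (f : A -> C) l :
  csum (fun a => (f a * c)%C) l = (csum f l * c)%C.
Proof. induction l as [|a l IH]; simpl; [ring | rewrite IH; ring]. Qed.

Lemma csum_minus {A} (f g : A -> C) l :
  csum (fun a => (f a - g a)%C) l = (csum f l - csum g l)%C.
Proof. induction l as [|a l IH]; simpl; [ring | rewrite IH; ring]. Qed.

Lemma csum_0 {A} (l : list A) : csum (fun _ => RtoC 0) l = RtoC 0.
Proof. induction l as [|a l IH]; simpl; [ring | rewrite IH; ring]. Qed.

Lemma csum_switch {A B} (f : A -> B -> C) l l' :
  csum (fun a => csum (fun b => f a b) l') l = csum (fun b => csum (fun a => f a b) l) l'.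
Proof.
induction l as [|a l IH]; simpl.
  rewrite csum_0; reflexivity.
rewrite IH, <- csum_plus; reflexivity.
Qed.

Lemma rsum_const {A} (c : R) (l : list A) : rsum (fun _ => c) l = INR (length l) * c.
Proof.
induction l as [|a l IH]; cbn [rsum fold_right length]; [simpl; ring|].
change (fold_right _ 0 l) with (rsum (fun _ => c) l).
rewrite IH, S_INR; ring.
Qed.

Lemma csum_conj {A} (f : A -> C) l : Cconj (csum f l) = csum (fun a => Cconj (f a)) l.
Proof.
induction l as [|a l IH]; simpl.
  unfold Cconj; simpl; rewrite Ropp_0; reflexivity.
rewrite Cplus_conj, IH; reflexivity.
Qed.

Lemma csum_mult {A B} (f : A -> C) (g : B -> C) l l' :
  (csum f l * csum g l')%C = csum (fun a => csum (fun b => (f a * g b)%C) l') l.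
Proof.
rewrite <- csum_scal_r; apply csum_ext; intros a.
rewrite csum_scal; reflexivity.
Qed.

Lemma Re_csum {A} (f : A -> C) l : Re (csum f l) = rsum (fun a => Re (f a)) l.
Proof. induction l as [|a l IH]; simpl; [reflexivity | rewrite <- IH; reflexivity]. Qed.

Lemma Im_csum {A} (f : A -> C) l : Im (csum f l) = rsum (fun a => Im (f a)) l.
Proof. induction l as [|a l IH]; simpl; [reflexivity | rewrite <- IH; reflexivity]. Qed.

Lemma RtoC_rsum {A} (f : A -> R) l : RtoC (rsum f l) = csum (fun a => RtoC (f a)) l.
Proof.
induction l as [|a l IH]; simpl; [reflexivity|].
rewrite RtoC_plus, <- IH; reflexivity.
Qed.

Lemma rsum_seq_S (f : nat -> R) n : rsum f (seq 0 (S n)) = rsum f (seq 0 n) + f n.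
Proof. rewrite seq_S, rsum_app; simpl; ring. Qed.

Lemma csum_seq_S (f : nat -> C) n : csum f (seq 0 (S n)) = (csum f (seq 0 n) + f n)%C.
Proof. rewrite seq_S, csum_app; simpl; ring. Qed.

Lemma csum_seq_S_l (f : nat -> C) n :
  csum f (seq 0 (S n)) = (f 0%nat + csum f (seq 1 n))%C.
Proof. reflexivity. Qed.

Lemma rsum_le_in {A} (f g : A -> R) l :
  (forall a, In a l -> f a <= g a) -> rsum f l <= rsum g l.
Proof.
induction l as [|a l IH]; simpl; intros H; [lra|].
apply Rplus_le_compat; auto.
Qed.

Lemma rsum_le {A} (f g : A -> R) l : (forall a, f a <= g a) -> rsum f l <= rsum g l.
Proof. intros H; apply rsum_le_in; auto. Qed.

Lemma rsum_ge0_in {A} (f : A -> R) l : (forall a, In a l -> 0 <= f a) -> 0 <= rsum f l.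
Proof.
induction l as [|a l IH]; simpl; intros H; [lra|].
apply Rplus_le_le_0_compat; auto.
Qed.

Lemma rsum_ge0 {A} (f : A -> R) l : (forall a, 0 <= f a) -> 0 <= rsum f l.
Proof. intros H; apply rsum_ge0_in; auto. Qed.

Lemma rsum_term_le {A} (f : A -> R) l a :
  (forall a, In a l -> 0 <= f a) -> In a l -> f a <= rsum f l.
Proof.
induction l as [|b l IH]; simpl; intros H Ha; [tauto|].
destruct Ha as [<- | Ha].
  assert (0 <= rsum f l) by (apply rsum_ge0_in; auto); unfold rsum in *; lra.
assert (0 <= f b) by auto.
assert (f a <= rsum f l) by auto; unfold rsum in *; lra.
Qed.

Lemma Cmod_csum {A} (f : A -> C) l : Cmod (csum f l) <= rsum (fun a => Cmod (f a)) l.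
Proof.
induction l as [|a l IH]; simpl; [rewrite Cmod_0; lra|].
eapply Rle_trans; [apply Cmod_triangle|].
apply Rplus_le_compat_l, IH.
Qed.

Lemma rsum_cauchy {A} (f g : A -> R) l :
  rsum (fun a => f a * g a) l ^ 2 <= rsum (fun a => f a ^ 2) l * rsum (fun a => g a ^ 2) l.
Proof.
induction l as [|a l IH]; [simpl; lra|].
assert (H1 : 0 <= rsum (fun a => f a ^ 2) l) by (apply rsum_ge0; intros; apply pow2_ge_0).
assert (H2 : 0 <= rsum (fun a => g a ^ 2) l) by (apply rsum_ge0; intros; apply pow2_ge_0).
cbn [rsum fold_right].
change (fold_right _ 0 l) with (rsum (fun a => f a * g a) l) at 1.
change (fold_right (fun a s => f a ^ 2 + s) 0 l) with (rsum (fun a => f a ^ 2) l).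
change (fold_right (fun a s => g a ^ 2 + s) 0 l) with (rsum (fun a => g a ^ 2) l).
revert IH H1 H2.
generalize (rsum (fun a => f a * g a) l) (rsum (fun a => f a ^ 2) l)
  (rsum (fun a => g a ^ 2) l) (f a) (g a); intros s F G x y IH HF HG.
(* The cross term: by the induction hypothesis the square of the left side is at most 4 x^2 y^2 F G,
   and (F y^2 + G x^2)^2 exceeds this by a square. *)
assert (H3 : 2 * (x * y) * s <= F * y ^ 2 + G * x ^ 2).
  apply Rsqr_incr_0_var.
    rewrite !Rsqr_pow2.
    apply Rle_trans with (4 * (x * y) ^ 2 * (F * G)).
      replace ((2 * (x * y) * s) ^ 2) with (4 * (x * y) ^ 2 * s ^ 2) by ring.
      apply Rmult_le_compat_l; [|exact IH].
      apply Rmult_le_pos; [lra | apply pow2_ge_0].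
    assert (0 <= (F * y ^ 2 - G * x ^ 2) ^ 2) by apply pow2_ge_0.
    nra.
  apply Rplus_le_le_0_compat; apply Rmult_le_pos; auto; apply pow2_ge_0.
nra.
Qed.

Lemma csum_cauchy {A} (f g : A -> C) l :
  Cmod (csum (fun a => (f a * g a)%C) l) ^ 2
  <= rsum (fun a => Cmod (f a) ^ 2) l * rsum (fun a => Cmod (g a) ^ 2) l.
Proof.
eapply Rle_trans; [|apply rsum_cauchy].
apply pow_incr; split; [apply Cmod_ge_0|].
eapply Rle_trans; [apply Cmod_csum|].
apply rsum_le; intros a; rewrite Cmod_mult; lra.
Qed.

(** * Complex limits and series *)

(** Phrased through the real sequence of distances, so that squeezing and comparison of real limits
    apply as they stand. *)
Definition climit (u : nat -> C) (l : C) : Prop :=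
  is_lim_seq (fun n => Cmod (u n - l)) 0.

Lemma lim0_le (u v : nat -> R) :
  (forall n, 0 <= u n <= v n) -> is_lim_seq v 0 -> is_lim_seq u 0.
Proof.
intros H Hv; apply (is_lim_seq_le_le (fun _ => 0) u v); auto.
apply is_lim_seq_const.
Qed.

Lemma climit_ext (u v : nat -> C) l : (forall n, u n = v n) -> climit u l -> climit v l.
Proof.
intros H; apply is_lim_seq_ext; intros n; rewrite H; reflexivity.
Qed.

Lemma climit_const (c : C) : climit (fun _ => c) c.
Proof.
apply is_lim_seq_ext with (fun _ => 0); [|apply is_lim_seq_const].
intros n; replace (c - c)%C with (RtoC 0) by ring; rewrite Cmod_0; reflexivity.
Qed.

Lemma climit_plus u v l m :
  climit u l -> climit v m -> climit (fun n => (u n + v n)%C) (l + m).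
Proof.
intros Hu Hv; apply lim0_le with (fun n => Cmod (u n - l) + Cmod (v n - m)).
  intros n; split; [apply Cmod_ge_0|].
  replace (u n + v n - (l + m))%C with ((u n - l) + (v n - m))%C by ring.
  apply Cmod_triangle.
rewrite <- (Rplus_0_l 0); apply is_lim_seq_plus'; assumption.
Qed.

Lemma climit_scal u l (c : C) : climit u l -> climit (fun n => (c * u n)%C) (c * l).
Proof.
intros Hu; apply is_lim_seq_ext with (fun n => Cmod c * Cmod (u n - l)).
  intros n; rewrite <- Cmod_mult; f_equal; ring.
rewrite <- (Rmult_0_r (Cmod c)).
apply (is_lim_seq_scal_l _ (Cmod c) 0 Hu).
Qed.

Lemma is_lim_seq_Re u l : climit u l -> is_lim_seq (fun n => Re (u n)) (Re l).
Proof.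
intros H; apply is_lim_seq_ext with (fun n => Re (u n - l) + Re l).
  intros n; unfold Re; simpl; ring.
rewrite <- (Rplus_0_l (Re l)) at 1.
apply is_lim_seq_plus'; [|apply is_lim_seq_const].
apply is_lim_seq_abs_0, lim0_le with (2 := H).
intros n; split; [apply Rabs_pos | apply re_le_Cmod].
Qed.

Lemma im_le_Cmod (c : C) : Rabs (Im c) <= Cmod c.
Proof. eapply Rle_trans; [|apply Rmax_Cmod]; apply Rmax_r. Qed.

Lemma is_lim_seq_Im u l : climit u l -> is_lim_seq (fun n => Im (u n)) (Im l).
Proof.
intros H; apply is_lim_seq_ext with (fun n => Im (u n - l) + Im l).
  intros n; unfold Im; simpl; ring.
rewrite <- (Rplus_0_l (Im l)) at 1.
apply is_lim_seq_plus'; [|apply is_lim_seq_const].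
apply is_lim_seq_abs_0, lim0_le with (2 := H).
intros n; split; [apply Rabs_pos | apply im_le_Cmod].
Qed.

Lemma Cmod_le_Re_Im (c : C) : Cmod c <= Rabs (Re c) + Rabs (Im c).
Proof.
replace c with (RtoC (Re c) + Ci * RtoC (Im c))%C.
  eapply Rle_trans; [apply Cmod_triangle|].
  rewrite Cmod_mult, Cmod_Ci, !Cmod_R.
  right; f_equal; [f_equal|rewrite Rmult_1_l; f_equal]; unfold Re, Im; simpl; ring.
destruct c; unfold Re, Im, Ci, RtoC, Cplus, Cmult; simpl; f_equal; ring.
Qed.

Lemma climit_Re_Im u l : is_lim_seq (fun n => Re (u n)) (Re l) ->
  is_lim_seq (fun n => Im (u n)) (Im l) -> climit u l.
Proof.
intros H1 H2; apply lim0_le with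
  (fun n => Rabs (Re (u n) - Re l) + Rabs (Im (u n) - Im l)).
  intros n; split; [apply Cmod_ge_0|].
  eapply Rle_trans; [apply Cmod_le_Re_Im|].
  right; f_equal; f_equal; unfold Re, Im; simpl; ring.
rewrite <- (Rplus_0_l 0); apply is_lim_seq_plus'.
  apply is_lim_seq_abs_0 with (u := fun n => Re (u n) - Re l).
  rewrite <- (Rminus_diag_eq (Re l) (Re l) eq_refl).
  apply is_lim_seq_minus'; [exact H1 | apply is_lim_seq_const].
apply is_lim_seq_abs_0 with (u := fun n => Im (u n) - Im l).
rewrite <- (Rminus_diag_eq (Im l) (Im l) eq_refl).
apply is_lim_seq_minus'; [exact H2 | apply is_lim_seq_const].
Qed.

Lemma climit_Cmod u l : climit u l -> is_lim_seq (fun n => Cmod (u n)) (Cmod l).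
Proof.
intros H; apply is_lim_seq_ext with (fun n => (Cmod (u n) - Cmod l) + Cmod l).
  intros n; ring.
rewrite <- (Rplus_0_l (Cmod l)) at 1.
apply is_lim_seq_plus'; [|apply is_lim_seq_const].
apply is_lim_seq_abs_0, lim0_le with (2 := H).
intros n; split; [apply Rabs_pos|].
apply Rabs_le; split.
  assert (Cmod l <= Cmod (u n) + Cmod (u n - l)); [|lra].
  replace l with (u n + - (u n - l))%C at 1 by ring.
  eapply Rle_trans; [apply Cmod_triangle|]; rewrite Cmod_opp; lra.
replace (u n) with (l + (u n - l))%C at 1 by ring.
assert (H3 := Cmod_triangle l (u n - l)); lra.
Qed.

Lemma climit_unique u l m : climit u l -> climit u m -> l = m.
Proof.
intros H1 H2.
assert (E1 := is_lim_seq_Re _ _ H1); assert (E2 := is_lim_seq_Re _ _ H2).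
assert (E3 := is_lim_seq_Im _ _ H1); assert (E4 := is_lim_seq_Im _ _ H2).
apply is_lim_seq_unique in E1, E2, E3, E4.
rewrite E1 in E2; rewrite E3 in E4; injection E2; injection E4; intros Ei Er.
destruct l, m; unfold Re, Im in *; simpl in *; congruence.
Qed.

Lemma climit_subseq u l (s : nat -> nat) :
  filterlim s eventually eventually -> climit u l -> climit (fun n => u (s n)) l.
Proof.
intros Hs Hu; exact (is_lim_seq_subseq (fun n => Cmod (u n - l)) 0 s Hs Hu).
Qed.

Lemma sum_n_rsum (a : nat -> R) n : sum_n a n = rsum a (seq 0 (S n)).
Proof.
induction n as [|n IH].
  rewrite sum_O; simpl; ring.
rewrite sum_Sn, IH, (seq_S (S n)), rsum_app; simpl; unfold plus; simpl; ring.
Qed.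

Lemma is_series_rsum (a : nat -> R) l :
  is_series a l <-> is_lim_seq (fun n => rsum a (seq 0 n)) l.
Proof.
rewrite (is_lim_seq_incr_1 (fun n => rsum a (seq 0 n))).
split; intros H.
  apply is_lim_seq_ext with (sum_n a); [intros n; apply sum_n_rsum | exact H].
unfold is_series; change (is_lim_seq (sum_n a) l).
eapply is_lim_seq_ext; [|exact H]; intros n; simpl; symmetry; apply sum_n_rsum.
Qed.

(** The n-th partial sum has [n] terms, whereas [sum_n] has [n + 1]; hence the index shifts between
    the two. *)
Definition cseries (a : nat -> C) (l : C) : Prop :=
  climit (fun n => csum a (seq 0 n)) l.

Lemma cseries_CSeries a l : cseries a l -> CSeries a = l.
Proof.
intros H; unfold CSeries.
rewrite (is_series_unique (fun n => Re (a n)) (Re l)),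
  (is_series_unique (fun n => Im (a n)) (Im l)).
- destruct l; reflexivity.
- apply is_series_rsum.
  apply is_lim_seq_ext with (fun n => Im (csum a (seq 0 n))).
    intros n; apply Im_csum.
  apply is_lim_seq_Im, H.
- apply is_series_rsum.
  apply is_lim_seq_ext with (fun n => Re (csum a (seq 0 n))).
    intros n; apply Re_csum.
  apply is_lim_seq_Re, H.
Qed.

Lemma cseries_abs (a : nat -> C) :
  ex_series (fun n => Cmod (a n)) -> cseries a (CSeries a).
Proof.
intros H; apply climit_Re_Im.
- apply is_lim_seq_ext with (fun n => rsum (fun k => Re (a k)) (seq 0 n)).
    intros n; symmetry; apply Re_csum.
  apply is_series_rsum, Series_correct.
  apply (ex_series_le (K := R_AbsRing) (V := R_CompleteNormedModule) _
    (fun n => Cmod (a n))); auto.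
  intros n; apply re_le_Cmod.
- apply is_lim_seq_ext with (fun n => rsum (fun k => Im (a k)) (seq 0 n)).
    intros n; symmetry; apply Im_csum.
  apply is_series_rsum, Series_correct.
  apply (ex_series_le (K := R_AbsRing) (V := R_CompleteNormedModule) _
    (fun n => Cmod (a n))); auto.
  intros n; apply im_le_Cmod.
Qed.

Lemma cseries_plus a b l m :
  cseries a l -> cseries b m -> cseries (fun n => (a n + b n)%C) (l + m).
Proof.
intros H1 H2; apply climit_ext with
  (fun n => csum a (seq 0 n) + csum b (seq 0 n))%C.
  intros n; symmetry; apply csum_plus.
apply climit_plus; assumption.
Qed.

Lemma cseries_scal a l (c : C) :
  cseries a l -> cseries (fun n => (c * a n)%C) (c * l).
Proof.
intros H1; apply climit_ext with (fun n => c * csum a (seq 0 n))%C.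
  intros n; symmetry; apply csum_scal.
apply climit_scal; assumption.
Qed.

Lemma cseries_ext a b l : (forall n, a n = b n) -> cseries a l -> cseries b l.
Proof.
intros H; apply climit_ext; intros n; apply csum_ext; exact H.
Qed.

Lemma cseries_csum {A} (a : A -> nat -> C) (s : A -> C) (l : list A) :
  (forall x, In x l -> cseries (a x) (s x)) ->
  cseries (fun n => csum (fun x => a x n) l) (csum s l).
Proof.
induction l as [|x l IH]; intros H; simpl.
  apply climit_ext with (fun _ => RtoC 0); [|apply climit_const].
  intros n; symmetry; apply csum_0.
apply (cseries_plus (a x)); [|apply IH]; intros; apply H; simpl; auto.
Qed.

Lemma cseries_Re a l : cseries a l -> is_series (fun n => Re (a n)) (Re l).
Proof.
intros H; apply is_series_rsum.
apply is_lim_seq_ext with (fun n => Re (csum a (seq 0 n))).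
  intros n; apply Re_csum.
apply is_lim_seq_Re, H.
Qed.

Lemma is_lim_seq_pow0 (q : R) : 0 <= q < 1 -> is_lim_seq (fun n => q ^ n) 0.
Proof. intros H; apply is_lim_seq_geom; rewrite Rabs_pos_eq; lra. Qed.

Lemma Cneq_of_Cmod (a b : C) : Cmod a <> Cmod b -> (a - b)%C <> 0.
Proof.
intros H E; apply H; f_equal.
replace a with ((a - b) + b)%C by ring; rewrite E; ring.
Qed.

Lemma csum_geom (q : C) n : (q - 1)%C <> 0 ->
  csum (fun k => (q ^ k)%C) (seq 0 n) = ((1 - q ^ n) / (1 - q))%C.
Proof.
intros Hq.
assert (Hq' : (1 - q)%C <> 0) by (intros E; apply Hq; rewrite <- Copp_0, <- E; ring).
induction n as [|n IH]; [simpl; field; exact Hq'|].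
rewrite seq_S, csum_app, IH; simpl; field; exact Hq'.
Qed.

Lemma cseries_geom (q : C) : Cmod q < 1 -> cseries (fun k => (q ^ k)%C) (/ (1 - q)).
Proof.
intros Hq.
assert (Hq1 : (q - 1)%C <> 0) by (apply Cneq_of_Cmod; rewrite Cmod_1; lra).
assert (Hq' : (1 - q)%C <> 0) by (intros E; apply Hq1; rewrite <- Copp_0, <- E; ring).
apply is_lim_seq_ext with (fun n => Cmod q ^ n * Cmod (/ (1 - q))).
  intros n; rewrite csum_geom by exact Hq1.
  rewrite <- Cmod_pow, <- Cmod_mult, <- Cmod_opp; f_equal; field; exact Hq'.
rewrite <- (Rmult_0_l (Cmod (/ (1 - q)))).
apply is_lim_seq_mult'; [|apply is_lim_seq_const].
apply is_lim_seq_pow0; split; [apply Cmod_ge_0 | exact Hq].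
Qed.

(** * The pairing of square-summable sequences *)

Lemma rsum_seq_mono (a : nat -> R) n m : (forall k, 0 <= a k) -> (n <= m)%nat ->
  rsum a (seq 0 n) <= rsum a (seq 0 m).
Proof.
intros Ha Hnm; replace m with (n + (m - n))%nat by lia.
rewrite seq_app, rsum_app.
assert (0 <= rsum a (seq (0 + n) (m - n))) by (apply rsum_ge0; auto); lra.
Qed.

Lemma rsum_le_series (a : nat -> R) l n :
  (forall k, 0 <= a k) -> is_series a l -> rsum a (seq 0 n) <= l.
Proof.
intros Ha H; apply is_series_rsum in H.
apply (is_lim_seq_incr_compare (fun n => rsum a (seq 0 n))); auto.
intros k; apply rsum_seq_mono; auto.
Qed.

Lemma is_series_le_bound (a : nat -> R) l c :
  is_series a l -> (forall n, rsum a (seq 0 n) <= c) -> l <= c.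
Proof.
intros H Hc; apply is_series_rsum in H.
apply (is_lim_seq_le (fun n => rsum a (seq 0 n)) (fun _ => c) l c); auto.
apply is_lim_seq_const.
Qed.

Lemma ex_series_bounded (a : nat -> R) c :
  (forall k, 0 <= a k) -> (forall n, rsum a (seq 0 n) <= c) -> ex_series a.
Proof.
intros Ha Hc.
destruct (ex_finite_lim_seq_incr (fun n => rsum a (seq 0 n)) c) as [l Hl]; auto.
  intros n; apply rsum_seq_mono; auto.
exists l; apply is_series_rsum, Hl.
Qed.

Lemma ell2_norm_ge0 (f : ell2) : 0 <= ell2_norm f.
Proof. apply sqrt_pos. Qed.

Lemma ell2_is_series (f : ell2) :
  is_series (fun k => Cmod (f k) ^ 2) (ell2_norm f ^ 2).
Proof. rewrite ell2_norm_sqr; apply Series_correct, coef_summable. Qed.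

Lemma ell2_partial (f : ell2) n :
  rsum (fun k => Cmod (f k) ^ 2) (seq 0 n) <= ell2_norm f ^ 2.
Proof.
apply rsum_le_series; [intros; apply pow2_ge_0 | apply ell2_is_series].
Qed.

Lemma sqr_le_inv (x y : R) : 0 <= y -> x ^ 2 <= y ^ 2 -> x <= y.
Proof. intros Hy H; apply Rsqr_incr_0_var; auto; rewrite !Rsqr_pow2; exact H. Qed.

Lemma ell2_norm_le (f : ell2) c : 0 <= c ->
  (forall n, rsum (fun k => Cmod (f k) ^ 2) (seq 0 n) <= c ^ 2) -> ell2_norm f <= c.
Proof.
intros Hc H; apply sqr_le_inv; auto.
apply is_series_le_bound with (2 := H), ell2_is_series.
Qed.

Lemma ell2_make (x : nat -> C) c : 0 <= c ->
  (forall n, rsum (fun k => Cmod (x k) ^ 2) (seq 0 n) <= c ^ 2) ->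
  exists f : ell2, (forall k, coef f k = x k) /\ ell2_norm f <= c.
Proof.
intros Hc H.
assert (Hs : ex_series (fun k => Cmod (x k) ^ 2)).
  apply ex_series_bounded with (c ^ 2); auto; intros; apply pow2_ge_0.
exists (Ell2 x Hs); split; [reflexivity | apply ell2_norm_le; auto].
Qed.

(** Bilinear, without conjugation: pairing with the sequence [comb l] is then exactly the functional
    sum b f(w). *)
Definition pair (f g : ell2) : C := CSeries (fun k => f k * g k)%C.

Lemma pair_abs (f g : ell2) : ex_series (fun k => Cmod (f k * g k)%C).
Proof.
apply ex_series_dominated with
  (fun k => / 2 * Cmod (f k) ^ 2 + / 2 * Cmod (g k) ^ 2).
  intros k; split; [apply Cmod_ge_0|].
  rewrite Cmod_mult; assert (H := pow2_ge_0 (Cmod (f k) - Cmod (g k))); lra.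
eexists; apply ell2_series_comb.
Qed.

Lemma cseries_pair (f g : ell2) : cseries (fun k => f k * g k)%C (pair f g).
Proof. apply cseries_abs, pair_abs. Qed.

Lemma climit_le u l c : climit u l -> (forall n, Cmod (u n) <= c) -> Cmod l <= c.
Proof.
intros H Hc; apply climit_Cmod in H.
apply (is_lim_seq_le (fun n => Cmod (u n)) (fun _ => c) (Cmod l) c); auto.
apply is_lim_seq_const.
Qed.

Lemma pair_le (f g : ell2) : Cmod (pair f g) <= ell2_norm f * ell2_norm g.
Proof.
apply (climit_le _ _ _ (cseries_pair f g)); intros n.
assert (Hf := ell2_norm_ge0 f); assert (Hg := ell2_norm_ge0 g).
apply sqr_le_inv; [apply Rmult_le_pos; auto|].
eapply Rle_trans; [apply csum_cauchy|].
rewrite Rpow_mult_distr.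
apply Rmult_le_compat; try apply ell2_partial;
  apply rsum_ge0; intros; apply pow2_ge_0.
Qed.

(** * Finite combinations of the power sequences *)

(* A list of pairs [(b, w)] stands for the combination [sum b (w^k)_k], which
   represents the functional [f |-> sum b f(w)] on the Hardy space. *)
Definition in_disc (l : list (C * C)) : Prop :=
  forall p, In p l -> Cmod (snd p) < 1.

Definition comb (l : list (C * C)) (k : nat) : C :=
  csum (fun p => fst p * snd p ^ k)%C l.

Definition gram (l : list (C * C)) : C :=
  csum (fun p => csum (fun q =>
    fst p * Cconj (fst q) / (1 - snd p * Cconj (snd q)))%C l) l.

Lemma Cmod_mult_lt1 (a b : C) : Cmod a < 1 -> Cmod b < 1 -> Cmod (a * b) < 1.
Proof.
intros Ha Hb; rewrite Cmod_mult.
assert (H1 := Cmod_ge_0 a); assert (H2 := Cmod_ge_0 b); nra.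
Qed.

Lemma Cmod_sqr_mult_conj (a : C) : RtoC (Cmod a ^ 2) = (a * Cconj a)%C.
Proof. apply Cmod2_conj. Qed.

(** Expanding the square turns each pair of nodes into a geometric series with ratio w_p conj(w_q),
    of modulus less than 1. *)
Lemma comb_series l : in_disc l ->
  is_series (fun k => Cmod (comb l k) ^ 2) (Re (gram l)).
Proof.
intros Hl.
apply (is_series_ext (fun k => Re (csum (fun p => csum (fun q =>
  (fst p * Cconj (fst q)) * (snd p * Cconj (snd q)) ^ k)%C l) l))).
  intros k; rewrite <- (re_RtoC (Cmod (comb l k) ^ 2)), Cmod_sqr_mult_conj.
  unfold comb; rewrite csum_conj, csum_mult; f_equal.
  apply csum_ext; intros p; apply csum_ext; intros q.
  rewrite Cmult_conj, Cpow_conj, Cpow_mult_l; ring.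
apply cseries_Re, (cseries_csum (fun p k => csum (fun q =>
  (fst p * Cconj (fst q)) * (snd p * Cconj (snd q)) ^ k)%C l)).
intros p Hp; apply (cseries_csum (fun q k =>
  (fst p * Cconj (fst q)) * (snd p * Cconj (snd q)) ^ k)%C).
intros q Hq; apply cseries_scal, cseries_geom.
apply Cmod_mult_lt1; [|rewrite Cmod_conj]; auto.
Qed.

Lemma gram_ge0 l : in_disc l -> 0 <= Re (gram l).
Proof.
intros Hl; assert (H := comb_series l Hl).
eapply Rle_trans; [|apply (rsum_le_series _ _ 0 (fun k => pow2_ge_0 _) H)].
simpl; lra.
Qed.

Lemma comb_ell2 l : in_disc l -> exists x : ell2,
  (forall k, coef x k = comb l k) /\ ell2_norm x = sqrt (Re (gram l)).
Proof.
intros Hl; assert (H := comb_series l Hl).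
exists (Ell2 (comb l) (ex_intro _ _ H)); split; [reflexivity|].
unfold ell2_norm; simpl coef; rewrite (is_series_unique _ _ H); reflexivity.
Qed.

Lemma hardy_series (f : ell2) w : Cmod w < 1 ->
  cseries (fun k => f k * w ^ k)%C (hardy_eval f w).
Proof.
intros Hw.
destruct (comb_ell2 ((RtoC 1, w) :: nil)) as [x [Hx _]].
  intros p [<- | []]; exact Hw.
assert (E : forall k, (f k * x k)%C = (f k * w ^ k)%C).
  intros k; rewrite Hx; unfold comb; simpl; ring.
assert (H := cseries_ext _ _ _ E (cseries_pair f x)).
unfold hardy_eval; rewrite (cseries_CSeries _ _ H); exact H.
Qed.

Lemma comb_pair (f x : ell2) l : in_disc l -> (forall k, coef x k = comb l k) ->
  csum (fun p => fst p * hardy_eval f (snd p))%C l = pair f x.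
Proof.
intros Hl Hx; refine (climit_unique _ _ _ _ (cseries_pair f x)).
apply climit_ext with
  (fun n => csum (fun k => csum (fun p => fst p * (f k * snd p ^ k))%C l) (seq 0 n)).
  intros n; apply csum_ext; intros k; rewrite Hx; unfold comb.
  rewrite <- csum_scal; apply csum_ext; intros p; ring.
apply (cseries_csum (fun p k => fst p * (f k * snd p ^ k))%C).
intros p Hp; apply cseries_scal, hardy_series; auto.
Qed.

Lemma comb_bound (f : ell2) l : in_disc l ->
  Cmod (csum (fun p => fst p * hardy_eval f (snd p))%C l)
  <= ell2_norm f * sqrt (Re (gram l)).
Proof.
intros Hl; destruct (comb_ell2 l Hl) as [x [Hx <-]].
rewrite (comb_pair f x) by assumption; apply pair_le.
Qed.

(** * Roots of unity *)

Definition cis (t : R) : C := (cos t, sin t).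

Lemma cis_plus a b : cis (a + b) = (cis a * cis b)%C.
Proof.
unfold cis, Cmult; simpl; rewrite cos_plus, sin_plus; f_equal; ring.
Qed.

Lemma cis_0 : cis 0 = RtoC 1.
Proof. unfold cis; rewrite cos_0, sin_0; reflexivity. Qed.

Lemma cis_pow t n : (cis t ^ n)%C = cis (INR n * t).
Proof.
induction n as [|n IH].
  simpl; rewrite Rmult_0_l, cis_0; reflexivity.
cbn [Cpow]; rewrite IH, <- cis_plus, S_INR; f_equal; ring.
Qed.

Lemma Cmod_cis t : Cmod (cis t) = 1.
Proof.
unfold Cmod, cis; simpl fst; simpl snd.
replace (cos t ^ 2 + sin t ^ 2) with 1; [apply sqrt_1|].
assert (H := sin2_cos2 t); unfold Rsqr in H; lra.
Qed.

Lemma cis_conj t : Cconj (cis t) = cis (- t).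
Proof. unfold Cconj, cis; simpl; rewrite cos_neg, sin_neg; reflexivity. Qed.

(** From cos t = 1 - 2 sin(t/2)^2 and the positivity of the sine on (0, pi). *)
Lemma cis_neq1 t : 0 < Rabs t < 2 * PI -> (cis t - 1)%C <> 0.
Proof.
intros Ht E.
assert (E1 : cos t = 1).
  assert (E2 := f_equal fst E); unfold cis in E2; simpl in E2; lra.
assert (E3 : cos (Rabs t) = 1).
  unfold Rabs; destruct (Rcase_abs t); [rewrite cos_neg|]; exact E1.
replace (Rabs t) with (2 * (Rabs t / 2)) in E3 by field.
rewrite cos_2a_sin in E3.
assert (H : 0 < sin (Rabs t / 2)) by (apply sin_gt_0; lra).
nra.
Qed.

Definition zeta (N : nat) : C := cis (2 * PI / INR N).

Lemma Cmod_zeta N : Cmod (zeta N) = 1.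
Proof. apply Cmod_cis. Qed.

Lemma Cmod_zeta_pow N j : Cmod (zeta N ^ j) = 1.
Proof. rewrite Cmod_pow, Cmod_zeta; apply pow1. Qed.

Lemma zeta_pow_N N : (0 < N)%nat -> (zeta N ^ N)%C = 1.
Proof.
intros HN; unfold zeta; rewrite cis_pow.
replace (INR N * (2 * PI / INR N)) with (2 * PI).
  unfold cis; rewrite cos_2PI, sin_2PI; reflexivity.
field; apply not_0_INR; lia.
Qed.

Lemma zeta_mult_conj N : (zeta N * Cconj (zeta N))%C = 1.
Proof. rewrite <- Cmod_sqr_mult_conj, Cmod_zeta; f_equal; ring. Qed.

Lemma zeta_pow_conj_1 N j : (zeta N ^ j * Cconj (zeta N) ^ j)%C = 1.
Proof. rewrite <- Cpow_mult_l, zeta_mult_conj; apply Cpow_1_l. Qed.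

(** Orthogonality of characters: a geometric sum whose ratio q differs from 1 and satisfies q^N =
    1. *)
Lemma zeta_sum_0 N m k : (m < N)%nat -> (k < N)%nat -> m <> k ->
  csum (fun j => (Cconj (zeta N) ^ (j * k) * zeta N ^ (j * m))%C) (seq 0 N) = 0.
Proof.
intros Hm Hk Hmk.
set (q := (Cconj (zeta N) ^ k * zeta N ^ m)%C).
rewrite (csum_ext _ (fun j => q ^ j)%C).
2:{ intros j; unfold q; rewrite Cpow_mult_l, <- !Cpow_mult_r; do 2 f_equal; lia. }
assert (HN : 0 < INR N) by (apply lt_0_INR; lia).
assert (Eq : q = cis ((INR m - INR k) * (2 * PI / INR N))).
  unfold q, zeta; rewrite cis_conj, !cis_pow, <- cis_plus; f_equal; ring.
assert (Hq : (q - 1)%C <> 0).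
  rewrite Eq; apply cis_neq1.
  assert (HPI := PI_RGT_0).
  assert (Hd : 0 < 2 * PI / INR N) by (apply Rdiv_lt_0_compat; lra).
  rewrite Rabs_mult, (Rabs_pos_eq (2 * PI / INR N)) by lra.
  assert (Hmk' : INR m - INR k <> 0) by (intros E; apply Hmk, INR_eq; lra).
  split; [apply Rmult_lt_0_compat; auto; apply Rabs_pos_lt; auto|].
  replace (2 * PI) with (INR N * (2 * PI / INR N)) at 2 by (field; lra).
  apply Rmult_lt_compat_r; auto.
  assert (0 <= INR m) by apply pos_INR; assert (0 <= INR k) by apply pos_INR.
  apply lt_INR in Hm, Hk; apply Rabs_def1; lra.
rewrite csum_geom by exact Hq.
replace (q ^ N)%C with (RtoC 1).
  unfold Cdiv; replace (1 - 1)%C with (RtoC 0) by ring; ring.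
unfold q; rewrite Cpow_mult_l, <- !Cpow_mult_r, (Nat.mul_comm k), (Nat.mul_comm m),
  !Cpow_mult_r, <- Cpow_conj, zeta_pow_N, Cpow_1_l by lia.
rewrite Cconj_1.
rewrite Cpow_1_l; ring.
Qed.

Lemma csum_const {A} (c : C) (l : list A) :
  csum (fun _ => c) l = (RtoC (INR (length l)) * c)%C.
Proof.
induction l as [|a l IH]; [simpl; ring|].
change (csum (fun _ => c) (a :: l)) with (c + csum (fun _ => c) l)%C.
rewrite IH; cbn [length]; rewrite S_INR, RtoC_plus; ring.
Qed.

Lemma zeta_sum_diag N k :
  csum (fun j => (Cconj (zeta N) ^ (j * k) * zeta N ^ (j * k))%C) (seq 0 N) = INR N.
Proof.
rewrite (csum_ext _ (fun _ => RtoC 1)).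
  rewrite csum_const, length_seq; ring.
intros j; rewrite Cmult_comm; apply zeta_pow_conj_1.
Qed.

(** * Functions dominated by the Hardy kernel *)

Definition seq_bound (x : nat -> C) (B : R) : Prop :=
  forall n, rsum (fun k => Cmod (x k) ^ 2) (seq 0 n) <= B ^ 2.

Lemma seq_bound_ext x y B : (forall k, x k = y k) -> seq_bound x B -> seq_bound y B.
Proof.
intros E H n; rewrite (rsum_ext _ (fun k => Cmod (x k) ^ 2)); [apply H|].
intros k; rewrite E; reflexivity.
Qed.

Lemma seq_bound_plus x y A B : 0 <= A -> 0 <= B -> seq_bound x A -> seq_bound y B ->
  seq_bound (fun k => x k + y k)%C (A + B).
Proof.
intros HA HB Hx Hy.
destruct (ell2_make x A HA Hx) as [f [Ef Hf]].
destruct (ell2_make y B HB Hy) as [g [Eg Hg]].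
intros n; apply Rle_trans with (ell2_norm (ell2_plus f g) ^ 2).
  eapply Rle_trans; [|apply (ell2_partial (ell2_plus f g) n)].
  right; apply rsum_ext; intros k; simpl coef; rewrite Ef, Eg; reflexivity.
apply pow_incr; split; [apply ell2_norm_ge0|].
eapply Rle_trans; [apply ell2_norm_triangle | lra].
Qed.

Lemma seq_bound_scal x A (c : C) : seq_bound x A ->
  seq_bound (fun k => c * x k)%C (Cmod c * A).
Proof.
intros Hx n.
rewrite (rsum_ext _ (fun k => Cmod c ^ 2 * Cmod (x k) ^ 2)).
  rewrite rsum_scal, Rpow_mult_distr.
  apply Rmult_le_compat_l; [apply pow2_ge_0 | apply Hx].
intros k; rewrite Cmod_mult, Rpow_mult_distr; reflexivity.
Qed.

Lemma seq_bound_csum {T} (x : T -> nat -> C) (A : T -> R) (l : list T) :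
  (forall t, In t l -> 0 <= A t /\ seq_bound (x t) (A t)) ->
  seq_bound (fun k => csum (fun t => x t k) l) (rsum A l).
Proof.
induction l as [|t l IH]; intros H.
  intros n; simpl; rewrite (rsum_ext _ (fun _ => 0)).
    rewrite rsum_const; lra.
  intros k; rewrite Cmod_0; simpl; ring.
change (seq_bound (fun k => x t k + csum (fun t => x t k) l)%C (A t + rsum A l)).
apply seq_bound_plus.
- apply H; left; reflexivity.
- apply rsum_ge0_in; intros; apply H; right; assumption.
- apply H; left; reflexivity.
- apply IH; intros; apply H; right; assumption.
Qed.

(** The error estimate shared by two truncations: the aliasing of the discrete Cauchy sums, with q =
    1/2, and the tail of the power sequence of a point w, with q = |w|. *)
Lemma seq_bound_tail (x : nat -> C) A q N : 0 <= A -> 0 <= q < 1 ->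
  (forall m, (m < N)%nat -> x m = 0) ->
  (forall m, (N <= m)%nat -> Cmod (x m) <= A * q ^ m) ->
  seq_bound x (A * q ^ N / sqrt (1 - q ^ 2)).
Proof.
intros HA Hq H0 H1 n.
assert (Hq2 : 0 < 1 - q ^ 2) by nra.
assert (HsN : 0 < sqrt (1 - q ^ 2)) by (apply sqrt_lt_R0; auto).
replace ((A * q ^ N / sqrt (1 - q ^ 2)) ^ 2) with (A ^ 2 * (q ^ N) ^ 2 / (1 - q ^ 2)).
2:{ rewrite <- (pow2_sqrt (1 - q ^ 2)) at 1 by lra. field; lra. }
destruct (Nat.le_gt_cases n N) as [Hn | Hn].
  rewrite (rsum_ext_in _ (fun _ => 0)).
    rewrite rsum_const, Rmult_0_r; apply Rmult_le_pos.
      apply Rmult_le_pos; apply pow2_ge_0.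
    left; apply Rinv_0_lt_compat; auto.
  intros k Hk; apply in_seq in Hk; rewrite H0 by lia; rewrite Cmod_0; simpl; ring.
assert (H : rsum (fun k => Cmod (x k) ^ 2) (seq 0 n)
  <= A ^ 2 * ((q ^ N) ^ 2 - (q ^ n) ^ 2) / (1 - q ^ 2)).
  assert (Hind : forall d, rsum (fun k => Cmod (x k) ^ 2) (seq 0 (N + d))
    <= A ^ 2 * ((q ^ N) ^ 2 - (q ^ (N + d)) ^ 2) / (1 - q ^ 2)).
    induction d as [|d IH].
      rewrite Nat.add_0_r; replace ((q ^ N) ^ 2 - (q ^ N) ^ 2) with 0 by ring.
      rewrite (rsum_ext_in _ (fun _ => 0)).
        rewrite rsum_const; unfold Rdiv; lra.
      intros k Hk; apply in_seq in Hk; rewrite H0 by lia; rewrite Cmod_0; simpl; ring.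
    replace (N + S d)%nat with (S (N + d)) by lia.
    rewrite seq_S, rsum_app; cbn [rsum fold_right].
    assert (Hx : Cmod (x (0 + (N + d))%nat) ^ 2 <= (A * q ^ (N + d)) ^ 2).
      apply pow_incr; split; [apply Cmod_ge_0 | apply H1; lia].
    replace (A ^ 2 * ((q ^ N) ^ 2 - (q ^ S (N + d)) ^ 2) / (1 - q ^ 2)) with
      (A ^ 2 * ((q ^ N) ^ 2 - (q ^ (N + d)) ^ 2) / (1 - q ^ 2) + (A * q ^ (N + d)) ^ 2).
      lra.
    simpl (q ^ S (N + d)); field; lra.
  replace n with (N + (n - N))%nat by lia; apply Hind.
eapply Rle_trans; [exact H|].
apply Rmult_le_compat_r; [left; apply Rinv_0_lt_compat; auto|].
apply Rmult_le_compat_l; [apply pow2_ge_0|].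
assert (H2 := pow2_ge_0 (q ^ n)); lra.
Qed.

Lemma comb_app l l' k : comb (l ++ l') k = (comb l k + comb l' k)%C.
Proof. apply csum_app. Qed.

Definition lscal (c : C) (l : list (C * C)) : list (C * C) :=
  map (fun p => ((c * fst p)%C, snd p)) l.

Lemma csum_lscal (c : C) (h : C -> C) l :
  csum (fun p => fst p * h (snd p))%C (lscal c l)
  = (c * csum (fun p => fst p * h (snd p)) l)%C.
Proof.
unfold lscal; rewrite csum_map, <- csum_scal; apply csum_ext; intros p; simpl; ring.
Qed.

Lemma comb_lscal c l k : comb (lscal c l) k = (c * comb l k)%C.
Proof. apply (csum_lscal c (fun w => w ^ k)%C). Qed.

Lemma csum_flat_map {A B} (f : A -> list B) (g : B -> C) l :
  csum g (flat_map f l) = csum (fun a => csum g (f a)) l.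
Proof.
induction l as [|a l IH]; simpl; [reflexivity|].
rewrite csum_app, IH; reflexivity.
Qed.

Lemma in_disc_lscal c l : in_disc l -> in_disc (lscal c l).
Proof.
intros H p Hp; apply in_map_iff in Hp; destruct Hp as [q [<- Hq]]; exact (H q Hq).
Qed.

Lemma in_disc_app l l' : in_disc l -> in_disc l' -> in_disc (l ++ l').
Proof. intros H H' p Hp; apply in_app_iff in Hp; destruct Hp; auto. Qed.

Lemma in_disc_flat_map {A} (f : A -> list (C * C)) l :
  (forall a, in_disc (f a)) -> in_disc (flat_map f l).
Proof.
intros H p Hp; apply in_flat_map in Hp; destruct Hp as [a [_ Ha]]; exact (H a p Ha).
Qed.

(* A discrete Cauchy integral over the circle of radius 1/2, which converges to
   the functional extracting the Taylor coefficient number [k]. *)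
Definition coef_comb (k N : nat) : list (C * C) :=
  map (fun j => ((RtoC (2 ^ k / INR N) * Cconj (zeta N) ^ (j * k))%C,
                 (RtoC (/ 2) * zeta N ^ j)%C)) (seq 0 N).

Lemma in_disc_coef_comb k N : in_disc (coef_comb k N).
Proof.
intros p Hp; apply in_map_iff in Hp; destruct Hp as [j [<- _]]; simpl.
rewrite Cmod_mult, Cmod_zeta_pow, Cmod_R, Rabs_pos_eq; lra.
Qed.

Lemma comb_coef_comb k N m : comb (coef_comb k N) m =
  (RtoC (2 ^ k / INR N * (/ 2) ^ m) *
    csum (fun j => Cconj (zeta N) ^ (j * k) * zeta N ^ (j * m)) (seq 0 N))%C.
Proof.
unfold comb, coef_comb; rewrite csum_map, <- csum_scal; apply csum_ext; intros j; simpl.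
rewrite Cpow_mult_l, <- Cpow_mult_r, RtoC_mult, RtoC_pow; ring.
Qed.

Definition delta_seq (k m : nat) : C := if Nat.eqb m k then RtoC 1 else RtoC 0.

(** Below index N the roots of unity select m = k exactly. The indices m >= N are aliased, but the
    radius 1/2 leaves their entries at most 2^k / 2^m. *)
Lemma coef_comb_bound k N : (k < N)%nat ->
  seq_bound (fun m => comb (coef_comb k N) m - delta_seq k m)%C
    (2 ^ k * (/ 2) ^ N / sqrt (1 - (/ 2) ^ 2)).
Proof.
intros Hk; assert (HN : 0 < INR N) by (apply lt_0_INR; lia).
apply seq_bound_tail; [apply pow_le; lra | lra | |].
- intros m Hm; rewrite comb_coef_comb; unfold delta_seq.
  destruct (Nat.eqb_spec m k) as [-> | Hmk].
    rewrite zeta_sum_diag, <- RtoC_mult, <- RtoC_minus; f_equal.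
    rewrite pow_inv; field; split; [apply pow_nonzero; lra | lra].
  rewrite zeta_sum_0 by auto; ring.
- intros m Hm; unfold delta_seq.
  destruct (Nat.eqb_spec m k) as [-> | Hmk]; [lia|].
  replace (comb (coef_comb k N) m - 0)%C with (comb (coef_comb k N) m) by ring.
  rewrite comb_coef_comb, Cmod_mult, Cmod_R.
  assert (H0 : 0 <= 2 ^ k / INR N * (/ 2) ^ m).
    apply Rmult_le_pos; [|apply pow_le; lra].
    apply Rmult_le_pos; [apply pow_le; lra | left; apply Rinv_0_lt_compat; auto].
  rewrite Rabs_pos_eq by exact H0.
  apply Rle_trans with (2 ^ k / INR N * (/ 2) ^ m * INR N); [|right; field; lra].
  apply Rmult_le_compat_l; [exact H0|].
  eapply Rle_trans; [apply Cmod_csum|].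
  rewrite (rsum_ext _ (fun _ => 1)), rsum_const, length_seq; [lra|].
  intros j; rewrite Cmod_mult, <- Cpow_conj, Cmod_conj, !Cmod_zeta_pow; ring.
Qed.

Lemma is_lim_half_pow (c : R) : is_lim_seq (fun N => c * (/ 2) ^ N / sqrt (1 - (/ 2) ^ 2)) 0.
Proof.
apply is_lim_seq_ext with (fun N => (c / sqrt (1 - (/ 2) ^ 2)) * (/ 2) ^ N).
  intros N; unfold Rdiv; ring.
rewrite <- (Rmult_0_r (c / sqrt (1 - (/ 2) ^ 2))).
apply (is_lim_seq_scal_l _ _ 0), is_lim_seq_pow0; lra.
Qed.

Lemma Cauchy_climit (v : nat -> C) (e : nat -> R) (N0 : nat) :
  (forall n m, (N0 <= n)%nat -> (N0 <= m)%nat -> Cmod (v n - v m) <= e n + e m) ->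
  is_lim_seq e 0 ->
  exists g, climit v g.
Proof.
intros H He.
assert (Hex : forall (f : C -> R), (forall a b, Rabs (f a - f b) <= Cmod (a - b)) ->
  ex_finite_lim_seq (fun n => f (v n))).
  intros f Hf; apply ex_lim_seq_cauchy_corr; intros eps.
  apply is_lim_seq_spec in He.
  assert (He2 : 0 < eps / 2) by (destruct eps; simpl; lra).
  destruct (He (mkposreal _ He2)) as [M HM]; simpl in HM.
  exists (Nat.max N0 M); intros n m Hn Hm.
  eapply Rle_lt_trans; [apply Hf|].
  eapply Rle_lt_trans; [apply H; lia|].
  assert (Hn2 := HM n ltac:(lia)); assert (Hm2 := HM m ltac:(lia)).
  rewrite Rminus_0_r in Hn2, Hm2.
  apply Rabs_def2 in Hn2, Hm2; lra.
destruct (Hex Re) as [x Hx].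
  intros a b; eapply Rle_trans; [|apply re_le_Cmod]; right; f_equal.
destruct (Hex Im) as [y Hy].
  intros a b; eapply Rle_trans; [|apply im_le_Cmod]; right; f_equal.
exists (x, y); apply climit_Re_Im; assumption.
Qed.

Definition functional (h : C -> C) (l : list (C * C)) : C :=
  csum (fun p => fst p * h (snd p))%C l.

Lemma is_lim_seq_rsum {A} (e : A -> nat -> R) (l : list A) :
  (forall a, is_lim_seq (e a) 0) -> is_lim_seq (fun n => rsum (fun a => e a n) l) 0.
Proof.
intros H; induction l as [|a l IH]; simpl; [apply is_lim_seq_const|].
rewrite <- (Rplus_0_l 0); apply is_lim_seq_plus'; auto.
Qed.

Section KernelDomination.

(** Boundedness of the map from [comb l] to [functional h l] in the l^2 norm; B = 0 gives its
    independence of the representing list. On the disc it characterises the Hardy functions of norm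
    at most K. *)
Definition dominated (h : C -> C) (K : R) : Prop :=
  forall l B, in_disc l -> 0 <= B -> seq_bound (comb l) B ->
  Cmod (functional h l) <= K * B.

Lemma functional_app h l l' : functional h (l ++ l') = (functional h l + functional h l')%C.
Proof. apply csum_app. Qed.

Lemma functional_lscal h c l : functional h (lscal c l) = (c * functional h l)%C.
Proof. apply csum_lscal. Qed.

Let err k N := 2 ^ k * (/ 2) ^ N / sqrt (1 - (/ 2) ^ 2).

Lemma err_ge0 k N : 0 <= err k N.
Proof.
apply Rmult_le_pos; [apply Rmult_le_pos; apply pow_le; lra|].
left; apply Rinv_0_lt_compat, sqrt_lt_R0; lra.
Qed.

(** For large n and m the sequences of [coef_comb k n] and [coef_comb k m] are both close to the
    k-th unit sequence, so domination makes the values Cauchy. The limit is the future k-th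
    coefficient. *)
Lemma dominated_coef h K k : 0 <= K -> dominated h K ->
  exists g, climit (fun N => functional h (coef_comb k N)) g.
Proof.
intros HK Hh.
apply Cauchy_climit with (e := fun N => K * err k N) (N0 := S k).
- intros n m Hn Hm.
  replace (functional h (coef_comb k n) - functional h (coef_comb k m))%C with
    (functional h (coef_comb k n ++ lscal (- (1))%C (coef_comb k m)))
    by (rewrite functional_app, functional_lscal; ring).
  rewrite <- Rmult_plus_distr_l; apply Hh.
  + apply in_disc_app; [|apply in_disc_lscal]; apply in_disc_coef_comb.
  + apply Rplus_le_le_0_compat; apply err_ge0.
  + apply seq_bound_ext with (fun j => (comb (coef_comb k n) j - delta_seq k j)
      + (- (1)) * (comb (coef_comb k m) j - delta_seq k j))%C.
      intros j; rewrite comb_app, comb_lscal; ring.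
    replace (err k m) with (Cmod (- (1)) * err k m) by (rewrite Cmod_m1; ring).
    apply seq_bound_plus; try apply err_ge0.
    * rewrite Cmod_m1, Rmult_1_l; apply err_ge0.
    * apply coef_comb_bound; lia.
    * apply seq_bound_scal, coef_comb_bound; lia.
- rewrite <- (Rmult_0_r K); apply (is_lim_seq_scal_l _ K 0), is_lim_half_pow.
Qed.

(** Domination extended to combinations that also involve coordinate functionals: each unit sequence
    is replaced by [coef_comb k N], and N tends to infinity. *)
Lemma dominated_approx h K (g c : nat -> C) M l B : 0 <= K -> dominated h K ->
  (forall k, climit (fun N => functional h (coef_comb k N)) (g k)) ->
  in_disc l -> 0 <= B ->
  seq_bound (fun m => comb l m - csum (fun k => c k * delta_seq k m) (seq 0 M))%C B ->
  Cmod (functional h l - csum (fun k => c k * g k) (seq 0 M))%C <= K * B.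
Proof.
intros HK Hh Hg Hl HB Hb.
set (X N := l ++ lscal (- (1))%C (flat_map (fun k => lscal (c k) (coef_comb k N)) (seq 0 M))).
assert (EX : forall N h', functional h' (X N) = (functional h' l
    - csum (fun k => c k * functional h' (coef_comb k N)) (seq 0 M))%C).
  intros N h'; unfold X; rewrite functional_app, functional_lscal.
  unfold functional at 2; rewrite csum_flat_map.
  rewrite (csum_ext _ (fun k => c k * functional h' (coef_comb k N))%C).
    ring.
  intros k; apply csum_lscal.
apply (is_lim_seq_le_loc (fun N => Cmod (functional h (X N)))
  (fun N => K * (B + rsum (fun k => Cmod (c k) * err k N) (seq 0 M)))
  (Cmod (functional h l - csum (fun k => c k * g k) (seq 0 M))%C) (K * B)).
- exists M; intros N HN; apply Hh.
  + apply in_disc_app, in_disc_lscal, in_disc_flat_map; auto.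
    intros k; apply in_disc_lscal, in_disc_coef_comb.
  + apply Rplus_le_le_0_compat; auto; apply rsum_ge0; intros k.
    apply Rmult_le_pos; [apply Cmod_ge_0 | apply err_ge0].
  + apply seq_bound_ext with (fun m =>
      (comb l m - csum (fun k => c k * delta_seq k m) (seq 0 M)) +
      csum (fun k => (- c k) * (comb (coef_comb k N) m - delta_seq k m)) (seq 0 M))%C.
      intros m; change (comb (X N) m) with (functional (fun w => w ^ m)%C (X N)).
      rewrite EX; change (functional (fun w => w ^ m)%C l) with (comb l m).
      rewrite (csum_ext (fun k => - c k * _)%C
        (fun k => c k * delta_seq k m - c k * comb (coef_comb k N) m)%C), csum_minus.
        change (fun k => c k * functional (fun w => w ^ m) (coef_comb k N))%C with
          (fun k => c k * comb (coef_comb k N) m)%C; ring.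
      intros k; ring.
    apply seq_bound_plus; auto.
      apply rsum_ge0; intros k; apply Rmult_le_pos; [apply Cmod_ge_0 | apply err_ge0].
    apply (seq_bound_csum (fun k m => (- c k) * (comb (coef_comb k N) m - delta_seq k m))%C
      (fun k => Cmod (c k) * err k N)).
    intros k Hk; apply in_seq in Hk; split.
      apply Rmult_le_pos; [apply Cmod_ge_0 | apply err_ge0].
    rewrite <- (Cmod_opp (c k)); apply seq_bound_scal, coef_comb_bound; lia.
- apply climit_Cmod.
  apply climit_ext with (fun N => functional h l +
    (- (1)) * csum (fun k => c k * functional h (coef_comb k N)) (seq 0 M))%C.
    intros N; rewrite EX; ring.
  replace (functional h l - csum (fun k => c k * g k) (seq 0 M))%C with
    (functional h l + (- (1)) * csum (fun k => c k * g k) (seq 0 M))%C by ring.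
  apply climit_plus; [apply climit_const|]; apply climit_scal.
  assert (Hs : forall s, climit
    (fun N => csum (fun k => c k * functional h (coef_comb k N)) s)%C
    (csum (fun k => c k * g k)%C s)).
    induction s as [|k s IH]; simpl; [apply climit_const|].
    apply climit_plus; [apply climit_scal, Hg | exact IH].
  apply Hs.
- apply (is_lim_seq_scal_l _ K B).
  rewrite <- (Rplus_0_r B) at 1; apply is_lim_seq_plus'; [apply is_lim_seq_const|].
  apply (is_lim_seq_rsum (fun k N => Cmod (c k) * err k N)); intros k.
  rewrite <- (Rmult_0_r (Cmod (c k))).
  apply (is_lim_seq_scal_l _ (Cmod (c k)) 0), is_lim_half_pow.
Qed.

Lemma csum_delta (c : nat -> C) M m :
  csum (fun k => c k * delta_seq k m)%C (seq 0 M) = if Nat.ltb m M then c m else 0.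
Proof.
induction M as [|M IH]; [reflexivity|].
rewrite seq_S, csum_app, IH; unfold delta_seq; simpl.
destruct (Nat.ltb_spec m M), (Nat.eqb_spec m M), (Nat.ltb_spec m (S M));
  subst; try lia; ring.
Qed.

(** The membership criterion. The limits [g k] are taken as coefficients; domination bounds their
    l^2 norm by duality and shows that their power series converges to h. *)
Lemma dominated_hardy h K : 0 <= K -> dominated h K ->
  exists g : ell2, ell2_norm g <= K /\ forall w, Cmod w < 1 -> hardy_eval g w = h w.
Proof.
intros HK Hh.
assert (Hc : forall k, { g | climit (fun N => functional h (coef_comb k N)) g }).
  intros k; apply constructive_indefinite_description, (dominated_coef h K); auto.
set (g k := proj1_sig (Hc k)).
assert (Hg : forall k, climit (fun N => functional h (coef_comb k N)) (g k)).
  intros k; apply (proj2_sig (Hc k)).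
destruct (ell2_make g K HK) as [f [Ef Hf]].
  intros n; set (s := rsum (fun k => Cmod (g k) ^ 2) (seq 0 n)).
  assert (Hs : 0 <= s) by (apply rsum_ge0; intros; apply pow2_ge_0).
  (* Duality: the empty list tested against the coordinates conj(g_k), k < n, yields s <= K
     sqrt(s). *)
  assert (H := dominated_approx h K g (fun k => Cconj (g k)) n nil (sqrt s) HK Hh Hg).
  assert (H1 : s <= K * sqrt s).
    replace s with (Cmod (functional h nil - csum (fun k => Cconj (g k) * g k) (seq 0 n))%C)
      at 1.
      apply H; [intros p [] | apply sqrt_pos|].
      intros m; rewrite pow2_sqrt by exact Hs.
      assert (E : forall k, Cmod (comb nil k
        - csum (fun j => Cconj (g j) * delta_seq j k) (seq 0 n))%C ^ 2 =
        if Nat.ltb k n then Cmod (g k) ^ 2 else 0).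
        intros k; rewrite csum_delta; unfold comb; simpl csum.
        destruct (Nat.ltb k n).
          replace (0 - Cconj (g k))%C with (- Cconj (g k))%C by ring.
          rewrite Cmod_opp, Cmod_conj; reflexivity.
        replace (0 - 0)%C with (RtoC 0) by ring; rewrite Cmod_0; ring.
      rewrite (rsum_ext _ _ _ E); unfold s.
      apply Rle_trans with (rsum (fun k => if Nat.ltb k n then Cmod (g k) ^ 2 else 0)
        (seq 0 (Nat.max m n))).
        apply rsum_seq_mono; [|lia].
        intros k; destruct (Nat.ltb k n); [apply pow2_ge_0 | lra].
      replace (Nat.max m n) with (n + (Nat.max m n - n))%nat by lia.
      rewrite seq_app, rsum_app, (rsum_ext_in _ (fun _ => 0) (seq (0 + n) _)).
        rewrite rsum_const, Rmult_0_r, Rplus_0_r; right; apply rsum_ext_in.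
        intros k Hk; apply in_seq in Hk; destruct (Nat.ltb_spec k n); [reflexivity | lia].
      intros k Hk; apply in_seq in Hk; destruct (Nat.ltb_spec k n); [lia | reflexivity].
    unfold functional; simpl csum.
    replace (0 - csum (fun k => Cconj (g k) * g k) (seq 0 n))%C with (- RtoC s)%C.
      rewrite Cmod_opp, Cmod_R; apply Rabs_pos_eq, Hs.
    unfold s; rewrite RtoC_rsum.
    rewrite (csum_ext _ (fun k => Cconj (g k) * g k)%C); [ring|].
    intros k; rewrite Cmod_sqr_mult_conj; ring.
  assert (H2 := sqrt_sqrt s Hs); assert (H3 := sqrt_pos s).
  assert (sqrt s <= K).
    destruct (Rle_lt_dec (sqrt s) K); auto; nra.
  change (s <= K ^ 2); nra.
exists f; split; [exact Hf|].
intros w Hw; refine (climit_unique _ _ _ (hardy_series f w Hw) _).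
assert (Hw0 := Cmod_ge_0 w).
(* Evaluation at w differs from its first M coordinates by a geometric tail of norm |w|^M / sqrt(1 -
   |w|^2). *)
apply lim0_le with (fun M => K * (1 * Cmod w ^ M / sqrt (1 - Cmod w ^ 2))).
- intros M; split; [apply Cmod_ge_0|].
  rewrite <- Cmod_opp.
  replace (- (csum (fun k => f k * w ^ k) (seq 0 M) - h w))%C with
    (functional h ((RtoC 1, w) :: nil) - csum (fun k => w ^ k * g k) (seq 0 M))%C.
  + apply dominated_approx; auto.
    * intros p [<- | []]; exact Hw.
    * apply Rmult_le_pos; [apply Rmult_le_pos; [lra | apply pow_le; lra]|].
      left; apply Rinv_0_lt_compat, sqrt_lt_R0; nra.
    * apply seq_bound_tail; try lra.
      -- intros m Hm; rewrite csum_delta; destruct (Nat.ltb_spec m M); [|lia].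
         unfold comb; simpl; ring.
      -- intros m Hm; rewrite csum_delta; destruct (Nat.ltb_spec m M); [lia|].
         rewrite <- Cmod_pow; unfold comb; simpl.
         right; rewrite Rmult_1_l; f_equal; ring.
  + unfold functional; simpl.
    rewrite (csum_ext (fun k => f k * w ^ k)%C (fun k => w ^ k * g k)%C); [ring|].
    intros k; rewrite Ef; ring.
- apply is_lim_seq_ext with (fun M => (K / sqrt (1 - Cmod w ^ 2)) * Cmod w ^ M).
    intros M; unfold Rdiv; ring.
  rewrite <- (Rmult_0_r (K / sqrt (1 - Cmod w ^ 2))).
  apply (is_lim_seq_scal_l _ _ 0), is_lim_seq_pow0; lra.
Qed.

End KernelDomination.

(** * Recovery of a Hardy function from its values, and operators defined by their values *)

Lemma climit_ext_from N0 u v l :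
  (forall n, (N0 <= n)%nat -> u n = v n) -> climit u l -> climit v l.
Proof.
intros H; apply is_lim_seq_ext_loc; exists N0; intros n Hn; rewrite H; auto.
Qed.

Lemma cseries_delta (f : nat -> C) k : cseries (fun j => f j * delta_seq k j)%C (f k).
Proof.
apply climit_ext_from with (S k) (fun _ => f k); [|apply climit_const].
intros n Hn; rewrite (csum_ext _ (fun j => f j * delta_seq j k)%C).
  rewrite csum_delta; destruct (Nat.ltb_spec k n); [reflexivity | lia].
intros j; unfold delta_seq; rewrite Nat.eqb_sym; reflexivity.
Qed.

Lemma hardy_eval_coef (f : ell2) k :
  climit (fun N => functional (hardy_eval f) (coef_comb k N)) (coef f k).
Proof.
apply (is_lim_seq_le_le_loc (fun _ => 0) _
  (fun N => ell2_norm f * (2 ^ k * (/ 2) ^ N / sqrt (1 - (/ 2) ^ 2)))).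
- exists (S k); intros N HN; split; [apply Cmod_ge_0|].
  destruct (ell2_make _ _ (err_ge0 k N) (coef_comb_bound k N HN)) as [y [Hy Hn]].
  destruct (comb_ell2 _ (in_disc_coef_comb k N)) as [x [Hx _]].
  unfold functional; rewrite (comb_pair f x) by (auto; apply in_disc_coef_comb).
  replace (pair f x - f k)%C with (pair f y).
    eapply Rle_trans; [apply pair_le|].
    apply Rmult_le_compat_l; [apply ell2_norm_ge0 | exact Hn].
  refine (climit_unique _ _ _ (cseries_pair f y) _).
  apply (cseries_ext (fun j => f j * x j + (- (1)) * (f j * delta_seq k j))%C).
    intros j; rewrite Hx, Hy; ring.
  replace (pair f x - f k)%C with (pair f x + (- (1)) * f k)%C by ring.
  apply cseries_plus; [apply cseries_pair | apply cseries_scal, cseries_delta].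
- apply is_lim_seq_const.
- rewrite <- (Rmult_0_r (ell2_norm f)).
  apply (is_lim_seq_scal_l _ (ell2_norm f) 0), is_lim_half_pow.
Qed.

(** Operators obtained by choice from [dominated_hardy] are known only through their values; this
    makes them linear. *)
Lemma hardy_eval_inj (f g : ell2) :
  (forall w, Cmod w < 1 -> hardy_eval f w = hardy_eval g w) -> f = g.
Proof.
intros H; apply ell2_ext; intros k.
refine (climit_unique _ _ _ (hardy_eval_coef f k) _).
apply climit_ext with (2 := hardy_eval_coef g k); intros N.
apply csum_ext_in; intros p Hp; rewrite H; [reflexivity|].
exact (in_disc_coef_comb k N p Hp).
Qed.

Lemma hardy_eval_plus (f g : ell2) w : Cmod w < 1 ->
  hardy_eval (ell2_plus f g) w = (hardy_eval f w + hardy_eval g w)%C.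
Proof.
intros Hw; apply cseries_CSeries.
apply (cseries_ext (fun k => f k * w ^ k + g k * w ^ k)%C).
  intros k; simpl; ring.
apply cseries_plus; apply hardy_series, Hw.
Qed.

Lemma hardy_eval_scal (c : C) (f : ell2) w : Cmod w < 1 ->
  hardy_eval (ell2_scal c f) w = (c * hardy_eval f w)%C.
Proof.
intros Hw; apply cseries_CSeries.
apply (cseries_ext (fun k => c * (f k * w ^ k))%C).
  intros k; simpl; ring.
apply cseries_scal, hardy_series, Hw.
Qed.

(* The adjoint form of boundedness: the transposed operator sends the point
   evaluation at [w] to the sequence [e_k(w)]. *)
Lemma bounded_synthesis (e : nat -> C -> C) (K : R) : 0 <= K ->
  (forall l n, in_disc l ->
    rsum (fun k => Cmod (functional (e k) l) ^ 2) (seq 0 n) <= K ^ 2 * Re (gram l)) ->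
  exists S : ell2_NormedModule -> ell2_NormedModule,
    is_linear S /\
    forall (f : ell2) w, Cmod w < 1 ->
      cseries (fun k => coef f k * e k w)%C (hardy_eval (S f) w).
Proof.
intros HK He.
assert (Hrow : forall l, in_disc l -> exists x : ell2,
    (forall k, coef x k = functional (e k) l) /\ ell2_norm x <= K * sqrt (Re (gram l))).
  intros l Hl; apply ell2_make.
    apply Rmult_le_pos; [exact HK | apply sqrt_pos].
  intros n; rewrite Rpow_mult_distr, pow2_sqrt by (apply gram_ge0, Hl); auto.
assert (Hser : forall (f : ell2) w, Cmod w < 1 -> cseries (fun k => f k * e k w)%C
    (CSeries (fun k => f k * e k w)%C)).
  intros f w Hw; destruct (Hrow ((RtoC 1, w) :: nil)) as [x [Hx _]].
    intros p [<- | []]; exact Hw.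
  assert (E : forall k, (f k * x k)%C = (f k * e k w)%C).
    intros k; rewrite Hx; unfold functional; simpl; ring.
  assert (H := cseries_ext _ _ _ E (cseries_pair f x)).
  rewrite (cseries_CSeries _ _ H); exact H.
assert (Hdom : forall f : ell2,
    dominated (fun w => CSeries (fun k => f k * e k w)%C) (K * ell2_norm f)).
  intros f l B Hl HB Hb; destruct (Hrow l Hl) as [x [Hx Hn]].
  assert (Hg : sqrt (Re (gram l)) <= B).
    apply sqr_le_inv; auto; rewrite pow2_sqrt by (apply gram_ge0, Hl).
    apply (is_series_le_bound _ _ _ (comb_series l Hl) Hb).
  replace (functional _ l) with (pair f x).
    eapply Rle_trans; [apply pair_le|].
    rewrite (Rmult_comm K), Rmult_assoc; apply Rmult_le_compat_l; [apply ell2_norm_ge0|].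
    eapply Rle_trans; [exact Hn | apply Rmult_le_compat_l; auto].
  refine (climit_unique _ _ _ (cseries_pair f x) _).
  apply (cseries_ext (fun k => csum (fun p => fst p * (f k * e k (snd p)))%C l)).
    intros k; rewrite Hx; unfold functional; rewrite <- csum_scal.
    apply csum_ext; intros p; ring.
  apply (cseries_csum (fun p k => fst p * (f k * e k (snd p)))%C).
  intros p Hp; apply cseries_scal, Hser, Hl, Hp.
assert (Hex : forall f : ell2, { g : ell2 | ell2_norm g <= K * ell2_norm f /\
    forall w, Cmod w < 1 -> hardy_eval g w = CSeries (fun k => f k * e k w)%C }).
  intros f; apply constructive_indefinite_description.
  apply dominated_hardy; [|apply Hdom].
  apply Rmult_le_pos; [exact HK | apply ell2_norm_ge0].
set (S f := proj1_sig (Hex f)).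
assert (HS : forall f w, Cmod w < 1 ->
    cseries (fun k => coef f k * e k w)%C (hardy_eval (S f) w)).
  intros f w Hw; assert (E := proj2 (proj2_sig (Hex f)) w Hw).
  change (hardy_eval (S f) w = CSeries (fun k => coef f k * e k w)%C) in E.
  rewrite E; auto.
exists S; split; [|exact HS]; constructor.
- intros f g; apply hardy_eval_inj; intros w Hw.
  change (plus (S f) (S g)) with (ell2_plus (S f) (S g)).
  rewrite hardy_eval_plus by exact Hw.
  refine (climit_unique _ _ _ (HS _ w Hw) _).
  apply (cseries_ext (fun k => coef f k * e k w + coef g k * e k w)%C).
    intros k; simpl; ring.
  apply cseries_plus; apply HS, Hw.
- intros c f; apply hardy_eval_inj; intros w Hw.
  change (scal c (S f)) with (ell2_scal c (S f)).
  rewrite hardy_eval_scal by exact Hw.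
  refine (climit_unique _ _ _ (HS _ w Hw) _).
  apply (cseries_ext (fun k => c * (coef f k * e k w))%C).
    intros k; simpl; ring.
  apply cseries_scal, HS, Hw.
(* [is_linear] demands a strictly positive constant, and K may be 0. *)
- exists (K + 1); split; [lra|]; intros f.
  change (ell2_norm (S f) <= (K + 1) * ell2_norm f).
  assert (H := proj1 (proj2_sig (Hex f))); assert (H1 := ell2_norm_ge0 f).
  change (ell2_norm (S f) <= K * ell2_norm f) in H; lra.
Qed.

(** * Exponential sums *)

(* [e^{-u x}] for real [x]; then [inv_npow n s] is [cexpn s (ln n)]. *)
Definition cexpn (u : C) (x : R) : C :=
  let r := exp (- Re u * x) in let t := Im u * x in (r * cos t, - (r * sin t)).

Lemma cexpn_plus u v x : cexpn (u + v) x = (cexpn u x * cexpn v x)%C.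
Proof.
unfold cexpn, Cmult; cbn [fst snd].
rewrite re_plus, im_plus.
replace (- (Re u + Re v) * x) with (- Re u * x + - Re v * x) by ring.
rewrite exp_plus, Rmult_plus_distr_r, cos_plus, sin_plus; f_equal; ring.
Qed.

Lemma cexpn_add u x y : cexpn u (x + y) = (cexpn u x * cexpn u y)%C.
Proof.
unfold cexpn, Cmult; cbn [fst snd].
rewrite !Rmult_plus_distr_l, exp_plus, cos_plus, sin_plus; f_equal; ring.
Qed.

Lemma cexpn_0 u : cexpn u 0 = RtoC 1.
Proof.
unfold cexpn; rewrite !Rmult_0_r, exp_0, cos_0, sin_0; unfold RtoC; f_equal; ring.
Qed.

Lemma cexpn_conj u x : Cconj (cexpn u x) = cexpn (Cconj u) x.
Proof.
unfold cexpn; rewrite re_conj, im_conj; unfold Cconj; cbn [fst snd].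
replace (- Im u * x) with (- (Im u * x)) by ring.
rewrite cos_neg, sin_neg; f_equal; ring.
Qed.

Lemma Cmod_cexpn u x : Cmod (cexpn u x) = exp (- Re u * x).
Proof.
unfold cexpn; set (r := exp _); set (t := Im u * x).
replace (r * cos t, - (r * sin t)) with (RtoC r * cis (- t))%C.
  rewrite Cmod_mult, Cmod_cis, Cmod_R, Rabs_pos_eq, Rmult_1_r; [reflexivity|].
  left; apply exp_pos.
unfold cis, RtoC, Cmult; simpl; rewrite cos_neg, sin_neg; f_equal; ring.
Qed.

Lemma is_derive_cexpn (c u : C) x :
  is_derive (fun x => Re (c * cexpn u x)%C) x (- Re (c * u * cexpn u x)%C).
Proof.
destruct c as [c1 c2], u as [u1 u2].
unfold cexpn, Cmult, Re, Im; simpl.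
auto_derive; [exact I | ring].
Qed.

Definition expsum (L : list (C * C)) (x : R) : C :=
  csum (fun p => fst p * cexpn (snd p) x)%C L.

(** For exponents in the right half-plane this is the closed form of the integral of |[expsum L]|^2
    over [x, +infinity). *)
Definition hgram (L : list (C * C)) (x : R) : C :=
  csum (fun p => csum (fun q =>
    fst p * Cconj (fst q) / (snd p + Cconj (snd q))
    * cexpn (snd p + Cconj (snd q)) x) L)%C L.

Definition in_half (L : list (C * C)) : Prop := forall p, In p L -> 0 < Re (snd p).

(** Its exponential sum is -G' rather than G'; the sign does not affect [energy]. *)
Definition ddx (L : list (C * C)) : list (C * C) :=
  map (fun p => ((fst p * snd p)%C, snd p)) L.

Lemma in_half_ddx L : in_half L -> in_half (ddx L).
Proof.
intros H p Hp; apply in_map_iff in Hp; destruct Hp as [q [<- Hq]]; exact (H q Hq).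
Qed.

Lemma Cneq0_Re (c : C) : 0 < Re c -> c <> 0.
Proof. intros H E; rewrite E in H; simpl in H; lra. Qed.

Lemma Cneq0_sum_conj u v : 0 < Re u -> 0 < Re v -> (u + Cconj v)%C <> 0.
Proof. intros Hu Hv; apply Cneq0_Re; rewrite re_plus, re_conj; lra. Qed.

Lemma expsum_mult_conj L L' x : (expsum L x * Cconj (expsum L' x))%C =
  csum (fun p => csum (fun q =>
    fst p * Cconj (fst q) * cexpn (snd p + Cconj (snd q)) x) L')%C L.
Proof.
unfold expsum; rewrite csum_conj, csum_mult.
apply csum_ext; intros p; apply csum_ext; intros q.
rewrite Cmult_conj, cexpn_plus, cexpn_conj; ring.
Qed.

Lemma is_derive_rsum {A} (f : A -> R -> R) (f' : A -> R) l x :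
  (forall a, In a l -> is_derive (f a) x (f' a)) ->
  is_derive (fun x => rsum (fun a => f a x) l) x (rsum f' l).
Proof.
induction l as [|a l IH]; intros H; simpl.
  apply (is_derive_const (K := R_AbsRing) (V := R_NormedModule)).
apply (is_derive_plus (K := R_AbsRing) (V := R_NormedModule) (f a)).
  apply H; left; reflexivity.
apply IH; intros; apply H; right; assumption.
Qed.

Lemma is_derive_hgram L x : in_half L ->
  is_derive (fun x => Re (hgram L x)) x (- Cmod (expsum L x) ^ 2).
Proof.
intros HL.
rewrite <- (re_RtoC (Cmod (expsum L x) ^ 2)), Cmod_sqr_mult_conj, expsum_mult_conj.
rewrite Re_csum.
replace (- rsum _ L) with (rsum (fun p => - Re (csum (fun q =>
    fst p * Cconj (fst q) * cexpn (snd p + Cconj (snd q)) x) L)%C) L).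
2:{ rewrite (rsum_ext _ (fun p => (-1) * Re (csum (fun q =>
      fst p * Cconj (fst q) * cexpn (snd p + Cconj (snd q)) x) L)%C)).
      rewrite rsum_scal; ring.
    intros; ring. }
apply is_derive_ext with (fun x => rsum (fun p => rsum (fun q =>
  Re (fst p * Cconj (fst q) / (snd p + Cconj (snd q))
    * cexpn (snd p + Cconj (snd q)) x)%C) L) L).
  intros y; unfold hgram; rewrite Re_csum; apply rsum_ext; intros p.
  rewrite Re_csum; reflexivity.
apply (is_derive_rsum (fun p x => rsum (fun q =>
  Re (fst p * Cconj (fst q) / (snd p + Cconj (snd q))
    * cexpn (snd p + Cconj (snd q)) x)%C) L)).
intros p Hp.
replace (- Re (csum _ L)) with (rsum (fun q =>
    - Re (fst p * Cconj (fst q) * cexpn (snd p + Cconj (snd q)) x)%C) L).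
2:{ rewrite Re_csum, (rsum_ext _ (fun q => (-1) *
      Re (fst p * Cconj (fst q) * cexpn (snd p + Cconj (snd q)) x)%C)).
      rewrite rsum_scal; ring.
    intros; ring. }
apply (is_derive_rsum (fun q x =>
  Re (fst p * Cconj (fst q) / (snd p + Cconj (snd q))
    * cexpn (snd p + Cconj (snd q)) x)%C)).
intros q Hq.
replace (fst p * Cconj (fst q) * cexpn (snd p + Cconj (snd q)) x)%C with
  (fst p * Cconj (fst q) / (snd p + Cconj (snd q)) * (snd p + Cconj (snd q))
    * cexpn (snd p + Cconj (snd q)) x)%C.
  apply is_derive_cexpn.
field; apply Cneq0_sum_conj; [apply HL, Hp | apply HL, Hq].
Qed.

Lemma is_derive_expsum_sqr L x :
  is_derive (fun x => Cmod (expsum L x) ^ 2) x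
    (- (2 * Re (expsum (ddx L) x * Cconj (expsum L x))%C)).
Proof.
apply is_derive_ext with (fun x => rsum (fun p => rsum (fun q =>
  Re (fst p * Cconj (fst q) * cexpn (snd p + Cconj (snd q)) x)%C) L) L).
  intros y; rewrite <- (re_RtoC (Cmod _ ^ 2)), Cmod_sqr_mult_conj, expsum_mult_conj.
  rewrite Re_csum; apply rsum_ext; intros p; rewrite Re_csum; reflexivity.
replace (2 * Re (expsum (ddx L) x * Cconj (expsum L x))%C) with
  (Re (expsum (ddx L) x * Cconj (expsum L x) + expsum L x * Cconj (expsum (ddx L) x))%C).
2:{ rewrite re_plus, <- (re_conj (expsum L x * _)%C), Cmult_conj, Cconj_conj.
    rewrite (Cmult_comm (Cconj _)); ring. }
replace (- Re _) with (rsum (fun p => rsum (fun q =>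
    - Re (fst p * Cconj (fst q) * (snd p + Cconj (snd q))
      * cexpn (snd p + Cconj (snd q)) x)%C) L) L).
  apply (is_derive_rsum (fun p x => rsum (fun q =>
    Re (fst p * Cconj (fst q) * cexpn (snd p + Cconj (snd q)) x)%C) L)).
  intros p _; apply (is_derive_rsum (fun q x =>
    Re (fst p * Cconj (fst q) * cexpn (snd p + Cconj (snd q)) x)%C)).
  intros q _; apply is_derive_cexpn.
rewrite !expsum_mult_conj; unfold ddx at 1; rewrite csum_map, <- csum_plus.
rewrite Re_csum, <- (Rmult_1_l (rsum _ L)), <- (Ropp_involutive 1), Ropp_mult_distr_l_reverse.
rewrite <- rsum_scal; f_equal; apply rsum_ext; intros p.
unfold ddx; rewrite csum_map, <- csum_plus, Re_csum, <- rsum_scal; apply rsum_ext; intros q.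
simpl fst; simpl snd.
rewrite Cmult_conj.
replace (fst p * Cconj (fst q) * (snd p + Cconj (snd q))
    * cexpn (snd p + Cconj (snd q)) x)%C with
  (fst p * snd p * Cconj (fst q) * cexpn (snd p + Cconj (snd q)) x
   + fst p * (Cconj (fst q) * Cconj (snd q)) * cexpn (snd p + Cconj (snd q)) x)%C by ring.
ring.
Qed.

Lemma decreasing_of_derive (f f' : R -> R) x y : x <= y ->
  (forall t, is_derive f t (f' t)) -> (forall t, f' t <= 0) -> f y <= f x.
Proof.
intros Hxy Hd Hn.
destruct (MVT_gen f x y f') as [c [_ Hc]]; [intros; apply Hd| |].
  intros t _; apply derivable_continuous_pt.
  exists (f' t); apply is_derive_Reals, Hd.
specialize (Hn c); nra.
Qed.

(** The integral of |G|^2 + |G'|^2 over [x, +infinity). *)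
Definition energy (L : list (C * C)) (x : R) : R :=
  Re (hgram L x) + Re (hgram (ddx L) x).

Lemma is_derive_energy L x : in_half L ->
  is_derive (energy L) x (- Cmod (expsum L x) ^ 2 - Cmod (expsum (ddx L) x) ^ 2).
Proof.
intros HL.
apply (is_derive_plus (K := R_AbsRing) (V := R_NormedModule)
  (fun x => Re (hgram L x)) (fun x => Re (hgram (ddx L) x))).
  apply is_derive_hgram, HL.
apply is_derive_hgram, in_half_ddx, HL.
Qed.

(* [|G|^2 + energy] decreases, its derivative being [-|G - G'|^2]; so on a block
   the value of [|G|^2] at the right end exceeds its mean, supplied by the mean
   value theorem, by at most the loss of energy. *)
Lemma expsum_block L x y : in_half L -> x < y -> y - x <= 1 ->
  (y - x) * Cmod (expsum L y) ^ 2 <=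
    (Re (hgram L x) - Re (hgram L y)) + (energy L x - energy L y).
Proof.
intros HL Hxy Hyx.
destruct (MVT_gen (fun x => Re (hgram L x)) x y (fun x => - Cmod (expsum L x) ^ 2))
  as [c [Hc Ec]].
  intros; apply is_derive_hgram, HL.
  intros t _; apply derivable_continuous_pt.
  exists (- Cmod (expsum L t) ^ 2); apply is_derive_Reals, is_derive_hgram, HL.
rewrite Rmin_left, Rmax_right in Hc by lra.
cbv beta in Ec.
assert (H1 : Cmod (expsum L y) ^ 2 + energy L y <= Cmod (expsum L c) ^ 2 + energy L c).
  apply (decreasing_of_derive (fun x => Cmod (expsum L x) ^ 2 + energy L x)
    (fun x => - (2 * Re (expsum (ddx L) x * Cconj (expsum L x))%C)
      + (- Cmod (expsum L x) ^ 2 - Cmod (expsum (ddx L) x) ^ 2))).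
  - lra.
  - intros t; apply (is_derive_plus (K := R_AbsRing) (V := R_NormedModule)
      (fun x => Cmod (expsum L x) ^ 2)).
      apply is_derive_expsum_sqr.
    apply is_derive_energy, HL.
  - intros t; rewrite !Cmod2_alt, re_mult, re_conj, im_conj.
    generalize (Re (expsum L t)) (Im (expsum L t)) (Re (expsum (ddx L) t))
      (Im (expsum (ddx L) t)); intros a b a' b'.
    assert (H := pow2_ge_0 (a + a')); assert (H' := pow2_ge_0 (b + b')); nra.
assert (H2 : energy L c <= energy L x).
  apply (decreasing_of_derive (energy L)
    (fun x => - Cmod (expsum L x) ^ 2 - Cmod (expsum (ddx L) x) ^ 2)).
  - lra.
  - intros t; apply is_derive_energy, HL.
  - intros t; assert (H3 := pow2_ge_0 (Cmod (expsum L t)));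
      assert (H4 := pow2_ge_0 (Cmod (expsum (ddx L) t))); lra.
assert (H3 : energy L y <= energy L x).
  assert (H4 := pow2_ge_0 (Cmod (expsum L c))).
  apply (decreasing_of_derive (energy L)
    (fun x => - Cmod (expsum L x) ^ 2 - Cmod (expsum (ddx L) x) ^ 2)).
  - lra.
  - intros t; apply is_derive_energy, HL.
  - intros t; assert (H5 := pow2_ge_0 (Cmod (expsum L t)));
      assert (H6 := pow2_ge_0 (Cmod (expsum (ddx L) t))); lra.
nra.
Qed.

(** * The Cayley transform *)

Definition cayley (w : C) : C := ((1 - w) / (1 + w))%C.

Lemma one_plus_neq0 w : Cmod w < 1 -> (1 + w)%C <> 0.
Proof.
intros Hw; replace (1 + w)%C with (1 - (- w))%C by ring.
apply Cneq_of_Cmod; rewrite Cmod_1, Cmod_opp; lra.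
Qed.

Lemma Re_cayley w : Cmod w < 1 -> Re (cayley w) = (1 - Cmod w ^ 2) / Cmod (1 + w) ^ 2.
Proof.
intros Hw; assert (H1 := one_plus_neq0 w Hw).
assert (H2 : Cmod (1 + w) ^ 2 <> 0).
  apply pow_nonzero; intros E; apply H1, Cmod_eq_0, E.
rewrite Cmod2_alt in *; rewrite Cmod2_alt.
destruct w as [a b]; unfold cayley, Cdiv, Cinv, Cmult, Cminus, Cplus, Copp, RtoC, Re, Im in *.
simpl in *; field.
intros E; apply H2; transitivity ((1 + a) * (1 + a) + b * b); [ring | exact E].
Qed.

Lemma Re_cayley_gt0 w : Cmod w < 1 -> 0 < Re (cayley w).
Proof.
intros Hw; rewrite Re_cayley by exact Hw.
assert (H0 := Cmod_ge_0 w).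
apply Rdiv_lt_0_compat; [nra | apply pow_lt, Cmod_gt_0, one_plus_neq0, Hw].
Qed.

Lemma one_plus_cayley w : Cmod w < 1 -> (1 + cayley w)%C = (2 / (1 + w))%C.
Proof. intros Hw; unfold cayley; field; apply one_plus_neq0, Hw. Qed.

Lemma one_minus_mult_neq0 a b : Cmod a < 1 -> Cmod b < 1 -> (1 - a * b)%C <> 0.
Proof.
intros Ha Hb; apply Cneq_of_Cmod; rewrite Cmod_1.
assert (H := Cmod_mult_lt1 a b Ha Hb); lra.
Qed.

(** The kernel of the half-plane is the Szego kernel of the disc up to a factor that splits into one
    depending on a and a conjugate one depending on b. Such factors can be absorbed into
    coefficients, so Gram sums of the two kernels correspond. *)
Lemma cayley_kernel a b : Cmod a < 1 -> Cmod b < 1 ->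
  (/ (cayley a + Cconj (cayley b)))%C =
  (2 / ((1 + cayley a) * Cconj (1 + cayley b)) * / (1 - a * Cconj b))%C.
Proof.
intros Ha Hb; assert (Hb' : Cmod (Cconj b) < 1) by (rewrite Cmod_conj; exact Hb).
assert (H1 := one_plus_neq0 a Ha); assert (H2 := one_plus_neq0 _ Hb').
assert (H3 := one_minus_mult_neq0 a (Cconj b) Ha Hb').
assert (H4 := Cneq0_sum_conj _ _ (Re_cayley_gt0 a Ha) (Re_cayley_gt0 b Hb)).
assert (H5 : Cconj 1 = 1) by apply Cconj_R.
assert (E2 : Cconj (1 + cayley b) = (2 / (1 + Cconj b))%C).
  rewrite one_plus_cayley by exact Hb; rewrite Cdiv_conj by (apply one_plus_neq0, Hb).
  rewrite Cplus_conj, H5, Cconj_R; reflexivity.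
assert (E3 : Cconj (cayley b) = ((1 - Cconj b) / (1 + Cconj b))%C).
  unfold cayley; rewrite Cdiv_conj by (apply one_plus_neq0, Hb).
  rewrite Cplus_conj, Cminus_conj, H5; reflexivity.
rewrite E2, one_plus_cayley by exact Ha.
assert (E4 : (cayley a + Cconj (cayley b))%C =
  (2 * (1 - a * Cconj b) / ((1 + a) * (1 + Cconj b)))%C).
  rewrite E3; unfold cayley; field; auto.
assert (H6 : RtoC 2 <> 0) by (apply RtoC_neq0; lra).
rewrite E4; field; auto.
Qed.

Definition to_half (l : list (C * C)) : list (C * C) :=
  map (fun p => (fst p, cayley (snd p))) l.

Lemma in_half_to_half l : in_disc l -> in_half (to_half l).
Proof.
intros H p Hp; apply in_map_iff in Hp; destruct Hp as [q [<- Hq]].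
apply Re_cayley_gt0; exact (H q Hq).
Qed.

(** Moving the origin to x multiplies the coefficients by exp(- u x). What remains is a Gram sum on
    the disc, which gives positivity here and admits the Riesz bound later. *)
Lemma hgram_to_half l x : in_disc l ->
  hgram (to_half l) x = (2 * gram (map (fun p =>
    ((fst p * cexpn (cayley (snd p)) x / (1 + cayley (snd p)))%C, snd p)) l))%C.
Proof.
intros Hl; unfold hgram, gram, to_half; rewrite !csum_map, <- csum_scal.
apply csum_ext_in; intros p Hp; rewrite !csum_map, <- csum_scal.
apply csum_ext_in; intros q Hq; simpl fst; simpl snd.
assert (Hp1 : (1 + cayley (snd p))%C <> 0).
  apply Cneq0_Re; rewrite re_plus, re_RtoC.
  assert (H := Re_cayley_gt0 _ (Hl p Hp)); lra.
assert (Hq1 : (1 + cayley (snd q))%C <> 0).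
  apply Cneq0_Re; rewrite re_plus, re_RtoC.
  assert (H := Re_cayley_gt0 _ (Hl q Hq)); lra.
unfold Cdiv at 1; rewrite cayley_kernel by auto.
rewrite cexpn_plus, <- cexpn_conj.
rewrite Cdiv_conj, Cmult_conj by exact Hq1.
assert (Hq2 := Cconj_neq0 _ Hq1).
assert (H3 : (1 - snd p * Cconj (snd q))%C <> 0).
  apply one_minus_mult_neq0; [|rewrite Cmod_conj]; auto.
field; auto.
Qed.

Lemma hgram_ge0 l x : in_disc l -> 0 <= Re (hgram (to_half l) x).
Proof.
intros Hl; rewrite hgram_to_half by exact Hl.
rewrite re_scal_l; apply Rmult_le_pos; [lra|].
apply gram_ge0; intros p Hp; apply in_map_iff in Hp; destruct Hp as [q [<- Hq]].
exact (Hl q Hq).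
Qed.

Lemma ddx_to_half l : ddx (to_half l) =
  to_half (map (fun p => ((fst p * cayley (snd p))%C, snd p)) l).
Proof. unfold ddx, to_half; rewrite !map_map; reflexivity. Qed.

Lemma energy_ge0 l x : in_disc l -> 0 <= energy (to_half l) x.
Proof.
intros Hl; apply Rplus_le_le_0_compat; [apply hgram_ge0, Hl|].
rewrite ddx_to_half; apply hgram_ge0.
intros p Hp; apply in_map_iff in Hp; destruct Hp as [q [<- Hq]].
exact (Hl q Hq).
Qed.

(** Inverting [cayley_kernel] produces (1 + u)(1 + conj v) / (u + conj v). Writing the numerator as
    1 + u conj(v) + (u + conj v) splits it into the integrals of |G|^2 and |G'|^2 and the boundary
    term |G(0)|^2. *)
Lemma gram_energy l : in_disc l ->
  Re (gram l) = / 2 * (energy (to_half l) 0 + Cmod (expsum (to_half l) 0) ^ 2).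
Proof.
intros Hl; unfold energy.
rewrite <- (re_RtoC (Cmod _ ^ 2)), Cmod_sqr_mult_conj, expsum_mult_conj.
rewrite <- !re_plus, <- re_scal_l; f_equal.
unfold hgram, gram, ddx, to_half; rewrite !map_map, !csum_map, <- !csum_plus, <- csum_scal.
apply csum_ext_in; intros p Hp; rewrite !csum_map, <- !csum_plus, <- csum_scal.
apply csum_ext_in; intros q Hq; simpl fst; simpl snd.
assert (Hp1 : (1 + cayley (snd p))%C <> 0).
  apply Cneq0_Re; rewrite re_plus, re_RtoC.
  assert (H := Re_cayley_gt0 _ (Hl p Hp)); lra.
assert (Hq1 : Cconj (1 + cayley (snd q)) <> 0).
  apply Cneq0_Re; rewrite re_conj, re_plus, re_RtoC.
  assert (H := Re_cayley_gt0 _ (Hl q Hq)); lra.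
assert (H3 : (1 - snd p * Cconj (snd q))%C <> 0).
  apply one_minus_mult_neq0; [|rewrite Cmod_conj]; auto.
assert (H4 := Cneq0_sum_conj _ _ (Re_cayley_gt0 _ (Hl p Hp)) (Re_cayley_gt0 _ (Hl q Hq))).
assert (H6 : RtoC 2 <> 0) by (apply RtoC_neq0; lra).
assert (E : (/ (1 - snd p * Cconj (snd q)))%C = (/ 2 * ((1 + cayley (snd p)) *
    Cconj (1 + cayley (snd q))) * / (cayley (snd p) + Cconj (cayley (snd q))))%C).
  rewrite cayley_kernel by auto; field; auto.
unfold Cdiv at 1; rewrite E, Cplus_conj, !Cmult_conj, cexpn_0.
rewrite Cconj_1.
rewrite RtoC_inv by lra; field; auto.
Qed.

Lemma in_disc_map_fst (g : C * C -> C) l :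
  in_disc l -> in_disc (map (fun p => (g p, snd p)) l).
Proof.
intros H p Hp; apply in_map_iff in Hp; destruct Hp as [q [<- Hq]]; exact (H q Hq).
Qed.

(** * Sampling at logarithms and the boundedness of [C_T] *)

Lemma ln_succ_bounds n : (1 <= n)%nat ->
  / INR (S n) <= ln (INR (S n)) - ln (INR n) <= / INR n.
Proof.
intros Hn; assert (H0 : 0 < INR n) by (apply lt_0_INR; lia).
assert (H1 : 0 < INR (S n)) by (apply lt_0_INR; lia).
assert (Hln : forall x y, 0 < x -> 0 < y -> ln x - ln y <= (x - y) / y).
  intros x y Hx Hy; rewrite <- ln_div by assumption.
  assert (H := exp_ineq1_le (ln (x / y))).
  rewrite exp_ln in H by (apply Rdiv_lt_0_compat; assumption).
  replace ((x - y) / y) with (x / y - 1) by (field; lra); lra.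
split.
  assert (H := Hln (INR n) (INR (S n)) H0 H1).
  replace ((INR n - INR (S n)) / INR (S n)) with (- / INR (S n)) in H; [lra|].
  rewrite S_INR in *; field; lra.
assert (H := Hln (INR (S n)) (INR n) H1 H0).
replace ((INR (S n) - INR n) / INR n) with (/ INR n) in H; [lra|].
rewrite S_INR; field; lra.
Qed.

(** The block from log k to log(k+1) has length at least 1/(k+1), the weight of the sample at its
    right end, so the block inequalities telescope. They leave at most |G(0)|^2 + 2 [energy](0),
    which is at most twice the sum in [gram_energy], hence 4. *)
Lemma expsum_log_sum l n : in_disc l ->
  rsum (fun k => / INR (S k) * Cmod (expsum (to_half l) (ln (INR (S k)))) ^ 2) (seq 0 n)
  <= 4 * Re (gram l).
Proof.
intros Hl; set (L := to_half l).
assert (HL : in_half L) by (apply in_half_to_half, Hl).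
assert (H : rsum (fun k => / INR (S k) * Cmod (expsum L (ln (INR (S k)))) ^ 2) (seq 0 (S n))
  <= Cmod (expsum L 0) ^ 2 + (Re (hgram L 0) - Re (hgram L (ln (INR (S n)))))
     + (energy L 0 - energy L (ln (INR (S n))))).
  clear - HL; induction n as [|n IH].
    cbn [seq rsum fold_right]; rewrite INR_1, ln_1, Rinv_1; lra.
  rewrite seq_S, rsum_app; cbn [rsum fold_right].
  replace (0 + S n)%nat with (S n) by lia.
  destruct (ln_succ_bounds (S n)) as [H1 H2]; [lia|].
  set (x := ln (INR (S n))) in *; set (y := ln (INR (S (S n)))) in *.
  assert (H3 : 0 < / INR (S (S n))) by (apply Rinv_0_lt_compat, lt_0_INR; lia).
  assert (H4 : / INR (S n) <= 1).
    rewrite <- Rinv_1; apply Rinv_le_contravar; [lra|].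
    rewrite <- INR_1; apply le_INR; lia.
  assert (H5 := expsum_block L x y HL ltac:(lra) ltac:(lra)).
  assert (H6 : / INR (S (S n)) * Cmod (expsum L y) ^ 2 <= (y - x) * Cmod (expsum L y) ^ 2).
    apply Rmult_le_compat_r; [apply pow2_ge_0 | lra].
  lra.
assert (H1 := hgram_ge0 l (ln (INR (S n))) Hl); fold L in H1.
assert (H2 := energy_ge0 l (ln (INR (S n))) Hl); fold L in H2.
assert (H3 := gram_energy l Hl); fold L in H3.
assert (H4 : Re (hgram L 0) <= energy L 0).
  assert (H5 := hgram_ge0 _ 0 (in_disc_map_fst (fun p => (fst p * cayley (snd p))%C) l Hl)).
  rewrite <- ddx_to_half in H5; fold L in H5; unfold energy; lra.
assert (H5 := pow2_ge_0 (Cmod (expsum L 0))).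
eapply Rle_trans; [apply rsum_seq_mono with (m := S n); [|lia]|].
  intros k; apply Rmult_le_pos; [|apply pow2_ge_0].
  left; apply Rinv_0_lt_compat, lt_0_INR; lia.
lra.
Qed.

Lemma Tmap_cayley w : Tmap w = (/ 2 + cayley w)%C.
Proof. reflexivity. Qed.

(** The abscissa 1/2 of [Tmap] is the source of the weight 1/n in the sampled sums. *)
Lemma inv_npow_half n u : (0 < n)%nat ->
  inv_npow n (/ 2 + u)%C = (RtoC (/ sqrt (INR n)) * cexpn u (ln (INR n)))%C.
Proof.
intros Hn; assert (H0 : 0 < INR n) by (apply lt_0_INR; lia).
change (inv_npow n (/ 2 + u)%C) with (cexpn (/ 2 + u)%C (ln (INR n))).
rewrite cexpn_plus; f_equal.
assert (E : cexpn (/ 2)%C (ln (INR n)) = RtoC (exp (- / 2 * ln (INR n)))).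
  rewrite <- RtoC_inv by lra.
  unfold cexpn; rewrite re_RtoC, im_RtoC, Rmult_0_l, cos_0, sin_0; unfold RtoC; f_equal; ring.
rewrite E; f_equal; rewrite <- Rpower_sqrt by exact H0.
unfold Rpower; rewrite <- exp_Ropp; f_equal; ring.
Qed.

Lemma embedding_exists : exists S : DirichletH2 -> HardyH2,
  is_composition_operator dirichlet_eval hardy_eval unit_disc Tmap S.
Proof.
destruct (bounded_synthesis (fun k w => inv_npow (S k) (Tmap w)) 2) as [S [HS1 HS2]].
- lra.
- intros l n Hl; eapply Rle_trans; [|].
    2: replace (2 ^ 2) with 4 by ring; apply (expsum_log_sum l n Hl).
  right; apply rsum_ext; intros k.
  assert (Hk : 0 < INR (S k)) by (apply lt_0_INR; lia).
  assert (Hs : 0 < sqrt (INR (S k))) by (apply sqrt_lt_R0, Hk).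
  replace (functional (fun w => inv_npow (S k) (Tmap w)) l) with
    (RtoC (/ sqrt (INR (S k))) * expsum (to_half l) (ln (INR (S k))))%C.
    rewrite Cmod_mult, Rpow_mult_distr, Cmod_R, Rabs_pos_eq.
      rewrite pow_inv, pow2_sqrt by lra; reflexivity.
    left; apply Rinv_0_lt_compat, Hs.
  unfold expsum, functional, to_half; rewrite csum_map, <- csum_scal.
  apply csum_ext; intros p; rewrite Tmap_cayley, inv_npow_half by lia; simpl; ring.
- exists S; split; [exact HS1|].
  intros f w Hw; symmetry; apply cseries_CSeries, HS2, Hw.
Qed.

(** * Second-order estimates for analytic functions *)

Lemma sum_n_csum (a : nat -> C) n :
  sum_n (G := C_AbelianMonoid) a n = csum a (seq 0 (S n)).
Proof.
induction n as [|n IH].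
  rewrite sum_O; simpl; ring.
rewrite sum_Sn, IH, (seq_S (S n)), csum_app; simpl; unfold plus; simpl; ring.
Qed.

Lemma filterlim_climit (u : nat -> C) (l : C) :
  filterlim u eventually (locally (T := C_UniformSpace) l) -> climit u l.
Proof.
intros H.
assert (H' : forall eps : posreal, eventually (fun n => ball (M := C_UniformSpace) l eps (u n))).
  apply filterlim_locally; exact H.
apply climit_Re_Im; apply is_lim_seq_spec; intros eps; destruct (H' eps) as [N HN];
  exists N; intros n Hn; destruct (HN n Hn) as [H1 H2]; assumption.
Qed.

Lemma pseries_cseries (a : nat -> C) (t l : C) :
  is_pseries (K := C_AbsRing) (V := C_NormedModule) a t l ->
  cseries (fun k => a k * t ^ k)%C l.
Proof.
intros H; apply filterlim_climit in H.
unfold cseries, climit in *.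
apply (is_lim_seq_incr_1 (fun n => Cmod (csum (fun k => a k * t ^ k)%C (seq 0 n) - l))).
eapply is_lim_seq_ext; [|exact H]; intros n; cbv beta.
f_equal; f_equal; rewrite sum_n_csum; apply csum_ext; intros k.
assert (E : pow_n (K := C_Ring) t k = (t ^ k)%C).
  induction k as [|k IH]; [reflexivity|]; simpl; rewrite <- IH; reflexivity.
change (pow_n (K := C_Ring) t k * a k = a k * t ^ k)%C; rewrite E; apply Cmult_comm.
Qed.

Lemma cseries_terms_bounded a l : cseries a l -> exists A, forall k, Cmod (a k) <= A.
Proof.
intros H.
destruct (filterlim_bounded (K := R_AbsRing) (V := R_NormedModule)
  (fun n => Cmod (csum a (seq 0 n)))) as [A HA].
  exists (Cmod l); apply (climit_Cmod _ _ H).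
exists (A + A); intros k.
assert (H1 := HA k); assert (H2 := HA (S k)).
unfold norm in H1, H2; simpl in H1, H2; unfold abs in H1, H2; simpl in H1, H2.
rewrite Rabs_pos_eq in H1, H2 by apply Cmod_ge_0.
change (Cmod (csum a (seq 0 (S k))) <= A) in H2.
rewrite seq_S, csum_app in H2; simpl in H2.
replace (a k) with ((csum a (seq 0 k) + (a k + 0)) - csum a (seq 0 k))%C by ring.
eapply Rle_trans; [apply Cmod_triangle|]; rewrite Cmod_opp; lra.
Qed.

(** Multiplication by q^2 avoids the exponent k - 2 of the usual remainder, and the generous factor
    k^2 lets the induction close by k^2 + k <= (k+1)^2. *)
Lemma pow_taylor (t t' : C) q k : 0 < q -> Cmod t <= q -> Cmod t' <= q ->
  Cmod (t' ^ k - t ^ k - INR k * t ^ pred k * (t' - t)) * q ^ 2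
  <= INR k ^ 2 * q ^ k * Cmod (t' - t) ^ 2.
Proof.
intros Hq Ht Ht'; set (d := Cmod (t' - t)).
assert (Hd : 0 <= d) by apply Cmod_ge_0.
induction k as [|k IH].
  simpl; replace (1 - 1 - 0 * 1 * (t' - t))%C with (RtoC 0) by ring; rewrite Cmod_0; lra.
replace (t' ^ S k - t ^ S k - INR (S k) * t ^ pred (S k) * (t' - t))%C with
  (t' * (t' ^ k - t ^ k - INR k * t ^ pred k * (t' - t))
   + INR k * t ^ pred k * ((t' - t) * (t' - t)))%C.
2:{ rewrite S_INR, RtoC_plus; destruct k as [|k]; simpl; ring. }
apply Rle_trans with (q * (Cmod (t' ^ k - t ^ k - INR k * t ^ pred k * (t' - t)) * q ^ 2)
  + INR k * q ^ S k * d ^ 2).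
  assert (H1 : Cmod (INR k * t ^ pred k * ((t' - t) * (t' - t))) * q ^ 2
      <= INR k * q ^ S k * d ^ 2).
    destruct k as [|k].
      simpl; rewrite !Cmod_mult, Cmod_R, Rabs_R0; lra.
    simpl pred; rewrite !Cmod_mult, Cmod_pow, Cmod_R, Rabs_pos_eq by apply pos_INR.
    fold d; apply Rle_trans with (INR (S k) * q ^ k * (d * d) * q ^ 2).
      repeat apply Rmult_le_compat_r; try (apply pow2_ge_0); try nra.
      apply Rmult_le_compat_l; [apply pos_INR|].
      apply pow_incr; split; [apply Cmod_ge_0 | exact Ht].
    right; rewrite <- tech_pow_Rmult; simpl; ring.
  assert (H2 : Cmod (t' * (t' ^ k - t ^ k - INR k * t ^ pred k * (t' - t)))
      <= q * Cmod (t' ^ k - t ^ k - INR k * t ^ pred k * (t' - t))).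
    rewrite Cmod_mult; apply Rmult_le_compat_r; [apply Cmod_ge_0 | exact Ht'].
  assert (H3 := Cmod_triangle (t' * (t' ^ k - t ^ k - INR k * t ^ pred k * (t' - t)))
    (INR k * t ^ pred k * ((t' - t) * (t' - t)))).
  assert (H4 := pow2_ge_0 q); nra.
apply Rle_trans with (q * (INR k ^ 2 * q ^ k * d ^ 2) + INR k * q ^ S k * d ^ 2).
  apply Rplus_le_compat_r, Rmult_le_compat_l; [lra | exact IH].
rewrite S_INR; simpl (q ^ S k).
assert (H5 : 0 <= q * q ^ k * d ^ 2).
  apply Rmult_le_pos; [|apply pow2_ge_0]; apply Rmult_le_pos; [lra | apply pow_le; lra].
assert (H6 := pos_INR k).
replace ((INR k + 1) ^ 2 * (q * q ^ k) * d ^ 2) with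
  ((INR k + 1) ^ 2 * (q * q ^ k * d ^ 2)) by ring.
replace (q * (INR k ^ 2 * q ^ k * d ^ 2) + INR k * (q * q ^ k) * d ^ 2) with
  ((INR k ^ 2 + INR k) * (q * q ^ k * d ^ 2)) by ring.
apply Rmult_le_compat_r; [exact H5 | nra].
Qed.

Lemma INR_le_pow2 k : INR k <= 2 ^ k.
Proof.
induction k as [|k IH]; [simpl; lra|].
rewrite S_INR; simpl; assert (1 <= 2 ^ k) by (apply pow_R1_Rle; lra); lra.
Qed.

Lemma rsum_half_pow n : rsum (fun k => (/ 2) ^ k) (seq 0 n) <= 2.
Proof.
apply rsum_le_series; [intros; apply pow_le; lra|].
assert (H := is_series_geom (/ 2)); replace (/ (1 - / 2)) with 2 in H by field.
apply H; rewrite Rabs_pos_eq; lra.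
Qed.

(** Uniform in the base point z near the centre, not only at the centre itself: D is the termwise
    derivative at z, and the remainders of the monomials are summed by [pow_taylor]. *)
Lemma pseries_second_order (F : C -> C) z0 (a : nat -> C) (r : posreal) :
  (forall z, Cmod (z - z0) < r -> cseries (fun k => a k * (z - z0) ^ k)%C (F z)) ->
  exists d K, 0 < d /\ 0 < K /\ forall z, Cmod (z - z0) <= d -> exists D, Cmod D <= K /\
    forall z', Cmod (z' - z0) <= d ->
      Cmod (F z' - F z - (z' - z) * D) <= K * Cmod (z' - z) ^ 2.
Proof.
intros HF; destruct r as [r Hr]; simpl in HF.
destruct (cseries_terms_bounded (fun k => a k * RtoC (r / 2) ^ k)%C (F (z0 + RtoC (r / 2))%C))
  as [A HA].
  assert (H := HF (z0 + RtoC (r / 2))%C).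
  replace (z0 + RtoC (r / 2) - z0)%C with (RtoC (r / 2)) in H by ring.
  apply H; rewrite Cmod_R, Rabs_pos_eq; lra.
(* The terms are bounded at distance r/2; at an eighth of it they decay like 8^(-k), and k^2 <= 4^k
   leaves the summable 2^(-k). *)
set (q := r / 16); assert (Hq : 0 < q) by (unfold q; lra).
assert (HA0 : 0 <= A) by (eapply Rle_trans; [apply Cmod_ge_0 | apply (HA 0%nat)]).
assert (Ha : forall k, Cmod (a k) * q ^ k <= A * (/ 8) ^ k).
  intros k; specialize (HA k).
  rewrite Cmod_mult, Cmod_pow, Cmod_R, Rabs_pos_eq in HA by lra.
  replace q with (r / 2 * / 8) by (unfold q; field).
  rewrite Rpow_mult_distr, <- Rmult_assoc.
  apply Rmult_le_compat_r; [apply pow_le; lra | exact HA].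
assert (Hk2 : forall k, INR k ^ 2 * (/ 8) ^ k <= (/ 2) ^ k).
  intros k; apply Rle_trans with ((2 ^ k) ^ 2 * (/ 8) ^ k).
    apply Rmult_le_compat_r; [apply pow_le; lra|].
    apply pow_incr; split; [apply pos_INR | apply INR_le_pow2].
  right; rewrite <- pow_mult, Nat.mul_comm, pow_mult, <- Rpow_mult_distr; f_equal; field.
assert (Hk1 : forall k, INR k * (/ 8) ^ k <= (/ 2) ^ k).
  intros k; eapply Rle_trans; [|apply Hk2].
  apply Rmult_le_compat_r; [apply pow_le; lra|].
  destruct k as [|k]; [simpl; lra|].
  assert (1 <= INR (S k)) by (rewrite <- INR_1; apply le_INR; lia); nra.
set (K := 2 * A / q ^ 2 + 2 * A / q + 1).
assert (Hq2 : 0 < q ^ 2) by (apply pow_lt; lra).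
assert (HKa : 0 <= 2 * A / q ^ 2).
  apply Rmult_le_pos; [lra | left; apply Rinv_0_lt_compat, Hq2].
assert (HKb : 0 <= 2 * A / q).
  apply Rmult_le_pos; [lra | left; apply Rinv_0_lt_compat, Hq].
exists q, K; split; [exact Hq|]; split; [unfold K; lra|].
intros z Hz; set (t := (z - z0)%C) in *.
set (b := fun k => (a k * (INR k * t ^ pred k))%C).
assert (Hb : forall k, Cmod (b k) <= A / q * (/ 2) ^ k).
  intros k; unfold b; rewrite !Cmod_mult, Cmod_pow, Cmod_R, Rabs_pos_eq by apply pos_INR.
  apply Rmult_le_reg_r with q; [exact Hq|].
  apply Rle_trans with (Cmod (a k) * q ^ k * INR k).
    destruct k as [|k]; [simpl; lra|]; simpl pred.
    replace (Cmod (a (S k)) * (INR (S k) * Cmod t ^ k) * q) with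
      (Cmod (a (S k)) * INR (S k) * q * Cmod t ^ k) by ring.
    replace (Cmod (a (S k)) * q ^ S k * INR (S k)) with
      (Cmod (a (S k)) * INR (S k) * q * q ^ k) by (simpl; ring).
    apply Rmult_le_compat_l.
      apply Rmult_le_pos; [|lra]; apply Rmult_le_pos; [apply Cmod_ge_0 | apply pos_INR].
    apply pow_incr; split; [apply Cmod_ge_0 | exact Hz].
  apply Rle_trans with (A * (/ 8) ^ k * INR k).
    apply Rmult_le_compat_r; [apply pos_INR | apply Ha].
  replace (A / q * (/ 2) ^ k * q) with (A * (/ 2) ^ k) by (field; lra).
  rewrite Rmult_assoc; apply Rmult_le_compat_l; [exact HA0|].
  rewrite Rmult_comm; apply Hk1.
assert (Hsum : forall n, rsum (fun k => Cmod (b k)) (seq 0 n) <= 2 * A / q).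
  intros n; apply Rle_trans with (rsum (fun k => A / q * (/ 2) ^ k) (seq 0 n)).
    apply rsum_le, Hb.
  rewrite rsum_scal; replace (2 * A / q) with (A / q * 2) by (field; lra).
  apply Rmult_le_compat_l; [|apply rsum_half_pow].
  apply Rmult_le_pos; [lra | left; apply Rinv_0_lt_compat, Hq].
assert (HD : cseries b (CSeries b)).
  apply cseries_abs, ex_series_bounded with (2 := Hsum); intros; apply Cmod_ge_0.
assert (Hzr : Cmod t < r) by (unfold q in Hz; lra).
exists (CSeries b); split.
  apply (climit_le _ _ _ HD); intros n; eapply Rle_trans; [apply Cmod_csum|].
  eapply Rle_trans; [apply Hsum | unfold K; lra].
intros z' Hz'; set (t' := (z' - z0)%C) in *.
assert (Hzr' : Cmod t' < r) by (unfold q in Hz'; lra).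
replace (z' - z)%C with (t' - t)%C by (unfold t, t'; ring).
replace (F z' - F z - (t' - t) * CSeries b)%C with
  (F z' + ((- (1)) * F z + (- (t' - t)) * CSeries b))%C by ring.
apply (climit_le _ _ _ (cseries_plus _ _ _ _ (HF z' Hzr')
  (cseries_plus _ _ _ _ (cseries_scal _ _ (- (1))%C (HF z Hzr))
    (cseries_scal _ _ (- (t' - t))%C HD)))).
intros n; fold t t'; apply Rle_trans with (2 * A / q ^ 2 * Cmod (t' - t) ^ 2).
  eapply Rle_trans; [apply Cmod_csum|].
  apply Rle_trans with
    (rsum (fun k => A / q ^ 2 * Cmod (t' - t) ^ 2 * (/ 2) ^ k) (seq 0 n)).
    apply rsum_le; intros k.
    replace (a k * t' ^ k + (- (1) * (a k * t ^ k) + - (t' - t) * b k))%C with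
      (a k * (t' ^ k - t ^ k - INR k * t ^ pred k * (t' - t)))%C by (unfold b; ring).
    rewrite Cmod_mult; apply Rmult_le_reg_r with (q ^ 2); [exact Hq2|].
    assert (H := pow_taylor t t' q k Hq Hz Hz').
    apply Rle_trans with (Cmod (a k) * (INR k ^ 2 * q ^ k * Cmod (t' - t) ^ 2)).
      rewrite Rmult_assoc; apply Rmult_le_compat_l; [apply Cmod_ge_0 | exact H].
    replace (Cmod (a k) * (INR k ^ 2 * q ^ k * Cmod (t' - t) ^ 2)) with
      (Cmod (a k) * q ^ k * INR k ^ 2 * Cmod (t' - t) ^ 2) by ring.
    replace (A / q ^ 2 * Cmod (t' - t) ^ 2 * (/ 2) ^ k * q ^ 2) with
      (A * (/ 2) ^ k * Cmod (t' - t) ^ 2) by (field; lra).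
    apply Rmult_le_compat_r; [apply pow2_ge_0|].
    apply Rle_trans with (A * (/ 8) ^ k * INR k ^ 2).
      apply Rmult_le_compat_r; [apply pow2_ge_0 | apply Ha].
    rewrite Rmult_assoc; apply Rmult_le_compat_l; [exact HA0|].
    rewrite Rmult_comm; apply Hk2.
  rewrite rsum_scal; replace (2 * A / q ^ 2 * Cmod (t' - t) ^ 2) with
    (A / q ^ 2 * Cmod (t' - t) ^ 2 * 2) by (field; lra).
  apply Rmult_le_compat_l; [|apply rsum_half_pow].
  apply Rmult_le_pos; [|apply pow2_ge_0].
  apply Rmult_le_pos; [lra | left; apply Rinv_0_lt_compat, Hq2].
apply Rmult_le_compat_r; [apply pow2_ge_0 | unfold K; lra].
Qed.

(** Differentiability with a quadratic remainder, uniform on a closed disc. This form passes to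
    products and is all that the discrete Cauchy formula asks of F. *)
Definition second_order (rho K : R) (F D : C -> C) : Prop :=
  forall z, Cmod z <= rho -> Cmod (F z) <= K /\ Cmod (D z) <= K /\
  forall z', Cmod z' <= rho ->
    Cmod (F z' - F z - (z' - z) * D z) <= K * Cmod (z' - z) ^ 2.

Lemma analytic_second_order (F : C -> C) rho : 0 <= rho < 1 ->
  analytic_on unit_disc F -> (forall z, unit_disc z -> unit_disc (F z)) ->
  exists K D, 0 < K /\ second_order rho K F D.
Proof.
intros Hrho Han Hself.
(* One number e records the local data: the estimate holds within 3e of the centre, with constants
   at most 1/e. The radius 3e covers a point within 2e of the centre and a second point within e of
   the first. *)
assert (Hloc : forall u v : R, { e : posreal | Cmod (u, v) < 1 ->
    forall z, Cmod (z - (u, v)) <= 3 * e -> exists D, Cmod D <= / e /\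
    forall z', Cmod (z' - (u, v)) <= 3 * e ->
      Cmod (F z' - F z - (z' - z) * D) <= / e * Cmod (z' - z) ^ 2 }).
  intros u v; apply constructive_indefinite_description.
  destruct (Rlt_dec (Cmod (u, v)) 1) as [Huv | Huv].
  2:{ exists (mkposreal 1 Rlt_0_1); intros; contradiction. }
  destruct (Han (u, v) Huv) as [a [r Har]].
  destruct (pseries_second_order F (u, v) a r) as [d [K [Hd [HK H]]]].
    intros z Hz; apply pseries_cseries, Har, Hz.
  assert (He : 0 < Rmin (d / 3) (/ K)).
    apply Rmin_glb_lt; [lra | apply Rinv_0_lt_compat, HK].
  exists (mkposreal _ He); intros _ z Hz; simpl in *.
  assert (H1 := Rmin_l (d / 3) (/ K)); assert (H2 := Rmin_r (d / 3) (/ K)).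
  assert (H3 : K <= / Rmin (d / 3) (/ K)).
    rewrite <- (Rinv_inv K) at 1; apply Rinv_le_contravar; assumption.
  destruct (H z ltac:(lra)) as [D [HD1 HD2]]; exists D; split; [lra|].
  intros z' Hz'; eapply Rle_trans; [apply HD2; lra|].
  apply Rmult_le_compat_r; [apply pow2_ge_0 | exact H3].
assert (Hg : 0 < (1 - rho) / 2) by lra.
(* Centres outside the open disc get the radius (1 - rho)/2, too small for them to be selected for a
   point of modulus at most rho. *)
set (dl u v := if Rlt_dec (Cmod (u, v)) 1 then proj1_sig (Hloc u v)
  else mkposreal _ Hg).
destruct (compactness_value_2d (-1) 1 (-1) 1 dl) as [d Hd].
assert (Hunif : forall z, Cmod z <= rho -> exists D, Cmod D <= / d /\
    forall z', Cmod (z' - z) < d ->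
      Cmod (F z' - F z - (z' - z) * D) <= / d * Cmod (z' - z) ^ 2).
  intros z Hz.
  assert (Hre := re_le_Cmod z); assert (Him := im_le_Cmod z).
  apply Rabs_le_between in Hre, Him.
  assert (Hd' := Hd (Re z) (Im z) ltac:(lra) ltac:(lra)).
  apply NNPP in Hd'; destruct Hd' as [u [v [_ [_ [Hu [Hv Hduv]]]]]].
  assert (Hzuv : Cmod (z - (u, v)) <= Rabs (Re z - u) + Rabs (Im z - v)).
    eapply Rle_trans; [apply Cmod_le_Re_Im|]; right; f_equal; f_equal;
      unfold Re, Im; simpl; ring.
  unfold dl in *; destruct (Rlt_dec (Cmod (u, v)) 1) as [Huv | Huv].
  - destruct (Hloc u v) as [e He]; cbn [proj1_sig] in *.
    assert (Hze : Cmod (z - (u, v)) <= 3 * e) by (assert (He0 := cond_pos e); lra).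
    destruct (He Huv z Hze) as [D [HD1 HD2]].
    assert (Hinv : / e <= / d) by (apply Rinv_le_contravar; [apply cond_pos | exact Hduv]).
    exists D; split; [lra|]; intros z' Hz'.
    eapply Rle_trans; [apply HD2|].
      replace (z' - (u, v))%C with ((z' - z) + (z - (u, v)))%C by ring.
      eapply Rle_trans; [apply Cmod_triangle|]; assert (He0 := cond_pos e); lra.
    apply Rmult_le_compat_r; [apply pow2_ge_0 | exact Hinv].
  - exfalso; cbn [pos] in *.
    assert (H := Cmod_triangle z ((u, v) - z)).
    generalize dependent ((u, v) : C); intros c Hc Hzc H.
    replace (z + (c - z))%C with c in H by ring.
    replace (c - z)%C with (- (z - c))%C in H by ring.
    rewrite Cmod_opp in H; lra.
assert (Hd0 := cond_pos d).
assert (Hi : 0 < / d) by (apply Rinv_0_lt_compat, Hd0).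
set (K := 1 + / d + 3 * (/ d) ^ 2).
assert (HK : / d <= K /\ 1 <= K /\ 2 * (/ d) ^ 2 + (/ d) ^ 2 <= K).
  unfold K; assert (H := pow2_ge_0 (/ d)); lra.
assert (HD : forall z, { D | Cmod z <= rho -> Cmod D <= / d /\ forall z', Cmod z' <= rho ->
    Cmod (F z' - F z - (z' - z) * D) <= K * Cmod (z' - z) ^ 2 }).
  intros z; apply constructive_indefinite_description.
  destruct (Rle_dec (Cmod z) rho) as [Hz | Hz]; [|exists (RtoC 0); intros; contradiction].
  destruct (Hunif z Hz) as [D [HD1 HD2]]; exists D; intros _; split; [exact HD1|].
  intros z' Hz'; destruct (Rlt_le_dec (Cmod (z' - z)) d) as [Hzz | Hzz].
    eapply Rle_trans; [apply HD2, Hzz|].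
    apply Rmult_le_compat_r; [apply pow2_ge_0 | lra].
  set (m := Cmod (z' - z)) in *.
  (* Points far apart need no differentiability: |F| < 1 bounds the left side by 2 + m/d, and m >= d
     turns this into 3 (m/d)^2. *)
  assert (H1 : Cmod (F z' - F z - (z' - z) * D) <= 2 + m * / d).
    eapply Rle_trans; [apply Cmod_triangle|]; rewrite Cmod_opp, Cmod_mult; fold m.
    assert (H2 : Cmod (F z' - F z) <= Cmod (F z') + Cmod (F z)).
      rewrite <- (Cmod_opp (F z)); apply Cmod_triangle.
    assert (H3 : unit_disc (F z)) by (apply Hself; unfold unit_disc; lra).
    assert (H4 : unit_disc (F z')) by (apply Hself; unfold unit_disc; lra).
    unfold unit_disc in *.
    assert (m * Cmod D <= m * / d) by (apply Rmult_le_compat_l; lra).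
    lra.
  assert (H2 : 1 <= m * / d).
    replace 1 with (d * / d) by (field; lra); apply Rmult_le_compat_r; lra.
  apply Rle_trans with (3 * (m * / d) ^ 2); [nra|].
  replace (3 * (m * / d) ^ 2) with ((2 * (/ d) ^ 2 + (/ d) ^ 2) * m ^ 2) by ring.
  apply Rmult_le_compat_r; [apply pow2_ge_0 | lra].
exists K, (fun z => proj1_sig (HD z)); split; [lra|].
intros z Hz; destruct (proj2_sig (HD z) Hz) as [H1 H2].
assert (H3 : unit_disc (F z)) by (apply Hself; unfold unit_disc; lra).
unfold unit_disc in H3; repeat split; [lra | lra | exact H2].
Qed.

(** * The discrete Cauchy formula *)

Definition mean (N : nat) (f : nat -> C) : C :=
  (RtoC (/ INR N) * csum f (seq 0 N))%C.

Lemma Cmod_mean_le N f B : 0 <= B ->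
  Cmod (csum f (seq 0 N)) <= INR N * B -> Cmod (mean N f) <= B.
Proof.
intros HB H; unfold mean; rewrite Cmod_mult, Cmod_R.
destruct N as [|N].
  simpl csum; rewrite Cmod_0, Rmult_0_r; exact HB.
assert (HN : 0 < INR (S N)) by (apply lt_0_INR; lia).
rewrite Rabs_pos_eq by (left; apply Rinv_0_lt_compat, HN).
apply Rmult_le_reg_l with (INR (S N)); [exact HN|].
rewrite <- Rmult_assoc, Rinv_r, Rmult_1_l by lra; exact H.
Qed.

Lemma zeta_to_1 : is_lim_seq (fun N => Cmod (zeta N - 1)) 0.
Proof.
assert (Ht : is_lim_seq (fun N => 2 * PI / INR N) 0).
  rewrite <- (Rmult_0_r (2 * PI)).
  apply (is_lim_seq_scal_l _ (2 * PI) 0).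
  apply (is_lim_seq_inv INR p_infty); [apply is_lim_seq_INR | discriminate].
change (climit zeta 1); apply climit_Re_Im.
- change (is_lim_seq (fun N => cos (2 * PI / INR N)) 1); rewrite <- cos_0.
  apply (is_lim_seq_continuous cos); [apply continuity_cos | exact Ht].
- change (is_lim_seq (fun N => sin (2 * PI / INR N)) 0); rewrite <- sin_0.
  apply (is_lim_seq_continuous sin); [apply continuity_sin | exact Ht].
Qed.

Lemma zeta_neq1 N : (2 <= N)%nat -> (zeta N - 1)%C <> 0.
Proof.
intros HN; apply cis_neq1.
assert (H2 : 2 <= INR N) by (apply (le_INR 2); exact HN).
assert (HPI := PI_RGT_0).
rewrite Rabs_pos_eq.
  split; [apply Rdiv_lt_0_compat; lra|].
  apply Rmult_lt_reg_r with (INR N); [lra|].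
  unfold Rdiv; rewrite Rmult_assoc, Rinv_l, Rmult_1_r by lra; nra.
apply Rmult_le_pos; [lra | left; apply Rinv_0_lt_compat; lra].
Qed.

Lemma Cmod_conj_zeta_pow N j : Cmod (Cconj (zeta N) ^ j) = 1.
Proof. rewrite <- Cpow_conj, Cmod_conj; apply Cmod_zeta_pow. Qed.

Lemma kernel_circle_neq0 a e : Cmod a < 1 -> Cmod e = 1 -> (1 - a * e)%C <> 0.
Proof.
intros Ha He; apply Cneq_of_Cmod; rewrite Cmod_mult, He, Cmod_1; lra.
Qed.

(** Multiplication by 1 - a^N turns each kernel into a finite geometric sum, of which orthogonality
    of the roots of unity keeps the term k = 0. *)
Lemma mean_kernel (a : C) N : Cmod a < 1 -> (1 <= N)%nat ->
  mean N (fun j => / (1 - a * Cconj (zeta N) ^ j))%C = (/ (1 - a ^ N))%C.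
Proof.
intros Ha HN; set (e := Cconj (zeta N)).
assert (HN0 : 0 < INR N) by (apply lt_0_INR; lia).
assert (HeN : forall j, ((e ^ j) ^ N)%C = 1).
  intros j; unfold e; rewrite <- Cpow_mult_r, Nat.mul_comm, Cpow_mult_r, <- Cpow_conj,
    zeta_pow_N by lia.
  rewrite Cconj_1.
  apply Cpow_1_l.
assert (HaN : (1 - a ^ N)%C <> 0).
  apply Cneq_of_Cmod; rewrite Cmod_1, Cmod_pow.
  assert (H := pow_lt_1_compat (Cmod a) N (conj (Cmod_ge_0 a) Ha) ltac:(lia)); lra.
assert (H1 : ((1 - a ^ N) * csum (fun j => / (1 - a * e ^ j)) (seq 0 N))%C = INR N).
  rewrite <- csum_scal.
  rewrite (csum_ext _ (fun j => csum (fun k => a ^ k * (e ^ (j * k) * zeta N ^ (j * 0)))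
    (seq 0 N)))%C.
    rewrite csum_switch.
    destruct N as [|n]; [lia|].
    rewrite csum_seq_S_l, (csum_ext_in _ (fun _ => RtoC 0) (seq 1 n)).
      unfold e; rewrite csum_0, csum_scal, zeta_sum_diag; simpl Cpow; ring.
    intros k Hk; apply in_seq in Hk.
    unfold e; rewrite csum_scal, zeta_sum_0 by lia; ring.
  intros j; assert (H := kernel_circle_neq0 a (e ^ j) Ha (Cmod_conj_zeta_pow N j)).
  transitivity (csum (fun k => (a * e ^ j) ^ k)%C (seq 0 N)).
    rewrite csum_geom.
      rewrite Cpow_mult_l, HeN; field; exact H.
    intros E; apply H; rewrite <- Copp_0, <- E; ring.
  apply csum_ext; intros k.
  rewrite Cpow_mult_l, <- Cpow_mult_r, Nat.mul_0_r; simpl; ring.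
unfold mean; rewrite RtoC_inv by lra.
assert (HNC : RtoC (INR N) <> 0) by (apply RtoC_neq0; lra).
replace (csum _ (seq 0 N)) with (RtoC (INR N) / (1 - a ^ N))%C by (rewrite <- H1; field; exact HaN).
field; auto.
Qed.

Lemma climit_pow0 (a : C) : Cmod a < 1 -> climit (fun n => a ^ n)%C 0.
Proof.
intros Ha; apply is_lim_seq_ext with (fun n => Cmod a ^ n).
  intros n; rewrite <- Cmod_pow; f_equal; ring.
apply is_lim_seq_pow0; split; [apply Cmod_ge_0 | exact Ha].
Qed.

Lemma climit_mult u v l m :
  climit u l -> climit v m -> climit (fun n => (u n * v n)%C) (l * m).
Proof.
intros Hu Hv; apply lim0_le with (fun n => Cmod (u n - l) * Cmod (v n - m)
  + (Cmod l * Cmod (v n - m) + Cmod m * Cmod (u n - l))).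
  intros n; split; [apply Cmod_ge_0|].
  replace (u n * v n - l * m)%C with ((u n - l) * (v n - m)
    + (l * (v n - m) + m * (u n - l)))%C by ring.
  eapply Rle_trans; [apply Cmod_triangle|]; rewrite Cmod_mult; apply Rplus_le_compat_l.
  eapply Rle_trans; [apply Cmod_triangle|]; rewrite !Cmod_mult; lra.
replace 0 with (0 * 0 + (Cmod l * 0 + Cmod m * 0)) by ring.
apply is_lim_seq_plus'; [apply is_lim_seq_mult'; assumption|].
apply is_lim_seq_plus'; apply is_lim_seq_mult'; try assumption; apply is_lim_seq_const.
Qed.

Lemma climit_conj u l : climit u l -> climit (fun n => Cconj (u n)) (Cconj l).
Proof.
apply is_lim_seq_ext; intros n; rewrite <- Cminus_conj, Cmod_conj; reflexivity.
Qed.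

Lemma climit_csum {A} (u : A -> nat -> C) (s : A -> C) (l : list A) :
  (forall x, In x l -> climit (u x) (s x)) ->
  climit (fun n => csum (fun x => u x n) l) (csum s l).
Proof.
induction l as [|x l IH]; intros H; simpl; [apply climit_const|].
apply (climit_plus (u x)); [|apply IH]; intros; apply H; simpl; auto.
Qed.

Lemma climit_mean_kernel (a : C) : Cmod a < 1 ->
  climit (fun N => mean N (fun j => / (1 - a * Cconj (zeta N) ^ j))%C) 1.
Proof.
intros Ha.
assert (Hne : forall N, (1 <= N)%nat -> (1 - a ^ N)%C <> 0).
  intros N HN; apply Cneq_of_Cmod; rewrite Cmod_1, Cmod_pow.
  assert (H := pow_lt_1_compat (Cmod a) N (conj (Cmod_ge_0 a) Ha) ltac:(lia)); lra.
apply (is_lim_seq_le_le_loc (fun _ => 0) _ (fun N => Cmod a ^ N * / (1 - Cmod a))).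
- exists 1%nat; intros N HN; split; [apply Cmod_ge_0|].
  rewrite mean_kernel by assumption.
  replace (/ (1 - a ^ N) - 1)%C with (a ^ N * / (1 - a ^ N))%C by (field; auto).
  rewrite Cmod_mult, Cmod_pow, Cmod_inv by auto.
  apply Rmult_le_compat_l; [apply pow_le, Cmod_ge_0|].
  apply Rinv_le_contravar; [lra|].
  assert (H1 := Cmod_triangle (1 - a ^ N) (a ^ N)).
  replace (1 - a ^ N + a ^ N)%C with (RtoC 1) in H1 by ring.
  rewrite Cmod_1, Cmod_pow in H1.
  assert (H2 : Cmod a ^ N <= Cmod a ^ 1).
    assert (H3 := Cmod_ge_0 a).
    replace N with (1 + (N - 1))%nat by lia; rewrite pow_add.
    rewrite <- (Rmult_1_r (Cmod a ^ 1)) at 2; apply Rmult_le_compat_l.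
      apply pow_le; lra.
    rewrite <- (pow1 (N - 1)); apply pow_incr; lra.
  simpl in H2; lra.
- apply is_lim_seq_const.
- rewrite <- (Rmult_0_l (/ (1 - Cmod a))).
  apply is_lim_seq_mult'; [|apply is_lim_seq_const].
  apply is_lim_seq_pow0; split; [apply Cmod_ge_0 | exact Ha].
Qed.

Lemma le_of_le_div (x A B : R) : (forall M, (1 <= M)%nat -> x <= A + B / INR M) -> x <= A.
Proof.
intros H.
apply (is_lim_seq_le_loc (fun _ => x) (fun M => A + B * / INR M) x A).
- exists 1%nat; exact H.
- apply is_lim_seq_const.
- rewrite <- (Rplus_0_r A) at 1; apply is_lim_seq_plus'; [apply is_lim_seq_const|].
  rewrite <- (Rmult_0_r B); apply (is_lim_seq_scal_l _ B 0).
  apply (is_lim_seq_inv INR p_infty); [apply is_lim_seq_INR | discriminate].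
Qed.

Lemma csum_telescope (f : nat -> C) n :
  csum (fun j => f (S j) - f j)%C (seq 0 n) = (f n - f 0%nat)%C.
Proof.
induction n as [|n IH]; [simpl; ring|].
rewrite seq_S, csum_app, IH; simpl; ring.
Qed.

Section DiscreteCauchy.

Variables (F D : C -> C) (K r : R) (z : C) (N : nat).
Hypotheses (Hr : 0 < r) (HK : 0 <= K) (HF : second_order r K F D)
  (Hz : Cmod z < 1) (HN : (2 <= N)%nat).

Let w := (r * z)%C.
Let gam j := (r * zeta N ^ j)%C.
Let W j := (/ (1 - z * Cconj (zeta N) ^ j))%C.
(* The homotopy contracting the circle [|z| = r] to the point [w]. *)
Let P (t : R) j := (w + t * (gam j - w))%C.

Lemma homotopy_Cmod_gam j : Cmod (gam j) = r.
Proof. unfold gam; rewrite Cmod_mult, Cmod_zeta_pow, Cmod_R, Rabs_pos_eq; lra. Qed.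

Lemma homotopy_Cmod_w : Cmod w <= r.
Proof.
unfold w; rewrite Cmod_mult, Cmod_R, Rabs_pos_eq by lra.
rewrite <- (Rmult_1_r r) at 2; apply Rmult_le_compat_l; lra.
Qed.

Lemma homotopy_Cmod_P t j : 0 <= t <= 1 -> Cmod (P t j) <= r.
Proof.
intros Ht; unfold P.
replace (w + t * (gam j - w))%C with (RtoC (1 - t) * w + t * gam j)%C
  by (rewrite RtoC_minus; ring).
eapply Rle_trans; [apply Cmod_triangle|].
rewrite !Cmod_mult, !Cmod_R, !Rabs_pos_eq, homotopy_Cmod_gam by lra.
assert (H := homotopy_Cmod_w); nra.
Qed.

(* The points [P t j] run around a circle, so the increments of [F] sum to 0;
   to first order these are [t (zeta - 1) gam_j D(P t j)]. *)
Lemma homotopy_derivative_sum t : 0 <= t <= 1 ->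
  Cmod (csum (fun j => gam j * D (P t j))%C (seq 0 N))
  <= INR N * (K * r ^ 2 * Cmod (zeta N - 1)).
Proof.
intros Ht; set (S0 := csum _ _).
set (d := Cmod (zeta N - 1)).
assert (Hd : 0 < d) by (apply Cmod_gt_0, zeta_neq1, HN).
assert (HN0 : 0 < INR N) by (apply lt_0_INR; lia).
(* The general argument divides by t. At t = 0 the circle has shrunk to the point w, and the sum of
   the roots of unity vanishes. *)
destruct (Req_dec t 0) as [-> | Ht0].
  replace S0 with (RtoC 0).
    rewrite Cmod_0; apply Rmult_le_pos; [lra|]; apply Rmult_le_pos; [|lra].
    apply Rmult_le_pos; [lra | apply pow2_ge_0].
  unfold S0, P; symmetry.
  rewrite (csum_ext _ (fun j => (r * D w) * (Cconj (zeta N) ^ (j * 0)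
    * zeta N ^ (j * 1)))%C).
    rewrite csum_scal, zeta_sum_0 by lia; ring.
  intros j; replace (w + 0 * (gam j - w))%C with w by ring.
  unfold gam; rewrite Nat.mul_0_r, Nat.mul_1_r; simpl; ring.
assert (HP : forall j, (P t (S j) - P t j)%C = (t * gam j * (zeta N - 1))%C).
  intros j; unfold P, gam; simpl; ring.
assert (H : Cmod (csum (fun j => F (P t (S j)) - F (P t j)
    - (P t (S j) - P t j) * D (P t j))%C (seq 0 N)) <= INR N * (K * (t * r * d) ^ 2)).
  eapply Rle_trans; [apply Cmod_csum|].
  rewrite <- (length_seq N 0) at 2; rewrite <- rsum_const.
  apply rsum_le; intros j.
  destruct (HF (P t j) (homotopy_Cmod_P t j Ht)) as [_ [_ H]].
  eapply Rle_trans; [apply H, homotopy_Cmod_P, Ht|].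
  rewrite HP, !Cmod_mult, Cmod_R, homotopy_Cmod_gam, Rabs_pos_eq by lra.
  fold d; lra.
rewrite csum_minus, (csum_telescope (fun j => F (P t j))) in H.
replace (P t N) with (P t 0) in H.
2:{ unfold P, gam; rewrite zeta_pow_N by lia; reflexivity. }
rewrite (csum_ext _ (fun j => (t * (zeta N - 1)) * (gam j * D (P t j)))%C) in H.
2:{ intros j; rewrite HP; ring. }
rewrite csum_scal in H; fold S0 in H.
replace (F (P t 0) - F (P t 0) - t * (zeta N - 1) * S0)%C with
  (- (t * (zeta N - 1) * S0))%C in H by ring.
rewrite Cmod_opp, !Cmod_mult, Cmod_R, Rabs_pos_eq in H by lra; fold d in H.
assert (Htd : 0 < t * d) by (apply Rmult_lt_0_compat; lra).
apply Rmult_le_reg_l with (t * d); [exact Htd|].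
eapply Rle_trans; [exact H|].
replace (INR N * (K * (t * r * d) ^ 2)) with (t * d * (INR N * (K * r ^ 2 * d)) * t) by ring.
rewrite <- (Rmult_1_r (t * d * (INR N * (K * r ^ 2 * d)))) at 2.
apply Rmult_le_compat_l; [|lra].
apply Rmult_le_pos; [lra|]; apply Rmult_le_pos; [lra|].
apply Rmult_le_pos; [|lra]; apply Rmult_le_pos; [lra | apply pow2_ge_0].
Qed.

Lemma homotopy_W_neq0 j : (1 - z * Cconj (zeta N) ^ j)%C <> 0.
Proof. apply kernel_circle_neq0; [exact Hz | apply Cmod_conj_zeta_pow]. Qed.

Lemma homotopy_Cmod_W j : Cmod (W j) <= / (1 - Cmod z).
Proof.
unfold W; rewrite Cmod_inv by apply homotopy_W_neq0.
apply Rinv_le_contravar; [lra|].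
assert (H := Cmod_triangle (1 - z * Cconj (zeta N) ^ j) (z * Cconj (zeta N) ^ j)).
replace (1 - z * Cconj (zeta N) ^ j + z * Cconj (zeta N) ^ j)%C with (RtoC 1) in H by ring.
rewrite Cmod_1, Cmod_mult, Cmod_conj_zeta_pow in H; lra.
Qed.

(** The Cauchy kernel cancels the velocity gam_j - w of the homotopy up to the factor gam_j. The
    derivative in t of the weighted sum is therefore the sum estimated in
    [homotopy_derivative_sum]. *)
Lemma homotopy_gam_W j : ((gam j - w) * W j)%C = gam j.
Proof.
unfold W, gam, w.
assert (E : (zeta N ^ j * Cconj (zeta N) ^ j)%C = 1) by apply zeta_pow_conj_1.
replace (r * zeta N ^ j - r * z)%C with
  (r * zeta N ^ j * (1 - z * Cconj (zeta N) ^ j))%C.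
  field; apply homotopy_W_neq0.
transitivity (r * zeta N ^ j - r * z * (zeta N ^ j * Cconj (zeta N) ^ j))%C; [ring|].
rewrite E; ring.
Qed.

Let g (t : R) := csum (fun j => F (P t j) * W j)%C (seq 0 N).

(** One Euler step: a first-order part, small like |zeta - 1|, and a remainder quadratic in s. *)
Lemma homotopy_step t s : 0 <= t -> 0 <= s -> t + s <= 1 ->
  Cmod (g (t + s) - g t) <= s * (INR N * (K * r ^ 2 * Cmod (zeta N - 1)))
    + s ^ 2 * (INR N * (4 * K * r ^ 2 * / (1 - Cmod z))).
Proof.
intros Ht Hs Hts; unfold g; rewrite <- csum_minus.
rewrite (csum_ext _ (fun j => s * (gam j * D (P t j)) +
  (F (P (t + s) j) - F (P t j) - (P (t + s) j - P t j) * D (P t j)) * W j)%C).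
2:{ intros j; rewrite <- (homotopy_gam_W j) at 1; unfold P; rewrite RtoC_plus; ring. }
rewrite csum_plus, csum_scal.
eapply Rle_trans; [apply Cmod_triangle|]; apply Rplus_le_compat.
  rewrite Cmod_mult, Cmod_R, Rabs_pos_eq by lra.
  apply Rmult_le_compat_l; [lra|]; apply homotopy_derivative_sum; lra.
eapply Rle_trans; [apply Cmod_csum|].
rewrite <- Rmult_assoc, (Rmult_comm (s ^ 2)), Rmult_assoc.
rewrite <- (length_seq N 0) at 2; rewrite <- rsum_const.
apply rsum_le; intros j; rewrite Cmod_mult.
destruct (HF (P t j) (homotopy_Cmod_P t j ltac:(lra))) as [_ [_ H]].
specialize (H (P (t + s) j) (homotopy_Cmod_P (t + s) j ltac:(lra))).
replace (s ^ 2 * (4 * K * r ^ 2 * / (1 - Cmod z))) with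
  (K * (s * (2 * r)) ^ 2 * / (1 - Cmod z)) by ring.
apply Rmult_le_compat; try apply Cmod_ge_0; [|apply homotopy_Cmod_W].
eapply Rle_trans; [exact H|].
apply Rmult_le_compat_l; [exact HK|].
apply pow_incr; split; [apply Cmod_ge_0|].
replace (P (t + s) j - P t j)%C with (s * (gam j - w))%C by (unfold P; rewrite RtoC_plus; ring).
rewrite Cmod_mult, Cmod_R, Rabs_pos_eq by lra; apply Rmult_le_compat_l; [lra|].
eapply Rle_trans; [apply Cmod_triangle|].
rewrite Cmod_opp, homotopy_Cmod_gam; assert (H1 := homotopy_Cmod_w); lra.
Qed.

(** M steps of length 1/M add up to A + B/M; M tends to infinity while N stays fixed. *)
Lemma homotopy_total : Cmod (g 1 - g 0) <= INR N * (K * r ^ 2 * Cmod (zeta N - 1)).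
Proof.
set (A := INR N * (K * r ^ 2 * Cmod (zeta N - 1))).
set (B := INR N * (4 * K * r ^ 2 * / (1 - Cmod z))).
apply le_of_le_div with B; intros M HM.
assert (HM0 : 0 < INR M) by (apply lt_0_INR; lia).
assert (H : forall k, (k <= M)%nat ->
    Cmod (g (INR k * / INR M) - g 0) <= INR k * (/ INR M * A + (/ INR M) ^ 2 * B)).
  induction k as [|k IH]; intros Hk.
    simpl INR; rewrite !Rmult_0_l.
    replace (g 0 - g 0)%C with (RtoC 0) by ring; rewrite Cmod_0; lra.
  replace (g (INR (S k) * / INR M) - g 0)%C with
    ((g (INR k * / INR M + / INR M) - g (INR k * / INR M)) + (g (INR k * / INR M) - g 0))%C.
    eapply Rle_trans; [apply Cmod_triangle|].
    assert (Hinv : 0 < / INR M) by (apply Rinv_0_lt_compat, HM0).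
    assert (H1 := homotopy_step (INR k * / INR M) (/ INR M)
      ltac:(apply Rmult_le_pos; [apply pos_INR | lra]) ltac:(lra)).
    assert (H2 : INR k * / INR M + / INR M <= 1).
      replace (INR k * / INR M + / INR M) with (INR (S k) * / INR M) by (rewrite S_INR; ring).
      apply Rmult_le_reg_r with (INR M); [exact HM0|].
      rewrite Rmult_assoc, Rinv_l, Rmult_1_r, Rmult_1_l by lra; apply le_INR, Hk.
    specialize (H1 H2); specialize (IH ltac:(lia)); fold A B in H1.
    rewrite S_INR; lra.
  rewrite S_INR; replace ((INR k + 1) * / INR M) with (INR k * / INR M + / INR M) by ring; ring.
specialize (H M (Nat.le_refl M)); rewrite Rinv_r in H by lra.
eapply Rle_trans; [exact H|]; right; field; lra.
Qed.

Lemma discrete_cauchy_error :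
  Cmod (mean N (fun j => F (r * zeta N ^ j) * / (1 - z * Cconj (zeta N) ^ j))
    - F (r * z) * mean N (fun j => / (1 - z * Cconj (zeta N) ^ j)))%C
  <= K * r ^ 2 * Cmod (zeta N - 1).
Proof.
replace (mean N _ - _)%C with (mean N (fun j => F (P 1 j) * W j - F (P 0 j) * W j)%C).
  apply Cmod_mean_le.
    apply Rmult_le_pos; [|apply Cmod_ge_0]; apply Rmult_le_pos; [lra | apply pow2_ge_0].
  rewrite csum_minus; apply homotopy_total.
unfold mean; rewrite csum_minus.
rewrite (csum_ext (fun j => F (P 0 j) * W j)%C (fun j => F (r * z) * W j)%C).
  rewrite csum_scal, (csum_ext (fun j => F (P 1 j) * W j)%C
    (fun j => F (r * zeta N ^ j) * / (1 - z * Cconj (zeta N) ^ j))%C).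
    unfold W; ring.
  intros j; unfold W, P, gam, w; do 2 f_equal; ring.
intros j; unfold P, w; do 2 f_equal; ring.
Qed.

End DiscreteCauchy.

Lemma discrete_cauchy F D K r z : 0 < r -> 0 <= K -> second_order r K F D -> Cmod z < 1 ->
  climit (fun N => mean N (fun j =>
    F (r * zeta N ^ j) * / (1 - z * Cconj (zeta N) ^ j))%C) (F (r * z)%C).
Proof.
intros Hr HK HF Hz.
apply climit_ext with (fun N =>
  (mean N (fun j => F (r * zeta N ^ j) * / (1 - z * Cconj (zeta N) ^ j))
    - F (r * z) * mean N (fun j => / (1 - z * Cconj (zeta N) ^ j)))
  + F (r * z) * mean N (fun j => / (1 - z * Cconj (zeta N) ^ j)))%C.
  intros N; ring.
refine (eq_ind _ (climit _) _ _ (_ : (0 + F (r * z) * 1)%C = F (r * z)%C)); [|ring].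
apply climit_plus; [|apply climit_scal, climit_mean_kernel, Hz].
apply (is_lim_seq_le_le_loc (fun _ => 0) _ (fun N => K * r ^ 2 * Cmod (zeta N - 1))).
- exists 2%nat; intros N HN; split; [apply Cmod_ge_0|].
  replace (_ - 0)%C with (mean N (fun j => F (r * zeta N ^ j) * / (1 - z * Cconj (zeta N) ^ j))
    - F (r * z) * mean N (fun j => / (1 - z * Cconj (zeta N) ^ j)))%C by ring.
  apply (discrete_cauchy_error F D); assumption.
- apply is_lim_seq_const.
- rewrite <- (Rmult_0_r (K * r ^ 2)).
  apply (is_lim_seq_scal_l _ _ 0), zeta_to_1.
Qed.

(** * Pick positivity and composition operators *)

Lemma second_order_ge0 rho K F D : 0 <= rho -> second_order rho K F D -> 0 <= K.
Proof.
intros Hrho H; destruct (H (RtoC 0)) as [H1 _]; [rewrite Cmod_0; exact Hrho|].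
eapply Rle_trans; [apply Cmod_ge_0 | exact H1].
Qed.

(** The remainder is bounded by K L (3 + d) d^2 with d = |z' - z| <= 2 rho, which explains the
    constant. *)
Lemma second_order_mult rho K L F D G E : 0 <= rho ->
  second_order rho K F D -> second_order rho L G E ->
  second_order rho (K * L * (3 + 2 * rho)) (fun z => F z * G z)%C
    (fun z => D z * G z + F z * E z)%C.
Proof.
intros Hrho HF HG.
assert (HK := second_order_ge0 _ _ _ _ Hrho HF).
assert (HL := second_order_ge0 _ _ _ _ Hrho HG).
assert (HKL : 0 <= K * L) by (apply Rmult_le_pos; assumption).
intros z Hz; destruct (HF z Hz) as [HF1 [HF2 HF3]]; destruct (HG z Hz) as [HG1 [HG2 HG3]].
assert (H1 := Cmod_ge_0 (F z)); assert (H2 := Cmod_ge_0 (D z)).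
assert (H3 := Cmod_ge_0 (G z)); assert (H4 := Cmod_ge_0 (E z)).
repeat split.
- rewrite Cmod_mult; apply Rle_trans with (K * L); [apply Rmult_le_compat; lra | nra].
- eapply Rle_trans; [apply Cmod_triangle|]; rewrite !Cmod_mult.
  apply Rle_trans with (K * L + K * L); [|nra].
  apply Rplus_le_compat; apply Rmult_le_compat; lra.
- intros z' Hz'; specialize (HF3 z' Hz'); specialize (HG3 z' Hz').
  destruct (HG z' Hz') as [HG1' _].
  replace (F z' * G z' - F z * G z - (z' - z) * (D z * G z + F z * E z))%C with
    ((F z' - F z - (z' - z) * D z) * G z'
     + ((z' - z) * D z * ((G z' - G z - (z' - z) * E z) + (z' - z) * E z)
        + F z * (G z' - G z - (z' - z) * E z)))%C by ring.
  set (d := Cmod (z' - z)) in *.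
  assert (Hd : 0 <= d) by apply Cmod_ge_0.
  assert (Hd2 : d <= 2 * rho).
    unfold d; eapply Rle_trans; [apply Cmod_triangle|]; rewrite Cmod_opp; lra.
  eapply Rle_trans; [apply Cmod_triangle|].
  apply Rle_trans with ((K * d ^ 2) * L + (d * K * (L * d ^ 2 + d * L) + K * (L * d ^ 2))).
    assert (HX : 0 <= K * d ^ 2) by (apply Rmult_le_pos; [lra | apply pow2_ge_0]).
    apply Rplus_le_compat.
      rewrite Cmod_mult; apply Rmult_le_compat; try apply Cmod_ge_0; assumption.
    eapply Rle_trans; [apply Cmod_triangle|]; apply Rplus_le_compat.
      rewrite !Cmod_mult; fold d.
      apply Rmult_le_compat; try apply Cmod_ge_0.
        apply Rmult_le_pos; [lra | apply Cmod_ge_0].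
        apply Rmult_le_compat_l; lra.
      eapply Rle_trans; [apply Cmod_triangle|]; rewrite Cmod_mult; fold d.
      apply Rplus_le_compat; [assumption | apply Rmult_le_compat_l; lra].
    rewrite Cmod_mult; apply Rmult_le_compat; try apply Cmod_ge_0; assumption.
  replace ((K * d ^ 2) * L + (d * K * (L * d ^ 2 + d * L) + K * (L * d ^ 2))) with
    (K * L * (3 + d) * d ^ 2) by ring.
  apply Rmult_le_compat_r; [apply pow2_ge_0|].
  apply Rmult_le_compat_l; [exact HKL | lra].
Qed.

Lemma second_order_kernel rho c : 0 <= rho -> Cmod c * rho < 1 ->
  exists K D, second_order rho K (fun z => / (1 - c * z))%C D.
Proof.
intros Hrho Hc; set (m := / (1 - Cmod c * rho)).
assert (Hm : 0 < m) by (apply Rinv_0_lt_compat; lra).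
assert (Hc0 := Cmod_ge_0 c).
exists (m + Cmod c * m ^ 2 + Cmod c ^ 2 * m ^ 3),
  (fun z => c * (/ (1 - c * z) * / (1 - c * z)))%C.
assert (Hcm : 0 <= Cmod c * m ^ 2) by (apply Rmult_le_pos; [lra | apply pow2_ge_0]).
assert (Hcm2 : 0 <= Cmod c ^ 2 * m ^ 3).
  apply Rmult_le_pos; [apply pow2_ge_0 | apply pow_le; lra].
assert (Hz1 : forall z, Cmod z <= rho -> (1 - c * z)%C <> 0 /\ Cmod (/ (1 - c * z)) <= m).
  intros z Hz.
  assert (H : 1 - Cmod c * rho <= Cmod (1 - c * z)).
    assert (H := Cmod_triangle (1 - c * z) (c * z)).
    replace (1 - c * z + c * z)%C with (RtoC 1) in H by ring.
    rewrite Cmod_1, Cmod_mult in H.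
    assert (Cmod c * Cmod z <= Cmod c * rho) by (apply Rmult_le_compat_l; lra); lra.
  assert (Hn : (1 - c * z)%C <> 0) by (apply Cmod_gt_0; lra).
  split; [exact Hn|]; rewrite Cmod_inv by exact Hn.
  apply Rinv_le_contravar; lra.
intros z Hz; destruct (Hz1 z Hz) as [Hn Hb].
assert (Hb0 := Cmod_ge_0 (/ (1 - c * z))).
split; [lra|]; split.
  rewrite !Cmod_mult.
  apply Rle_trans with (Cmod c * m ^ 2); [|lra].
  apply Rmult_le_compat_l; [lra|]; simpl; rewrite Rmult_1_r; apply Rmult_le_compat; lra.
intros z' Hz'; destruct (Hz1 z' Hz') as [Hn' Hb'].
assert (Hb0' := Cmod_ge_0 (/ (1 - c * z'))).
replace (/ (1 - c * z') - / (1 - c * z) - (z' - z) * (c * (/ (1 - c * z) * / (1 - c * z))))%C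
  with (c * c * (/ (1 - c * z) * / (1 - c * z) * / (1 - c * z')) * ((z' - z) * (z' - z)))%C
  by (field; auto).
rewrite !Cmod_mult.
apply Rle_trans with (Cmod c ^ 2 * m ^ 3 * Cmod (z' - z) ^ 2).
  replace (Cmod (z' - z) ^ 2) with (Cmod (z' - z) * Cmod (z' - z)) by ring.
  apply Rmult_le_compat_r; [apply Rmult_le_pos; apply Cmod_ge_0|].
  replace (Cmod c ^ 2) with (Cmod c * Cmod c) by ring.
  apply Rmult_le_compat_l; [apply Rmult_le_pos; lra|].
  replace (m ^ 3) with (m * m * m) by ring.
  apply Rmult_le_compat; [apply Rmult_le_pos; lra | lra | apply Rmult_le_compat; lra | lra].
apply Rmult_le_compat_r; [apply pow2_ge_0 | lra].
Qed.

(** The generating function of the sequence [comb l], taken at the conjugate of the j-th power of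
    [zeta N]. *)
Definition kernel_sum (l : list (C * C)) (N j : nat) : C :=
  functional (fun w => / (1 - w * Cconj (zeta N) ^ j))%C l.

(** On the circle x = 1 - a conj(zeta) and y = 1 - conj(b) zeta satisfy x + y - x y = 1 - a conj(b).
    So 1/(x y) is a fixed multiple of 1/x + 1/y - 1, and the means of 1/x and 1/y tend to 1. *)
Lemma climit_kernel_product a b : Cmod a < 1 -> Cmod b < 1 ->
  climit (fun N => mean N (fun j =>
    / (1 - a * Cconj (zeta N) ^ j) * Cconj (/ (1 - b * Cconj (zeta N) ^ j)))%C)
  (/ (1 - a * Cconj b))%C.
Proof.
intros Ha Hb.
set (c := (/ (1 - a * Cconj b))%C).
assert (Hab : (1 - a * Cconj b)%C <> 0).
  apply one_minus_mult_neq0; [|rewrite Cmod_conj]; assumption.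
apply climit_ext_from with 1%nat (fun N => c * (mean N (fun j => / (1 - a * Cconj (zeta N) ^ j))
  + (Cconj (mean N (fun j => / (1 - b * Cconj (zeta N) ^ j))) + - (1))))%C.
- intros N HN.
  assert (HN0 : 0 < INR N) by (apply lt_0_INR; lia).
  unfold mean; rewrite Cmult_conj, csum_conj.
  rewrite (Cconj_R (/ INR N)).
  replace (- (1))%C with (RtoC (/ INR N) * csum (fun _ => - (1)) (seq 0 N))%C.
    rewrite <- !Cmult_plus_distr_l, <- !csum_plus.
    rewrite Cmult_assoc, (Cmult_comm c), <- Cmult_assoc, <- csum_scal.
    f_equal; apply csum_ext; intros j.
    assert (H1 := kernel_circle_neq0 a _ Ha (Cmod_conj_zeta_pow N j)).
    assert (H2 := kernel_circle_neq0 b _ Hb (Cmod_conj_zeta_pow N j)).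
    assert (H3 := Cconj_neq0 _ H2).
    rewrite Cinv_conj by exact H2.
    assert (E : (1 - a * Cconj b)%C = ((1 - a * Cconj (zeta N) ^ j)
        + Cconj (1 - b * Cconj (zeta N) ^ j)
        - (1 - a * Cconj (zeta N) ^ j) * Cconj (1 - b * Cconj (zeta N) ^ j))%C).
      rewrite Cminus_conj, Cmult_conj, Cconj_1, Cpow_conj, Cconj_conj.
      transitivity (1 - a * Cconj b * (zeta N ^ j * Cconj (zeta N) ^ j))%C; [|ring].
      rewrite zeta_pow_conj_1; ring.
    unfold c; rewrite E; rewrite E in Hab.
    revert H1 H3 Hab.
    generalize (1 - a * Cconj (zeta N) ^ j)%C (Cconj (1 - b * Cconj (zeta N) ^ j)).
    intros x y Hx Hy Hxy; field; auto.
  rewrite csum_const, length_seq, Cmult_assoc, <- RtoC_mult, Rinv_l by lra; ring.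
- replace c with (c * (1 + (1 + - (1))))%C at 1 by ring.
  apply climit_scal, climit_plus; [apply climit_mean_kernel, Ha|].
  apply climit_plus; [|apply climit_const].
  refine (eq_ind _ (climit _) _ _ Cconj_1).
  apply (climit_conj (fun N => mean N (fun j => / (1 - b * Cconj (zeta N) ^ j))%C)).
  apply climit_mean_kernel, Hb.
Qed.

Lemma mean_csum {A} (f : A -> nat -> C) l N :
  mean N (fun j => csum (fun a => f a j) l) = csum (fun a => mean N (f a)) l.
Proof. unfold mean; rewrite csum_switch, <- csum_scal; reflexivity. Qed.

Lemma mean_scal (c : C) f N : mean N (fun j => c * f j)%C = (c * mean N f)%C.
Proof. unfold mean; rewrite csum_scal; ring. Qed.

Lemma climit_mean_kernel_sum l : in_disc l ->
  climit (fun N => mean N (fun j => kernel_sum l N j * Cconj (kernel_sum l N j))%C) (gram l).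
Proof.
intros Hl.
apply climit_ext with (fun N => csum (fun p => csum (fun q =>
  (fst p * Cconj (fst q)) * mean N (fun j => / (1 - snd p * Cconj (zeta N) ^ j)
     * Cconj (/ (1 - snd q * Cconj (zeta N) ^ j)))) l) l)%C.
  intros N; unfold kernel_sum, functional.
  transitivity (mean N (fun j => csum (fun p => csum (fun q =>
    (fst p * Cconj (fst q)) * (/ (1 - snd p * Cconj (zeta N) ^ j)
     * Cconj (/ (1 - snd q * Cconj (zeta N) ^ j)))) l) l)%C).
    rewrite mean_csum; apply csum_ext; intros p; rewrite mean_csum.
    apply csum_ext; intros q; rewrite mean_scal; reflexivity.
  unfold mean; f_equal; apply csum_ext; intros j; rewrite csum_conj, csum_mult.
  apply csum_ext; intros p; apply csum_ext; intros q; rewrite Cmult_conj; ring.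
apply (climit_csum (fun p N => csum (fun q =>
  (fst p * Cconj (fst q)) * mean N (fun j => / (1 - snd p * Cconj (zeta N) ^ j)
     * Cconj (/ (1 - snd q * Cconj (zeta N) ^ j)))) l)%C).
intros p Hp; apply (climit_csum (fun q N =>
  (fst p * Cconj (fst q)) * mean N (fun j => / (1 - snd p * Cconj (zeta N) ^ j)
     * Cconj (/ (1 - snd q * Cconj (zeta N) ^ j))))%C).
intros q Hq; apply climit_scal, climit_kernel_product; auto.
Qed.

Lemma mean_sqr_rsum (f : nat -> C) N :
  mean N (fun j => f j * Cconj (f j))%C
  = RtoC (/ INR N * rsum (fun j => Cmod (f j) ^ 2) (seq 0 N)).
Proof.
unfold mean; rewrite RtoC_mult, RtoC_rsum; f_equal.
apply csum_ext; intros j; rewrite Cmod_sqr_mult_conj; reflexivity.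
Qed.

Definition twist (psi : C -> C) (l : list (C * C)) : list (C * C) :=
  map (fun p => ((fst p * psi (snd p))%C, snd p)) l.

Lemma in_disc_twist psi l : in_disc l -> in_disc (twist psi l).
Proof. apply (in_disc_map_fst (fun p => fst p * psi (snd p))%C). Qed.

(** The twisted Gram sum G' is the limit of means of omega times two kernel sums, so Cauchy-Schwarz
    and |omega| < 1 give G'^2 <= G G'. The dilation by r keeps the sampled circle inside the disc,
    where omega has uniform second-order estimates. *)
Lemma pick_dilated omega r l : analytic_on unit_disc omega ->
  (forall z, unit_disc z -> unit_disc (omega z)) -> 0 < r < 1 -> in_disc l ->
  Re (gram (twist (fun z => omega (r * z)%C) l)) <= Re (gram l).
Proof.
intros Han Hself Hr Hl.
destruct (analytic_second_order omega r ltac:(lra) Han Hself) as [K [D [HK HF]]].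
set (lw := twist (fun z => omega (r * z)%C) l).
assert (Hlw : in_disc lw) by (apply in_disc_twist, Hl).
assert (Hlim : climit (fun N => mean N (fun j => omega (r * zeta N ^ j)
    * (kernel_sum l N j * Cconj (kernel_sum lw N j)))%C) (gram lw)).
  apply climit_ext with (fun N => csum (fun p => csum (fun q =>
    (fst p * Cconj (fst q * omega (r * snd q))) * mean N (fun j =>
      (omega (r * zeta N ^ j) * / (1 - (Cconj (snd q) / r) * (r * zeta N ^ j)))
      * / (1 - snd p * Cconj (zeta N) ^ j))) l) l)%C.
    intros N; unfold kernel_sum, functional, lw, twist.
    transitivity (mean N (fun j => csum (fun p => csum (fun q =>
      (fst p * Cconj (fst q * omega (r * snd q))) *
      ((omega (r * zeta N ^ j) * / (1 - (Cconj (snd q) / r) * (r * zeta N ^ j)))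
      * / (1 - snd p * Cconj (zeta N) ^ j))) l) l)%C).
      rewrite mean_csum; apply csum_ext; intros p; rewrite mean_csum.
      apply csum_ext; intros q; rewrite mean_scal; reflexivity.
    unfold mean; f_equal; apply csum_ext; intros j; rewrite csum_map, csum_conj, csum_mult.
    rewrite <- csum_scal; apply csum_ext_in; intros p Hp.
    rewrite <- csum_scal; apply csum_ext_in; intros q Hq; simpl fst; simpl snd.
    assert (H2 := kernel_circle_neq0 _ _ (Hl q Hq) (Cmod_conj_zeta_pow N j)).
    rewrite (Cmult_conj (fst q * _)), Cinv_conj by exact H2.
    rewrite Cminus_conj, (Cmult_conj (snd q)), Cconj_1, Cpow_conj, Cconj_conj.
    assert (Hr0 : RtoC r <> 0) by (apply RtoC_neq0; lra).
    replace (Cconj (snd q) / r * (r * zeta N ^ j))%C with (Cconj (snd q) * zeta N ^ j)%C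
      by (field; exact Hr0).
    ring.
  unfold lw, twist, gram; rewrite csum_map.
  apply (climit_csum (fun p N => csum (fun q =>
    (fst p * Cconj (fst q * omega (r * snd q))) * mean N (fun j =>
      (omega (r * zeta N ^ j) * / (1 - (Cconj (snd q) / r) * (r * zeta N ^ j)))
      * / (1 - snd p * Cconj (zeta N) ^ j))) l)%C).
  intros p Hp; rewrite csum_map; apply (climit_csum (fun q N =>
    (fst p * Cconj (fst q * omega (r * snd q))) * mean N (fun j =>
      (omega (r * zeta N ^ j) * / (1 - (Cconj (snd q) / r) * (r * zeta N ^ j)))
      * / (1 - snd p * Cconj (zeta N) ^ j)))%C).
  intros q Hq; simpl fst; simpl snd.
  assert (Hr0 : RtoC r <> 0) by (apply RtoC_neq0; lra).
  assert (Hpq : (1 - snd p * Cconj (snd q))%C <> 0).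
    apply one_minus_mult_neq0; [|rewrite Cmod_conj]; auto.
  replace (fst p * omega (r * snd p) * Cconj (fst q * omega (r * snd q))
      / (1 - snd p * Cconj (snd q)))%C with
    (fst p * Cconj (fst q * omega (r * snd q)) * (omega (r * snd p)
      * / (1 - (Cconj (snd q) / r) * (r * snd p))))%C.
    apply climit_scal.
    (* The Cauchy formula is applied on |z| = r, at the point r w_p, to omega(z) / (1 -
       (conj(w_q)/r) z); the pole lies outside because |w_q| < 1. *)
    destruct (second_order_kernel r (Cconj (snd q) / r)%C) as [L [E HE]]; [lra| |].
      rewrite Cmod_div, Cmod_conj, Cmod_R, Rabs_pos_eq by (auto; lra).
      unfold Rdiv; rewrite Rmult_assoc, Rinv_l, Rmult_1_r by lra; auto.
    assert (Hr1 : 0 < r) by lra; assert (Hr2 : 0 <= r) by lra.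
    assert (Hprod := second_order_mult r _ _ _ _ _ _ Hr2 HF HE).
    apply (discrete_cauchy (fun z => omega z * / (1 - (Cconj (snd q) / r) * z))%C _ _ r
      (snd p) Hr1 (second_order_ge0 _ _ _ _ Hr2 Hprod) Hprod), Hl, Hp.
  replace (Cconj (snd q) / r * (r * snd p))%C with (snd p * Cconj (snd q))%C
    by (field; exact Hr0).
  field; exact Hpq.
assert (HG := climit_mean_kernel_sum l Hl); assert (HGw := climit_mean_kernel_sum lw Hlw).
apply climit_Cmod in Hlim; apply is_lim_seq_Re in HG; apply is_lim_seq_Re in HGw.
assert (Hsq : Cmod (gram lw) ^ 2 <= Re (gram l) * Re (gram lw)).
  apply (is_lim_seq_le (fun N => Cmod (mean N (fun j => omega (r * zeta N ^ j)
      * (kernel_sum l N j * Cconj (kernel_sum lw N j)))%C) ^ 2)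
    (fun N => Re (mean N (fun j => kernel_sum l N j * Cconj (kernel_sum l N j))%C)
      * Re (mean N (fun j => kernel_sum lw N j * Cconj (kernel_sum lw N j))%C))
    (Cmod (gram lw) ^ 2) (Re (gram l) * Re (gram lw))).
  - intros N; rewrite !mean_sqr_rsum, !re_RtoC; unfold mean.
    set (X := rsum _ _); set (Y := rsum _ _).
    replace (/ INR N * X * (/ INR N * Y)) with ((/ INR N) ^ 2 * (X * Y)) by ring.
    rewrite Cmod_mult, Rpow_mult_distr, Cmod_R, pow2_abs.
    apply Rmult_le_compat_l; [apply pow2_ge_0|].
    rewrite (csum_ext _ (fun j => (omega (r * zeta N ^ j) * kernel_sum l N j)
      * Cconj (kernel_sum lw N j))%C) by (intros; ring).
    eapply Rle_trans; [apply csum_cauchy|].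
    apply Rmult_le_compat; try (apply rsum_ge0; intros; apply pow2_ge_0).
      apply rsum_le; intros j; rewrite Cmod_mult, Rpow_mult_distr.
      rewrite <- (Rmult_1_l (Cmod (kernel_sum l N j) ^ 2)) at 2.
      apply Rmult_le_compat_r; [apply pow2_ge_0|].
      assert (H : unit_disc (omega (r * zeta N ^ j)%C)).
        apply Hself; unfold unit_disc.
        rewrite Cmod_mult, Cmod_zeta_pow, Cmod_R, Rabs_pos_eq; lra.
      unfold unit_disc in H; rewrite <- (pow1 2); apply pow_incr; split;
        [apply Cmod_ge_0 | lra].
    right; apply rsum_ext; intros j; rewrite Cmod_conj; reflexivity.
  - apply is_lim_seq_ext with (fun N => Cmod (mean N (fun j => omega (r * zeta N ^ j)
      * (kernel_sum l N j * Cconj (kernel_sum lw N j)))%C)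
      * Cmod (mean N (fun j => omega (r * zeta N ^ j)
      * (kernel_sum l N j * Cconj (kernel_sum lw N j)))%C)).
      intros N; ring.
    replace (Cmod (gram lw) ^ 2) with (Cmod (gram lw) * Cmod (gram lw)) by ring.
    apply is_lim_seq_mult'; exact Hlim.
  - apply is_lim_seq_mult'; assumption.
assert (H1 : Re (gram lw) <= Cmod (gram lw)).
  eapply Rle_trans; [apply Rle_abs | apply re_le_Cmod].
assert (H2 := gram_ge0 lw Hlw); assert (H3 := gram_ge0 l Hl).
destruct (Rle_lt_dec (Re (gram lw)) (Re (gram l))) as [H|H]; [exact H|].
nra.
Qed.

Lemma analytic_continuous omega z (u : nat -> C) : analytic_on unit_disc omega ->
  (forall z, unit_disc z -> unit_disc (omega z)) -> Cmod z < 1 ->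
  (forall n, Cmod (u n) <= Cmod z) -> climit u z -> climit (fun n => omega (u n)) (omega z).
Proof.
intros Han Hself Hz Hu Hlim.
assert (H0 := Cmod_ge_0 z).
destruct (analytic_second_order omega (Cmod z) ltac:(lra) Han Hself) as [K [D [HK HF]]].
destruct (HF z ltac:(lra)) as [_ [HD HF2]].
apply lim0_le with (fun n => K * Cmod (u n - z) + K * (2 * Cmod (u n - z))).
  intros n; split; [apply Cmod_ge_0|].
  specialize (HF2 (u n) (Hu n)).
  replace (omega (u n) - omega z)%C with
    ((u n - z) * D z + (omega (u n) - omega z - (u n - z) * D z))%C by ring.
  eapply Rle_trans; [apply Cmod_triangle|]; rewrite Cmod_mult.
  assert (H1 := Cmod_ge_0 (u n - z)).
  assert (H2 : Cmod (u n - z) <= 2).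
    eapply Rle_trans; [apply Cmod_triangle|]; rewrite Cmod_opp; specialize (Hu n); lra.
  set (d := Cmod (u n - z)) in *.
  apply Rplus_le_compat.
    rewrite Rmult_comm; apply Rmult_le_compat_r; lra.
  eapply Rle_trans; [exact HF2|]; apply Rmult_le_compat_l; nra.
replace 0 with (K * 0 + K * (2 * 0)) by ring.
apply is_lim_seq_plus'; repeat (apply is_lim_seq_mult'; [apply is_lim_seq_const|]); exact Hlim.
Qed.

Lemma pick_positivity omega l : analytic_on unit_disc omega ->
  (forall z, unit_disc z -> unit_disc (omega z)) -> in_disc l ->
  Re (gram (twist omega l)) <= Re (gram l).
Proof.
intros Han Hself Hl.
set (r n := 1 - / (INR n + 2)).
assert (Hr : forall n, 0 < r n < 1).
  intros n; unfold r; assert (H := pos_INR n).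
  assert (H1 : 0 < / (INR n + 2)) by (apply Rinv_0_lt_compat; lra).
  assert (H2 : / (INR n + 2) <= / 2) by (apply Rinv_le_contravar; lra); lra.
assert (Hlim : is_lim_seq r 1).
  rewrite <- (Rminus_0_r 1); apply is_lim_seq_minus'; [apply is_lim_seq_const|].
  apply (is_lim_seq_inv (fun n => INR n + 2) p_infty); [|discriminate].
  apply is_lim_seq_plus with p_infty 2; [apply is_lim_seq_INR | apply is_lim_seq_const | reflexivity].
assert (Hom : forall z, Cmod z < 1 -> climit (fun n => omega (r n * z)%C) (omega z)).
  intros z Hz; apply analytic_continuous; auto.
    intros n; rewrite Cmod_mult, Cmod_R, Rabs_pos_eq by (specialize (Hr n); lra).
    rewrite <- (Rmult_1_l (Cmod z)) at 2; apply Rmult_le_compat_r; [apply Cmod_ge_0|].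
    specialize (Hr n); lra.
  refine (eq_ind _ (climit _) _ _ (Cmult_1_l z)); apply climit_mult; [|apply climit_const].
  apply climit_Re_Im; [exact Hlim | apply is_lim_seq_const].
assert (HG : climit (fun n => gram (twist (fun z => omega (r n * z)%C) l)) (gram (twist omega l))).
  unfold gram, twist; rewrite csum_map.
  apply climit_ext with (fun n => csum (fun p => csum (fun q =>
    fst p * omega (r n * snd p) * Cconj (fst q * omega (r n * snd q))
      / (1 - snd p * Cconj (snd q))) l) l)%C.
    intros n; rewrite csum_map; apply csum_ext; intros p; rewrite csum_map; reflexivity.
  apply (climit_csum (fun p n => csum (fun q =>
    fst p * omega (r n * snd p) * Cconj (fst q * omega (r n * snd q))
      / (1 - snd p * Cconj (snd q))) l)%C).
  intros p Hp; rewrite csum_map; apply (climit_csum (fun q n =>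
    fst p * omega (r n * snd p) * Cconj (fst q * omega (r n * snd q))
      / (1 - snd p * Cconj (snd q)))%C).
  intros q Hq; simpl fst; simpl snd; unfold Cdiv.
  apply climit_mult; [|apply climit_const].
  apply climit_mult; [apply climit_mult; [apply climit_const | apply Hom; auto]|].
  apply climit_conj, climit_mult; [apply climit_const | apply Hom; auto].
apply is_lim_seq_Re in HG.
apply (is_lim_seq_le (fun n => Re (gram (twist (fun z => omega (r n * z)%C) l)))
  (fun _ => Re (gram l)) (Re (gram (twist omega l))) (Re (gram l)));
  [|exact HG | apply is_lim_seq_const].
intros n; apply pick_dilated; auto.
Qed.

Lemma gram_cons_0 t l :
  gram ((t, RtoC 0) :: l) =
  (t * Cconj t + t * Cconj (csum fst l) + Cconj t * csum fst l + gram l)%C.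
Proof.
assert (H1 : RtoC 1 <> 0) by (apply RtoC_neq0; lra).
unfold gram at 1.
change (csum _ ((t, RtoC 0) :: l)) with
  (t * Cconj t / (1 - 0 * Cconj 0)
   + csum (fun q => t * Cconj (fst q) / (1 - 0 * Cconj (snd q))) l
   + csum (fun p => fst p * Cconj t / (1 - snd p * Cconj 0) +
      csum (fun q => fst p * Cconj (fst q) / (1 - snd p * Cconj (snd q))) l) l)%C.
rewrite csum_plus; fold (gram l); rewrite Cconj_0.
rewrite (csum_ext _ (fun q => t * Cconj (fst q))%C).
2:{ intros q; replace (1 - 0 * Cconj (snd q))%C with (RtoC 1) by ring; field; exact H1. }
rewrite (csum_ext (fun p => fst p * Cconj t / _)%C (fun p => Cconj t * fst p)%C).
2:{ intros q; replace (1 - snd q * 0)%C with (RtoC 1) by ring; field; exact H1. }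
rewrite !csum_scal, csum_conj; field.
Qed.

Lemma re_mult_conj_l (a : C) : Re (a * Cconj a)%C = Cmod a ^ 2.
Proof. rewrite <- Cmod_sqr_mult_conj; apply re_RtoC. Qed.

(** * Boundedness of [C_omega] from Pick's inequality *)

Section CompositionBound.

Variable omega : C -> C.
Hypothesis omega_analytic : analytic_on unit_disc omega.
Hypothesis omega_self_map : forall z, unit_disc z -> unit_disc (omega z).

Let p := omega 0.
Let H := 1 - Cmod p ^ 2.

Lemma omega_0_lt1 : Cmod p < 1.
Proof. apply omega_self_map; unfold unit_disc; rewrite Cmod_0; lra. Qed.

(* Pick's inequality with the extra point 0, optimized in its coefficient. *)
Lemma pick_defect l : in_disc l ->
  Cmod (functional (fun z => 1 - Cconj p * omega z)%C l) ^ 2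
  <= H * (Re (gram l) - Re (gram (twist omega l))).
Proof.
intros Hl; set (e := functional _ l).
assert (Hp := omega_0_lt1); assert (Hp0 := Cmod_ge_0 p).
assert (HH : 0 < H) by (unfold H; nra).
(* The minimiser of the quadratic H |t|^2 + 2 Re(conj(t) e) that Pick's inequality produces; the
   minimum is -|e|^2 / H. *)
set (t := (RtoC (- / H) * e)%C).
assert (Hpick := pick_positivity omega ((t, RtoC 0) :: l) omega_analytic omega_self_map).
assert (Hl' : in_disc ((t, RtoC 0) :: l)).
  intros q [<- | Hq]; [simpl; rewrite Cmod_0; lra | apply Hl, Hq].
specialize (Hpick Hl').
change (twist omega ((t, RtoC 0) :: l)) with (((t * p)%C, RtoC 0) :: twist omega l) in Hpick.
rewrite !gram_cons_0, !re_plus, !re_mult_conj_l in Hpick.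
set (s := csum fst l) in *; set (s' := csum fst (twist omega l)) in *.
assert (He : e = (s - Cconj p * s')%C).
  unfold e, s, s', functional, twist; rewrite csum_map, <- csum_scal, <- csum_minus.
  apply csum_ext; intros q; simpl; ring.
assert (E1 : Re (t * Cconj s)%C = Re (Cconj t * s)%C).
  rewrite <- (re_conj (t * Cconj s)%C), Cmult_conj, Cconj_conj; reflexivity.
assert (E2 : Re (t * p * Cconj s')%C = Re (Cconj (t * p) * s')%C).
  rewrite <- (re_conj (t * p * Cconj s')%C), Cmult_conj, Cconj_conj; reflexivity.
assert (E3 : Re (Cconj t * s)%C - Re (Cconj (t * p) * s')%C = Re (Cconj t * e)%C).
  rewrite He; replace (Cconj t * (s - Cconj p * s'))%C with
    (Cconj t * s + - (Cconj (t * p) * s'))%C by (rewrite Cmult_conj; ring).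
  rewrite re_plus, re_opp; ring.
assert (E4 : Re (Cconj t * e)%C = - / H * Cmod e ^ 2).
  rewrite <- re_mult_conj_l, <- re_scal_l; f_equal; unfold t; rewrite Cmult_conj.
  rewrite (Cconj_R (- / H)).
  ring.
assert (E5 : Cmod t ^ 2 = (/ H) ^ 2 * Cmod e ^ 2).
  unfold t; rewrite Cmod_mult, Rpow_mult_distr, Cmod_R, pow2_abs; ring.
rewrite Cmod_mult, Rpow_mult_distr in Hpick.
assert (Hmain : 0 <= Cmod t ^ 2 * H + 2 * (- / H * Cmod e ^ 2)
    + (Re (gram l) - Re (gram (twist omega l)))).
  unfold H at 1; lra.
rewrite E5 in Hmain.
replace ((/ H) ^ 2 * Cmod e ^ 2 * H + 2 * (- / H * Cmod e ^ 2)) with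
  (- / H * Cmod e ^ 2) in Hmain by (field; lra).
apply Rmult_le_reg_l with (/ H); [apply Rinv_0_lt_compat, HH|].
rewrite <- Rmult_assoc, Rinv_l, Rmult_1_l by lra; lra.
Qed.

Let tw k l := twist (fun z => omega z ^ k)%C l.

Lemma twist_pow_S k l : twist omega (tw k l) = tw (S k) l.
Proof.
unfold tw, twist; rewrite map_map; apply map_ext; intros q; simpl; f_equal; ring.
Qed.

(** Applying [pick_defect] to the list twisted by omega^k makes the right sides telescope over k. *)
Lemma defect_sum l n : in_disc l ->
  rsum (fun k => Cmod (functional (fun z => 1 - Cconj p * omega z)%C (tw k l)) ^ 2) (seq 0 n)
  <= H * (Re (gram l) - Re (gram (tw n l))).
Proof.
intros Hl; induction n as [|n IH].
  replace (tw 0 l) with l; [simpl; lra|].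
  unfold tw, twist; rewrite <- (map_id l) at 1; apply map_ext; intros q.
  destruct q as [a b]; simpl; f_equal; ring.
rewrite rsum_seq_S.
assert (H1 := pick_defect (tw n l) (in_disc_twist _ _ Hl)).
rewrite twist_pow_S in H1; lra.
Qed.

(** The functional is the zeroth entry of the sequence [comb (tw n l)], whose norm is at most that
    of [comb l] by [defect_sum]. *)
Lemma moment_le l n : in_disc l ->
  Cmod (functional (fun z => omega z ^ n)%C l) ^ 2 <= Re (gram l).
Proof.
intros Hl.
assert (Hn := rsum_ge0 (fun k => Cmod (functional (fun z => 1 - Cconj p * omega z)%C (tw k l)) ^ 2)
  (seq 0 n) (fun k => pow2_ge_0 _)).
assert (H1 := defect_sum l n Hl).
assert (Hp := omega_0_lt1); assert (Hp0 := Cmod_ge_0 p).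
assert (HH : 0 < H) by (unfold H; nra).
assert (H2 : Re (gram (tw n l)) <= Re (gram l)).
  assert (0 <= Re (gram l) - Re (gram (tw n l))); [|lra].
  apply Rmult_le_reg_l with H; [exact HH | rewrite Rmult_0_r; cbv beta in *; lra].
eapply Rle_trans; [|exact H2].
assert (H3 := rsum_le_series _ _ 1 (fun k => pow2_ge_0 _) (comb_series _ (in_disc_twist
  (fun z => omega z ^ n)%C l Hl))).
cbn [seq rsum fold_right] in H3; rewrite Rplus_0_r in H3.
replace (functional (fun z => omega z ^ n)%C l) with (comb (tw n l) 0).
  exact H3.
unfold comb, functional, tw, twist; rewrite csum_map; apply csum_ext; intros q; simpl; ring.
Qed.

(* Convexity of [t^2], applied to [y_k = e_k + conj p y_(k+1)]. *)
Lemma moment_sum l n : in_disc l ->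
  rsum (fun k => Cmod (functional (fun z => omega z ^ k)%C l) ^ 2) (seq 0 n)
  <= (2 / (1 - Cmod p)) ^ 2 * Re (gram l).
Proof.
intros Hl; set (y k := functional (fun z => omega z ^ k)%C l).
set (e k := functional (fun z => 1 - Cconj p * omega z)%C (tw k l)).
assert (Hp := omega_0_lt1); assert (Hp0 := Cmod_ge_0 p); set (pi := Cmod p) in *.
assert (Hye : forall k, y k = (e k + Cconj p * y (S k))%C).
  intros k; unfold y, e, tw, twist, functional; rewrite csum_map, <- csum_scal, <- csum_plus.
  apply csum_ext; intros q; simpl; ring.
assert (Hstep : forall k, Cmod (y k) ^ 2 <= / (1 - pi) * Cmod (e k) ^ 2 + pi * Cmod (y (S k)) ^ 2).
  intros k; apply Rle_trans with ((Cmod (e k) + pi * Cmod (y (S k))) ^ 2).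
    apply pow_incr; split; [apply Cmod_ge_0|].
    rewrite Hye; eapply Rle_trans; [apply Cmod_triangle|].
    rewrite Cmod_mult, Cmod_conj; fold pi; lra.
  set (a := Cmod (e k)); set (b := Cmod (y (S k))).
  assert (H1 : 0 <= pi * / (1 - pi) * (a - (1 - pi) * b) ^ 2).
    apply Rmult_le_pos; [|apply pow2_ge_0].
    apply Rmult_le_pos; [lra | left; apply Rinv_0_lt_compat; lra].
  replace (/ (1 - pi) * a ^ 2 + pi * b ^ 2) with
    ((a + pi * b) ^ 2 + pi * / (1 - pi) * (a - (1 - pi) * b) ^ 2) by (field; lra).
  lra.
set (G := Re (gram l)).
assert (HG : 0 <= G) by (apply gram_ge0, Hl).
set (Y := rsum (fun k => Cmod (y k) ^ 2) (seq 0 n)).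
(* Shifting the index costs at most one end term, bounded by G. The resulting inequality has Y on
   both sides, with the factor pi < 1 on the right, and can be solved for Y. *)
assert (HYS : rsum (fun k => Cmod (y (S k)) ^ 2) (seq 0 n) <= Y + G).
  assert (E : forall m, rsum (fun k => Cmod (y (S k)) ^ 2) (seq 0 m) + Cmod (y 0%nat) ^ 2 =
    rsum (fun k => Cmod (y k) ^ 2) (seq 0 m) + Cmod (y m) ^ 2).
    induction m as [|m IH]; [simpl; ring|].
    rewrite !rsum_seq_S; lra.
  specialize (E n); fold Y in E.
  assert (H1 := moment_le l n Hl); fold (y n) G in H1.
  assert (H2 := pow2_ge_0 (Cmod (y 0%nat))); lra.
assert (HE : rsum (fun k => Cmod (e k) ^ 2) (seq 0 n) <= G).
  assert (H1 := defect_sum l n Hl); fold G in H1.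
  assert (H2 : 0 <= Re (gram (tw n l))) by (apply gram_ge0, in_disc_twist, Hl).
  assert (HH : 0 < H <= 1) by (unfold H; fold pi; nra).
  unfold e; nra.
assert (HY : Y <= / (1 - pi) * G + pi * (Y + G)).
  eapply Rle_trans; [apply rsum_le, Hstep|].
  rewrite rsum_plus, !rsum_scal.
  assert (Hi : 0 < / (1 - pi)) by (apply Rinv_0_lt_compat; lra).
  apply Rplus_le_compat; apply Rmult_le_compat_l; lra.
apply Rmult_le_reg_l with (1 - pi); [lra|].
replace ((1 - pi) * ((2 / (1 - pi)) ^ 2 * G)) with (4 * / (1 - pi) * G) by (field; lra).
assert (Hi : 1 <= / (1 - pi)) by (rewrite <- Rinv_1 at 1; apply Rinv_le_contravar; lra).
assert (H1 : pi * G <= / (1 - pi) * G) by (apply Rmult_le_compat_r; lra).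
assert (H2 : 0 <= / (1 - pi) * G) by (apply Rmult_le_pos; lra).
change ((1 - pi) * Y <= 4 * / (1 - pi) * G); lra.
Qed.

Lemma composition_exists : exists S : HardyH2 -> HardyH2,
  is_composition_operator hardy_eval hardy_eval unit_disc omega S.
Proof.
assert (Hp := omega_0_lt1).
destruct (bounded_synthesis (fun k w => omega w ^ k)%C (2 / (1 - Cmod p))) as [S [HS1 HS2]].
- apply Rmult_le_pos; [lra | left; apply Rinv_0_lt_compat; lra].
- intros l n Hl; apply moment_sum, Hl.
- exists S; split; [exact HS1|].
  intros f w Hw; symmetry; apply cseries_CSeries, HS2, Hw.
Qed.

End CompositionBound.

(** * Embedding the Hardy space as the Dirichlet series in powers of 2 *)

(** Position m carries (m+1)^(-s), so the entry a_k sits where m + 1 = 2^k. *)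
Definition sparse {A : Type} (a : nat -> A) (zero : A) (m : nat) : A :=
  if Nat.eqb (2 ^ Nat.log2 (S m)) (S m) then a (Nat.log2 (S m)) else zero.

Lemma log2_step n :
  (Nat.log2 (S (S n)) = S (Nat.log2 (S n)) /\ (2 ^ Nat.log2 (S (S n)) = S (S n))%nat) \/
  (Nat.log2 (S (S n)) = Nat.log2 (S n) /\ (2 ^ Nat.log2 (S (S n)) <> S (S n))%nat).
Proof.
destruct (Nat.log2_succ_or (S n)) as [E | E]; [left | right]; split; auto.
  destruct (Nat.log2_eq_succ_is_pow2 (S n) E) as [b Hb].
  rewrite Hb, Nat.log2_pow2 by lia; reflexivity.
intros E'; assert (H : Nat.log2 (S (S n)) = S (Nat.log2 (S n))).
  apply Nat.log2_eq_succ_iff_pow2; [lia|]; eexists; symmetry; exact E'.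
lia.
Qed.

Lemma csum_sparse (a : nat -> C) n :
  csum (sparse a (RtoC 0)) (seq 0 (S n)) = csum a (seq 0 (S (Nat.log2 (S n)))).
Proof.
induction n as [|n IH]; [reflexivity|].
rewrite csum_seq_S, IH; unfold sparse.
destruct (log2_step n) as [[E1 E2] | [E1 E2]]; rewrite E1 in *.
  apply Nat.eqb_eq in E2; rewrite E2, (csum_seq_S a (S _)); reflexivity.
apply Nat.eqb_neq in E2; rewrite E2; ring.
Qed.

Lemma rsum_sparse (a : nat -> R) n :
  rsum (sparse a 0) (seq 0 (S n)) = rsum a (seq 0 (S (Nat.log2 (S n)))).
Proof.
induction n as [|n IH]; [reflexivity|].
rewrite rsum_seq_S, IH; unfold sparse.
destruct (log2_step n) as [[E1 E2] | [E1 E2]]; rewrite E1 in *.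
  apply Nat.eqb_eq in E2; rewrite E2, (rsum_seq_S a (S _)); reflexivity.
apply Nat.eqb_neq in E2; rewrite E2; ring.
Qed.

Lemma sparse_bound (a : ell2) n :
  rsum (fun m => Cmod (sparse a (RtoC 0) m) ^ 2) (seq 0 n) <= ell2_norm a ^ 2.
Proof.
eapply Rle_trans; [apply rsum_seq_mono with (m := S n); [intros; apply pow2_ge_0 | lia]|].
rewrite (rsum_ext _ (sparse (fun k => Cmod (a k) ^ 2) 0)).
  rewrite rsum_sparse; apply ell2_partial.
intros m; unfold sparse; destruct (Nat.eqb _ _); [reflexivity|].
rewrite Cmod_0; ring.
Qed.

Lemma sparse_summable (a : ell2) :
  ex_series (fun m => Cmod (sparse a (RtoC 0) m) ^ 2).
Proof.
apply ex_series_bounded with (ell2_norm a ^ 2); [intros; apply pow2_ge_0 | apply sparse_bound].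
Qed.

Definition powers_of_2 (a : ell2_NormedModule) : ell2_NormedModule :=
  Ell2 (sparse (coef a) (RtoC 0)) (sparse_summable a).

Lemma powers_of_2_norm a : ell2_norm (powers_of_2 a) <= ell2_norm a.
Proof. apply ell2_norm_le; [apply ell2_norm_ge0 | apply sparse_bound]. Qed.

Lemma powers_of_2_linear : is_linear powers_of_2.
Proof.
constructor.
- intros a b; apply ell2_ext; intros m; simpl; unfold sparse.
  destruct (Nat.eqb _ _); [reflexivity | ring].
- intros c a; apply ell2_ext; intros m; simpl; unfold sparse.
  destruct (Nat.eqb _ _); [reflexivity | ring].
- exists 1; split; [lra|]; intros a; rewrite Rmult_1_l; apply powers_of_2_norm.
Qed.

Lemma inv_npow_pow2 k s : inv_npow (2 ^ k) s = (Imap s ^ k)%C.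
Proof.
change (cexpn s (ln (INR (2 ^ k))) = (cexpn s (ln (INR 2)) ^ k)%C).
induction k as [|k IH]; [simpl; rewrite ln_1; apply cexpn_0|].
cbn [Cpow]; rewrite <- IH, <- cexpn_add, Nat.pow_succ_r', mult_INR, ln_mult.
- reflexivity.
- apply lt_0_INR; lia.
- apply lt_0_INR; assert (H := Nat.pow_nonzero 2 k); lia.
Qed.

Lemma Imap_unit_disc s : half_plane s -> unit_disc (Imap s).
Proof.
intros Hs; unfold half_plane in Hs; unfold unit_disc.
change (Cmod (cexpn s (ln (INR 2))) < 1); rewrite Cmod_cexpn.
rewrite <- exp_0; apply exp_increasing.
assert (H : 0 < ln (INR 2)).
  rewrite <- ln_1; apply ln_increasing; simpl; lra.
nra.
Qed.

Lemma powers_of_2_eval a s : half_plane s ->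
  dirichlet_eval (powers_of_2 a) s = hardy_eval a (Imap s).
Proof.
intros Hs; apply cseries_CSeries.
apply (cseries_ext (sparse (fun k => coef a k * Imap s ^ k)%C (RtoC 0))).
  intros m; simpl coef; unfold sparse.
  destruct (Nat.eqb_spec (2 ^ Nat.log2 (S m)) (S m)) as [E | E]; [|ring].
  rewrite <- inv_npow_pow2, E; reflexivity.
apply climit_ext_from with 1%nat (fun n =>
  csum (fun k => coef a k * Imap s ^ k)%C (seq 0 (S (Nat.log2 n)))).
  intros [|n] Hn; [lia|]; symmetry; apply csum_sparse.
apply (climit_subseq (fun n => csum (fun k => coef a k * Imap s ^ k)%C (seq 0 n)) _
  (fun n => S (Nat.log2 n))).
  intros P [M HM]; exists (2 ^ M)%nat; intros n Hn; apply HM.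
  apply Nat.le_trans with (Nat.log2 n); [|lia].
  rewrite <- (Nat.log2_pow2 M) by lia; apply Nat.log2_le_mono, Hn.
apply (hardy_series a), Imap_unit_disc, Hs.
Qed.

Lemma rsum_pow2_le (f : nat -> R) K : (forall m, 0 <= f m) ->
  rsum (fun k => f (2 ^ k - 1)%nat) (seq 0 (S K)) <= rsum f (seq 0 (2 ^ K)).
Proof.
intros Hf; induction K as [|K IH]; [simpl; lra|].
rewrite rsum_seq_S; replace (2 ^ S K)%nat with (2 ^ K + 2 ^ K)%nat by (simpl; lia).
rewrite seq_app, rsum_app; apply Rplus_le_compat; [exact IH|].
apply (rsum_term_le f); [auto|].
assert (H := Nat.pow_nonzero 2 K); apply in_seq; lia.
Qed.

Lemma dyadic_bound (g : ell2) n :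
  rsum (fun k => Cmod (g (2 ^ k - 1)%nat) ^ 2) (seq 0 n) <= ell2_norm g ^ 2.
Proof.
eapply Rle_trans; [apply rsum_seq_mono with (m := S n); [intros; apply pow2_ge_0 | lia]|].
eapply Rle_trans; [apply (rsum_pow2_le (fun m => Cmod (g m) ^ 2)); intros; apply pow2_ge_0|].
apply ell2_partial.
Qed.

Lemma dyadic_summable (g : ell2) : ex_series (fun k => Cmod (g (2 ^ k - 1)%nat) ^ 2).
Proof.
apply ex_series_bounded with (ell2_norm g ^ 2); [intros; apply pow2_ge_0 | apply dyadic_bound].
Qed.

(** The contractive left inverse of [powers_of_2]. It carries an arbitrary approximant of [C_phi],
    whose range need not consist of series in powers of 2, back to the Hardy space. *)
Definition dyadic (g : ell2_NormedModule) : ell2_NormedModule :=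
  Ell2 (fun k => coef g (2 ^ k - 1)%nat) (dyadic_summable g).

Lemma dyadic_norm g : ell2_norm (dyadic g) <= ell2_norm g.
Proof. apply ell2_norm_le; [apply ell2_norm_ge0 | apply dyadic_bound]. Qed.

Lemma dyadic_linear : is_linear dyadic.
Proof.
constructor.
- intros a b; apply ell2_ext; intros m; reflexivity.
- intros c a; apply ell2_ext; intros m; reflexivity.
- exists 1; split; [lra|]; intros a; rewrite Rmult_1_l; apply dyadic_norm.
Qed.

Lemma sparse_pow2 {A} (a : nat -> A) z k : sparse a z (2 ^ k - 1) = a k.
Proof.
unfold sparse; assert (H := Nat.pow_nonzero 2 k).
replace (S (2 ^ k - 1)) with (2 ^ k)%nat by lia.
rewrite Nat.log2_pow2, Nat.eqb_refl by lia; reflexivity.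
Qed.

Lemma dyadic_powers_of_2 a : dyadic (powers_of_2 a) = a.
Proof. apply ell2_ext; intros k; apply sparse_pow2. Qed.

(** * Infima, operator norms and approximation numbers *)

(** [infimum] applies [real] to an extended value, which yields 0 for a set that is empty or
    unbounded below; both cases have to be excluded. *)
Lemma infimum_glb (E : R -> Prop) c : (exists x, E x) -> (forall x, E x -> c <= x) ->
  Glb_Rbar E = Finite (infimum E).
Proof.
intros [x Hx] Hc; destruct (Glb_Rbar_correct E) as [H1 H2]; unfold infimum.
assert (Hlow := H1 x Hx); assert (Hup := H2 (Finite c) Hc).
destruct (Glb_Rbar E); simpl in *; [reflexivity | contradiction | contradiction].
Qed.

Lemma infimum_le (E : R -> Prop) c x : (forall x, E x -> c <= x) -> E x -> infimum E <= x.
Proof.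
intros Hc Hx; assert (HE := infimum_glb E c (ex_intro _ x Hx) Hc).
destruct (Glb_Rbar_correct E) as [H1 _]; specialize (H1 x Hx).
rewrite HE in H1; exact H1.
Qed.

Lemma infimum_ge (E : R -> Prop) c : (exists x, E x) -> (forall x, E x -> c <= x) ->
  c <= infimum E.
Proof.
intros Hex Hc; assert (HE := infimum_glb E c Hex Hc).
destruct (Glb_Rbar_correct E) as [_ H2]; specialize (H2 (Finite c) Hc).
rewrite HE in H2; exact H2.
Qed.

Lemma infimum_approx (E : R -> Prop) c e : (exists x, E x) -> (forall x, E x -> c <= x) ->
  infimum E < e -> exists x, E x /\ x < e.
Proof.
intros Hex Hc He; apply NNPP; intros Hn.
assert (H : e <= infimum E); [|lra].
apply infimum_ge; [exact Hex|]; intros x Hx.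
destruct (Rle_lt_dec e x); [assumption|]; exfalso; apply Hn; exists x; auto.
Qed.

Lemma operator_norm_le {U V : NormedModule C_AbsRing} (T : U -> V) M :
  0 <= M -> (forall x, norm (T x) <= M * norm x) -> operator_norm T <= M.
Proof.
intros HM H; apply infimum_le with 0; [intros x [Hx _]; exact Hx | split; assumption].
Qed.

Lemma operator_norm_ge0 {U V : NormedModule C_AbsRing} (T : U -> V) :
  (exists M, 0 <= M /\ forall x, norm (T x) <= M * norm x) -> 0 <= operator_norm T.
Proof. intros Hex; apply infimum_ge; [exact Hex | intros x [Hx _]; exact Hx]. Qed.

Lemma operator_norm_bound {U V : NormedModule C_AbsRing} (T : U -> V) :
  (exists M, 0 <= M /\ forall x, norm (T x) <= M * norm x) ->
  forall x, norm (T x) <= operator_norm T * norm x.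
Proof.
intros Hex x; set (m := operator_norm T).
apply Rnot_lt_le; intros Hlt.
(* When the norm of x is 0 there is no quotient to compare with, but any admissible constant already
   forces the norm of T x to be 0. *)
destruct (Req_dec (norm x) 0) as [E0 | N0].
  destruct Hex as [M [_ HM]]; specialize (HM x); rewrite E0, Rmult_0_r in *; lra.
assert (Hx : 0 < norm x) by (assert (H := norm_ge_0 x); lra).
assert (He : infimum (fun M => 0 <= M /\ forall x, norm (T x) <= M * norm x) < norm (T x) / norm x).
  change (m < norm (T x) / norm x).
  apply Rmult_lt_reg_r with (norm x); [exact Hx|].
  unfold Rdiv; rewrite Rmult_assoc, Rinv_l, Rmult_1_r by lra; exact Hlt.
destruct (infimum_approx _ 0 _ Hex (fun M HM => proj1 HM) He) as [M [[_ HM] HM2]].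
specialize (HM x).
apply (Rmult_lt_compat_r (norm x)) in HM2; [|exact Hx].
unfold Rdiv in HM2; rewrite Rmult_assoc, Rinv_l, Rmult_1_r in HM2 by lra; lra.
Qed.

Lemma norm_minus_le {V : NormedModule C_AbsRing} (x y : V) : norm (minus x y) <= norm x + norm y.
Proof. unfold minus; rewrite <- (norm_opp y); apply norm_triangle. Qed.

Lemma linear_minus_bounded {U V : NormedModule C_AbsRing} (S L : U -> V) :
  is_linear S -> is_linear L ->
  exists M, 0 <= M /\ forall x, norm (minus (S x) (L x)) <= M * norm x.
Proof.
intros HS HL; destruct (linear_norm _ HS) as [M [HM HM2]];
  destruct (linear_norm _ HL) as [M' [HM' HM'2]].
exists (M + M'); split; [lra|]; intros x.
eapply Rle_trans; [apply norm_minus_le|].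
specialize (HM2 x); specialize (HM'2 x); lra.
Qed.

Lemma linear_bounded {U V : NormedModule C_AbsRing} (S : U -> V) :
  is_linear S -> exists M, 0 <= M /\ forall x, norm (S x) <= M * norm x.
Proof.
intros HS; destruct (linear_norm _ HS) as [M [HM HM2]]; exists M; split; [lra | exact HM2].
Qed.

Lemma linear_sum_n_m {U V : NormedModule C_AbsRing} (T : U -> V) (c : nat -> C) (v : nat -> U) n m :
  is_linear T ->
  T (sum_n_m (fun k => scal (c k) (v k)) n m) = sum_n_m (fun k => scal (c k) (T (v k))) n m.
Proof.
intros HT; destruct (Nat.le_gt_cases n m) as [H | H].
  induction H as [|m H IH].
    rewrite !sum_n_n; apply (linear_scal T HT).
  rewrite !sum_n_Sm by lia; rewrite (linear_plus T HT), IH; f_equal.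
  apply (linear_scal T HT).
rewrite !sum_n_m_zero by exact H; apply (linear_zero T HT).
Qed.

Lemma approximation_set_nonempty {U V : NormedModule C_AbsRing} n (S : U -> V) : (1 <= n)%nat ->
  exists d, exists L : U -> V, is_linear L /\ rank_lt n L /\
    d = operator_norm (fun x => minus (S x) (L x)).
Proof.
intros Hn; exists (operator_norm (fun x => minus (S x) zero)), (fun _ => zero).
split; [apply is_linear_zero|]; split; [|reflexivity].
exists 0%nat, (fun _ => zero); split; [lia|].
intros x; exists (fun _ => RtoC 0); rewrite sum_n_m_zero by lia; reflexivity.
Qed.

Lemma approximation_number_le {U V : NormedModule C_AbsRing} n (S : U -> V) L :
  is_linear S -> is_linear L -> rank_lt n L ->
  approximation_number n S <= operator_norm (fun x => minus (S x) (L x)).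
Proof.
intros HS HL HnL; apply infimum_le with 0.
  intros d [L' [HL' [_ ->]]]; apply operator_norm_ge0, linear_minus_bounded; assumption.
exists L; auto.
Qed.

(** If L competes for S, then B L A competes for B S A: linear maps do not raise the rank, and the
    error grows at most by the norm of A. *)
Lemma approximation_number_comp {T U V W : NormedModule C_AbsRing}
    n (A : T -> U) (S : U -> V) (B : V -> W) : (1 <= n)%nat ->
  is_linear A -> is_linear S -> is_linear B -> (forall x, norm (B x) <= norm x) ->
  approximation_number n (fun x => B (S (A x)))
    <= operator_norm A * approximation_number n S.
Proof.
intros Hn HA HS HB HB1; set (a := operator_norm A).
assert (Ha : 0 <= a) by (apply operator_norm_ge0, linear_bounded, HA).
assert (Hall : forall L, is_linear L -> rank_lt n L ->
    approximation_number n (fun x => B (S (A x)))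
      <= a * operator_norm (fun x => minus (S x) (L x))).
  intros L HL [m [v [Hm Hv]]].
  set (d := operator_norm (fun x => minus (S x) (L x))).
  assert (Hd : 0 <= d) by (apply operator_norm_ge0, linear_minus_bounded; assumption).
  eapply Rle_trans; [apply (approximation_number_le n _ (fun x => B (L (A x))))|].
  - apply (is_linear_comp (fun x => S (A x)) B); [apply (is_linear_comp A S)|]; assumption.
  - apply (is_linear_comp (fun x => L (A x)) B); [apply (is_linear_comp A L)|]; assumption.
  - exists m, (fun k => B (v k)); split; [exact Hm|]; intros x.
    destruct (Hv (A x)) as [c Hc]; exists c; rewrite Hc; apply linear_sum_n_m, HB.
  - apply operator_norm_le; [apply Rmult_le_pos; assumption|]; intros x.
    rewrite <- linear_minus by exact HB.
    eapply Rle_trans; [apply HB1|].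
    eapply Rle_trans.
      apply (operator_norm_bound (fun x => minus (S x) (L x)));
        apply linear_minus_bounded; assumption.
    fold d; rewrite (Rmult_comm a), Rmult_assoc; apply Rmult_le_compat_l; [exact Hd|].
    apply operator_norm_bound, linear_bounded, HA.
destruct (approximation_set_nonempty n S Hn) as [d0 [L0 [HL0 [Hn0 Ed0]]]].
(* A vanishing norm of A cannot be divided out; a single competitor then gives the bound. *)
destruct (Req_dec a 0) as [E0 | N0].
  assert (H := Hall L0 HL0 Hn0); rewrite E0, Rmult_0_l in *; exact H.
assert (Ha0 : 0 < a) by lra.
apply Rmult_le_reg_l with (/ a); [apply Rinv_0_lt_compat, Ha0|].
rewrite <- (Rmult_assoc (/ a) a), Rinv_l, Rmult_1_l by lra.
apply infimum_ge; [exists d0, L0; auto|].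
intros d [L [HL [HnL ->]]].
apply Rmult_le_reg_l with a; [exact Ha0|].
rewrite <- Rmult_assoc, Rinv_r, Rmult_1_l by lra; apply Hall; assumption.
Qed.

(** Compactness is tested on the unit ball, so A x_k is scaled by 1/M; the factor M is restored by
    the continuous map applied after S. *)
Lemma compact_operator_comp {T U V W : NormedModule C_AbsRing}
    (A : T -> U) (S : U -> V) (B : V -> W) :
  is_linear A -> is_linear S -> is_linear B ->
  compact_operator S -> compact_operator (fun x => B (S (A x))).
Proof.
intros HA HS HB HC x Hx.
destruct (linear_norm _ HA) as [M [HM HA2]].
assert (HMi : 0 < / M) by (apply Rinv_0_lt_compat, HM).
destruct (HC (fun k => scal (RtoC (/ M)) (A (x k)))) as [sigma [y [Hs Hy]]].
  intros k; eapply Rle_trans; [apply (norm_scal (K := C_AbsRing) (RtoC (/ M)) (A (x k)))|].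
  change (Cmod (RtoC (/ M)) * norm (A (x k)) <= 1).
  rewrite Cmod_R, Rabs_pos_eq by lra.
  specialize (HA2 (x k)); specialize (Hx k).
  apply Rle_trans with (/ M * (M * 1)); [|right; field; lra].
  apply Rmult_le_compat_l; [lra|]; eapply Rle_trans; [exact HA2|].
  apply Rmult_le_compat_l; lra.
exists sigma, (scal (RtoC M) (B y)); split; [exact Hs|].
set (D := fun v => scal (RtoC M) (B v)).
assert (HD : is_linear D).
  apply (is_linear_comp B (fun w => scal (RtoC M) w)); [exact HB|].
  apply (is_linear_scal_r (K := C_AbsRing)); intros n m; apply Cmult_comm.
apply filterlim_ext with (fun k => D (S (scal (RtoC (/ M)) (A (x (sigma k)))))).
  intros k; unfold D.
  assert (E1 := linear_scal _ HS (RtoC (/ M)) (A (x (sigma k)))).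
  change (scal (RtoC M) (B (S (@scal C_AbsRing _ (RtoC (/ M)) (A (x (sigma k))))))
    = B (S (A (x (sigma k))))).
  rewrite E1, (linear_scal _ HB (RtoC (/ M))), scal_assoc.
  replace (mult (RtoC M) (RtoC (/ M))) with (@one C_AbsRing).
    apply (scal_one (K := C_AbsRing)).
  change (RtoC 1 = (M * RtoC (/ M))%C); rewrite <- RtoC_mult, Rinv_r; [reflexivity | lra].
apply filterlim_comp with (1 := Hy); apply (linear_cont D y HD).
Qed.

(** * Partial fractions of a reciprocal Blaschke product *)

(** The reciprocal of the Blaschke product of the right half-plane with zeros [us]. *)
Definition inv_blaschke (us : list C) (v : C) : C :=
  fold_right (fun u s => (v + Cconj u) / (v - u) * s)%C (RtoC 1) us.

Lemma Cminus_neq0 (a b : C) : a <> b -> (a - b)%C <> 0.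
Proof. apply Cminus_eq_contra. Qed.

Lemma Cmod_inv_blaschke_ge1 us v : 0 < Re v -> ~ In v us ->
  (forall u, In u us -> 0 < Re u) -> 1 <= Cmod (inv_blaschke us v).
Proof.
intros Hv; induction us as [|u us IH]; intros Hnin Hus; simpl.
  rewrite Cmod_1; lra.
assert (Hu : 0 < Re u) by (apply Hus; left; reflexivity).
assert (Hne : (v - u)%C <> 0) by (apply Cminus_neq0; intros E; apply Hnin; left; auto).
assert (H1 : 1 <= Cmod (inv_blaschke us v)).
  apply IH; [intros H; apply Hnin; right; exact H | intros; apply Hus; right; assumption].
rewrite Cmod_mult, Cmod_div by exact Hne.
assert (H2 : Cmod (v - u) <= Cmod (v + Cconj u)).
  apply sqr_le_inv; [apply Cmod_ge_0|].
  rewrite !Cmod2_alt; unfold Re, Im in *; simpl in *; nra.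
assert (H3 : 0 < Cmod (v - u)) by (apply Cmod_gt_0, Hne).
assert (H4 : 1 <= Cmod (v + Cconj u) / Cmod (v - u)).
  apply Rmult_le_reg_r with (Cmod (v - u)); [exact H3|].
  unfold Rdiv; rewrite Rmult_assoc, Rinv_l by lra; lra.
fold (inv_blaschke us v); nra.
Qed.

(** The residue at u_j is 2 Re u_j times the other factors at u_j, each of modulus at least 1 in the
    half-plane; the constant 1 is the value at infinity. Inductively, a new factor multiplies the
    old residues by its values at their poles. *)
Lemma partial_fractions us : NoDup us -> (forall u, In u us -> 0 < Re u) ->
  exists Y : list (C * C), map snd Y = us /\
    (forall p, In p Y -> 2 * Re (snd p) <= Cmod (fst p)) /\
    forall v, ~ In v us ->
      inv_blaschke us v = (1 + csum (fun p => fst p / (v - snd p)) Y)%C.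
Proof.
induction us as [|u us IH]; intros Hnd Hus.
  exists nil; split; [reflexivity|]; split; [intros p []|].
  intros v _; simpl; ring.
inversion Hnd as [|u' us' Hnin Hnd']; subst.
assert (Hu : 0 < Re u) by (apply Hus; left; reflexivity).
assert (Hus' : forall u, In u us -> 0 < Re u) by (intros; apply Hus; right; assumption).
destruct (IH Hnd' Hus') as [Y [HY1 [HY2 HY3]]].
assert (HYin : forall p, In p Y -> In (snd p) us).
  intros p Hp; rewrite <- HY1; apply in_map, Hp.
exists (((u + Cconj u) * inv_blaschke us u, u)%C ::
  map (fun p => (fst p * ((snd p + Cconj u) / (snd p - u)), snd p)%C) Y).
split; [|split].
- simpl; rewrite map_map; simpl; f_equal; exact HY1.
- intros p [<- | Hp]; simpl.
    rewrite Cmod_mult.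
    assert (E : Cmod (u + Cconj u) = 2 * Re u).
      replace (u + Cconj u)%C with (RtoC (2 * Re u)).
        rewrite Cmod_R, Rabs_pos_eq; lra.
      destruct u as [a b]; unfold RtoC, Cplus, Cconj, Re; simpl; f_equal; ring.
    rewrite E; assert (H := Cmod_inv_blaschke_ge1 us u Hu Hnin Hus'); nra.
  apply in_map_iff in Hp; destruct Hp as [q [<- Hq]]; simpl.
  assert (Hne : (snd q - u)%C <> 0).
    apply Cminus_neq0; intros E; apply Hnin; rewrite <- E; apply HYin, Hq.
  eapply Rle_trans; [apply HY2, Hq|].
  rewrite Cmod_mult.
  assert (H : 1 <= Cmod (inv_blaschke (u :: nil) (snd q))).
    apply Cmod_inv_blaschke_ge1.
    - apply Hus', HYin, Hq.
    - intros [E | []]; apply Hne; rewrite E; ring.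
    - intros x [<- | []]; exact Hu.
  simpl in H; rewrite Cmult_1_r in H.
  assert (H0 := Cmod_ge_0 (fst q)); nra.
- intros v Hv.
  assert (Hvu : (v - u)%C <> 0).
    apply Cminus_neq0; intros E; apply Hv; left; auto.
  simpl inv_blaschke; fold (inv_blaschke us v).
  rewrite HY3 by (intros H; apply Hv; right; exact H).
  simpl csum; fold (csum (fun p : C * C => fst p / (v - snd p))%C).
  rewrite csum_map, HY3 by exact Hnin; simpl.
  rewrite (csum_ext_in (fun a => fst a * ((snd a + Cconj u) / (snd a - u)) / (v - snd a))%C
    (fun a => (v + Cconj u) / (v - u) * (fst a / (v - snd a))
      - (u + Cconj u) / (v - u) * (fst a / (u - snd a)))%C).
    rewrite csum_minus, !csum_scal; field; exact Hvu.
  intros p Hp.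
  assert (H1 : (v - snd p)%C <> 0).
    apply Cminus_neq0; intros E; apply Hv; right; rewrite E; apply HYin, Hp.
  assert (H2 : (u - snd p)%C <> 0).
    apply Cminus_neq0; intros E; apply Hnin; rewrite E; apply HYin, Hp.
  assert (H3 : (snd p - u)%C <> 0).
    intros E; apply H2; rewrite <- Copp_0, <- E; ring.
  field; auto.
Qed.

Lemma inv_blaschke_reflect us u : In u us -> inv_blaschke us (- Cconj u)%C = 0.
Proof.
induction us as [|u' us IH]; [intros [] | intros [<- | H]]; simpl.
  replace (- Cconj u' + Cconj u')%C with (RtoC 0) by ring; unfold Cdiv; ring.
fold (inv_blaschke us (- Cconj u)%C); rewrite IH by exact H; ring.
Qed.

(** The factors are unimodular on the imaginary axis, which yields a reflection identity; here it is
    used at a real point. *)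
Lemma inv_blaschke_conj us (th : R) : 0 < th ->
  (forall u, In u us -> 0 < Re u /\ u <> RtoC th) ->
  (inv_blaschke us (- th) * Cconj (inv_blaschke us th))%C = 1.
Proof.
intros Hth; induction us as [|u us IH]; intros Hus.
  simpl; rewrite Cconj_1; ring.
change (inv_blaschke (u :: us) (- th)) with
  ((- th + Cconj u) / (- th - u) * inv_blaschke us (- th))%C.
change (inv_blaschke (u :: us) th) with ((th + Cconj u) / (th - u) * inv_blaschke us th)%C.
destruct (Hus u) as [Hu1 Hu2]; [left; reflexivity|].
assert (Hc : Cconj (RtoC th) = th) by apply Cconj_R.
assert (H1 : (th - u)%C <> 0) by (apply Cminus_neq0; auto).
assert (H2 : (th - Cconj u)%C <> 0).
  intros E; apply H1; rewrite <- (Cconj_conj (th - u)%C), Cminus_conj, Hc, E.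
  apply Cconj_0.
assert (H3 : (th + u)%C <> 0) by (apply Cneq0_Re; rewrite re_plus, re_RtoC; lra).
rewrite Cmult_conj, Cdiv_conj by exact H1.
rewrite Cplus_conj, Cminus_conj, Hc, Cconj_conj.
replace ((- th + Cconj u) / (- th - u))%C with ((th - Cconj u) / (th + u))%C.
2:{ field; split; auto; intros E; apply H3; rewrite <- Copp_0, <- E; ring. }
transitivity (inv_blaschke us (- th) * Cconj (inv_blaschke us th))%C.
  field; auto.
apply IH; intros; apply Hus; right; assumption.
Qed.

(** The double sum is computed exactly. The expansion at the zeros -conj(u_q) and at -th collapses
    the sum over p; its values at -th and th collapse the sum over q, leaving (1 - |d|^2) / (2 th).
    Excluding th from the nodes keeps the value at th finite. *)
Lemma blaschke_residue_norm us (th : R) Y : 0 < th ->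
  (forall u, In u us -> 0 < Re u /\ u <> RtoC th) -> map snd Y = us ->
  (forall v, ~ In v us ->
      inv_blaschke us v = (1 + csum (fun p => fst p / (v - snd p)) Y)%C) ->
  Re (hgram (map (fun p => (fst p / (th + snd p), snd p)%C) Y) 0) <= / (2 * th).
Proof.
intros Hth Hus HY Hpf.
set (d := inv_blaschke us (- th)); set (e := inv_blaschke us th).
assert (HYin : forall p, In p Y -> In (snd p) us).
  intros p Hp; rewrite <- HY; apply in_map, Hp.
assert (Hc : Cconj (RtoC th) = th) by apply Cconj_R.
assert (Hnz : forall p, In p Y -> (th + snd p)%C <> 0 /\ (th - snd p)%C <> 0 /\
    (th + Cconj (snd p))%C <> 0 /\ (th - Cconj (snd p))%C <> 0).
  intros p Hp; destruct (Hus _ (HYin p Hp)) as [H1 H2].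
  assert (H3 : (th - snd p)%C <> 0) by (apply Cminus_neq0; auto).
  repeat split; auto; try (apply Cneq0_Re; rewrite re_plus, ?re_conj, re_RtoC; lra).
  intros E; apply H3; rewrite <- (Cconj_conj (th - snd p)%C), Cminus_conj, Hc, E.
  apply Cconj_0.
assert (Hplus : csum (fun p => fst p / (th + snd p))%C Y = (1 - d)%C).
  assert (H : ~ In (- th)%C us).
    intros Hin; destruct (Hus _ Hin) as [H _]; rewrite re_opp, re_RtoC in H; lra.
  unfold d; rewrite (Hpf _ H).
  rewrite (csum_ext_in (fun p => fst p / (- th - snd p))%C
    (fun p => (- (1)) * (fst p / (th + snd p)))%C).
    rewrite csum_scal; ring.
  intros p Hp; destruct (Hnz p Hp) as [H1 _]; field; split; auto.
  intros E; apply H1; rewrite <- Copp_0, <- E; ring.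
assert (Hminus : csum (fun p => fst p / (th - snd p))%C Y = (e - 1)%C).
  assert (H : ~ In (RtoC th) us).
    intros Hin; destruct (Hus _ Hin) as [_ H]; auto.
  unfold e; rewrite (Hpf _ H); ring.
assert (Hrefl : forall q, In q Y -> csum (fun p => fst p / (snd p + Cconj (snd q)))%C Y = 1).
  intros q Hq; destruct (Hus _ (HYin q Hq)) as [Hq1 _].
  assert (H : ~ In (- Cconj (snd q))%C us).
    intros Hin; destruct (Hus _ Hin) as [H _]; rewrite re_opp, re_conj in H; lra.
  assert (E := Hpf _ H); rewrite inv_blaschke_reflect in E by (apply HYin, Hq).
  rewrite (csum_ext_in (fun p => fst p / (- Cconj (snd q) - snd p))%C
    (fun p => (- (1)) * (fst p / (snd p + Cconj (snd q))))%C), csum_scal in E.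
    transitivity (1 - (1 + - (1) * csum (fun p => fst p / (snd p + Cconj (snd q))) Y))%C; [ring|].
    rewrite <- E; ring.
  intros p Hp; destruct (Hus _ (HYin p Hp)) as [Hp1 _].
  assert (H1 := Cneq0_sum_conj _ _ Hp1 Hq1); field; split; auto.
  intros E1; apply H1; rewrite <- Copp_0, <- E1; ring.
assert (Hth2 : RtoC (2 * th) <> 0) by (apply RtoC_neq0; lra).
assert (Hinner : forall q, In q Y -> csum (fun p => fst p / (th + snd p)
    / (snd p + Cconj (snd q)))%C Y = (d / (th - Cconj (snd q)))%C).
  intros q Hq; destruct (Hus _ (HYin q Hq)) as [Hq1 _].
  destruct (Hnz q Hq) as [_ [_ [_ Hq4]]].
  rewrite (csum_ext_in _ (fun p => / (th - Cconj (snd q)) *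
    (fst p / (snd p + Cconj (snd q)) - fst p / (th + snd p)))%C).
    rewrite csum_scal, csum_minus, Hplus, Hrefl by exact Hq; field; exact Hq4.
  intros p Hp; destruct (Hus _ (HYin p Hp)) as [Hp1 _]; destruct (Hnz p Hp) as [Hp2 _].
  assert (H1 := Cneq0_sum_conj _ _ Hp1 Hq1); field; auto.
assert (Htot : hgram (map (fun p => (fst p / (th + snd p), snd p)%C) Y) 0
    = (/ RtoC (2 * th) * (1 - d * Cconj d))%C).
  unfold hgram; rewrite csum_map.
  rewrite (csum_ext _ (fun p => csum (fun q =>
    Cconj (fst q / (th + snd q)) * (fst p / (th + snd p) / (snd p + Cconj (snd q)))) Y)%C).
  2:{ intros p; rewrite csum_map; apply csum_ext; intros q; simpl.
      rewrite cexpn_0; unfold Cdiv; ring. }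
  rewrite csum_switch.
  rewrite (csum_ext_in _ (fun q => (d / RtoC (2 * th)) *
    Cconj (fst q / (th + snd q) + fst q / (th - snd q)))%C).
    rewrite csum_scal, <- csum_conj, csum_plus, Hplus, Hminus.
    replace (1 - d + (e - 1))%C with (e - d)%C by ring.
    rewrite Cminus_conj.
    transitivity (/ RtoC (2 * th) * (d * Cconj e - d * Cconj d))%C; [field; exact Hth2|].
    unfold d at 1, e; rewrite inv_blaschke_conj by assumption; reflexivity.
  intros q Hq; rewrite csum_scal, Hinner by exact Hq.
  destruct (Hnz q Hq) as [Hq1 [Hq2 [Hq3 Hq4]]].
  rewrite Cplus_conj, !Cdiv_conj, Cplus_conj, Cminus_conj, Hc by assumption.
  rewrite RtoC_mult in *; assert (Ht : RtoC th <> 0) by (apply RtoC_neq0; lra).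
  assert (H2 : RtoC 2 <> 0) by (apply RtoC_neq0; lra).
  field; auto.
rewrite Htot, <- RtoC_inv, re_scal_l by lra.
rewrite <- (Rmult_1_r (/ (2 * th))) at 2.
apply Rmult_le_compat_l; [left; apply Rinv_0_lt_compat; lra|].
unfold Cminus; rewrite re_plus, re_opp, re_mult_conj_l, re_RtoC.
assert (H := pow2_ge_0 (Cmod d)); lra.
Qed.

(** * Riesz bounds and sampled exponential sums *)

Definition weighted_nodes (b w : nat -> C) (n : nat) : list (C * C) :=
  map (fun j => (b j, w j)) (seq 1 n).

(** Point evaluation at w has squared norm 1/(1 - |w|^2), so this is the lower Riesz inequality for
    the normalised kernels, the dual form of interpolation with constant M. *)
Definition riesz_bound (n : nat) (w : nat -> C) (M : R) : Prop :=
  forall b, rsum (fun j => Cmod (b j) ^ 2 / (1 - Cmod (w j) ^ 2)) (seq 1 n)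
    <= M ^ 2 * Re (gram (weighted_nodes b w n)).

Lemma weighted_nodes_of_list n (w : nat -> C) (Y : list (C * C)) :
  map snd Y = map w (seq 1 n) -> exists y, Y = weighted_nodes y w n.
Proof.
intros HY; exists (fun j => fst (nth (j - 1) Y (RtoC 0, w 0%nat))).
assert (Hlen : length Y = n).
  rewrite <- (length_map snd Y), HY, length_map, length_seq; reflexivity.
apply nth_ext with (d := (RtoC 0, w 0%nat)) (d' := (fst (nth (0 - 1) Y (RtoC 0, w 0%nat)), w 0%nat)).
  unfold weighted_nodes; rewrite length_map, length_seq; exact Hlen.
intros i Hi; unfold weighted_nodes.
rewrite (map_nth (fun j => (fst (nth (j - 1) Y (RtoC 0, w 0%nat)), w j)) (seq 1 n) 0%nat i).
rewrite seq_nth by lia; replace (1 + i - 1)%nat with i by lia.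
rewrite (surjective_pairing (nth i Y (RtoC 0, w 0%nat))) at 1; f_equal.
change (w 0%nat) with (snd (RtoC 0, w 0%nat)) at 1; rewrite <- map_nth, HY.
simpl snd; rewrite map_nth, seq_nth by lia; reflexivity.
Qed.

Lemma cayley_inj a b : Cmod a < 1 -> Cmod b < 1 -> cayley a = cayley b -> a = b.
Proof.
intros Ha Hb E; assert (H1 := one_plus_neq0 a Ha); assert (H2 := one_plus_neq0 b Hb).
assert (H3 : RtoC 2 <> 0) by (intros H; apply RtoC_inj in H; lra).
assert (E1 : (2 * (a - b))%C = 0).
  transitivity ((cayley b - cayley a) * ((1 + a) * (1 + b)))%C.
    unfold cayley; field; auto.
  rewrite E; ring.
apply Ceq_minus; destruct (Ceq_dec (a - b)%C 0) as [H|H]; [exact H|].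
exfalso; exact (Cmult_neq_0 _ _ H3 H E1).
Qed.

Lemma Re_cayley_ge w : Cmod w < 1 -> (1 - Cmod w ^ 2) / 4 <= Re (cayley w).
Proof.
intros Hw; rewrite Re_cayley by exact Hw.
assert (H0 := Cmod_ge_0 w).
assert (H1 : 0 < Cmod (1 + w)) by (apply Cmod_gt_0, one_plus_neq0, Hw).
assert (H2 : Cmod (1 + w) <= 2).
  eapply Rle_trans; [apply Cmod_triangle|]; rewrite Cmod_1; lra.
apply Rmult_le_compat_l; [nra|].
apply Rinv_le_contravar; [nra|nra].
Qed.

Lemma in_disc_weighted_nodes b w n :
  (forall j, (1 <= j <= n)%nat -> Cmod (w j) < 1) -> in_disc (weighted_nodes b w n).
Proof.
intros Hw p Hp; apply in_map_iff in Hp; destruct Hp as [j [<- Hj]].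
apply in_seq in Hj; apply Hw; lia.
Qed.

Lemma hgram_weighted_nodes b w n x : (forall j, (1 <= j <= n)%nat -> Cmod (w j) < 1) ->
  Re (hgram (to_half (weighted_nodes b w n)) x) = 2 * Re (gram (weighted_nodes
    (fun j => b j * cexpn (cayley (w j)) x / (1 + cayley (w j)))%C w n)).
Proof.
intros Hw; rewrite hgram_to_half by (apply in_disc_weighted_nodes, Hw).
rewrite re_scal_l; unfold weighted_nodes; rewrite map_map; reflexivity.
Qed.

Lemma Cmod_add_cayley_le (t B : R) w : 0 <= t -> Cmod (cayley w) <= B ->
  Cmod (t + cayley w) <= t + B.
Proof.
intros Ht HB; eapply Rle_trans; [apply Cmod_triangle|].
rewrite Cmod_R, Rabs_pos_eq by lra; lra.
Qed.

Lemma add_cayley_neq0 (t : R) w : 0 <= t -> Cmod w < 1 -> (t + cayley w)%C <> 0.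
Proof.
intros Ht Hw; apply Cneq0_Re; rewrite re_plus, re_RtoC.
assert (H := Re_cayley_gt0 w Hw); lra.
Qed.

(* The Riesz bound tested on the residues of the reciprocal Blaschke product,
   whose modulus is at least [1 - |w|^2] up to constants. *)
Lemma riesz_mass n (w : nat -> C) B M : 0 < B ->
  (forall j, (1 <= j <= n)%nat -> Cmod (w j) < 1) ->
  (forall j, (1 <= j <= n)%nat -> Cmod (cayley (w j)) <= B) ->
  distinct_points n w -> riesz_bound n w M ->
  rsum (fun j => 1 - Cmod (w j) ^ 2) (seq 1 n) <= ((2 * B + 1) * (B + 1)) ^ 2 * M ^ 2.
Proof.
intros HB Hw HwB Hdist HM; set (u j := cayley (w j)).
(* Larger than every |u_j|, so that th is not a node. *)
set (th := B + 1); assert (Hth : 0 < th) by (unfold th; lra).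
set (us := map u (seq 1 n)).
assert (Hus : forall v, In v us -> 0 < Re v /\ v <> RtoC th).
  intros v Hv; apply in_map_iff in Hv; destruct Hv as [j [<- Hj]].
  apply in_seq in Hj; assert (Hj' : (1 <= j <= n)%nat) by lia.
  split; [apply Re_cayley_gt0, Hw, Hj'|].
  intros E; assert (H := HwB j Hj'); fold (u j) in H.
  rewrite E, Cmod_R, Rabs_pos_eq in H by lra; unfold th in H; lra.
assert (Hnd : NoDup us).
  apply NoDup_map_NoDup_ForallPairs; [|apply seq_NoDup].
  intros i j Hi Hj E; apply in_seq in Hi, Hj.
  apply Hdist; [lia | lia | apply cayley_inj; [apply Hw | apply Hw | exact E]; lia].
destruct (partial_fractions us Hnd (fun v Hv => proj1 (Hus v Hv))) as [Y [HY1 [HY2 HY3]]].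
assert (Hres := blaschke_residue_norm us th Y Hth Hus HY1 HY3).
destruct (weighted_nodes_of_list n u Y HY1) as [y Ey].
set (b j := (y j / (th + u j))%C).
assert (EY : map (fun p => (fst p / (th + snd p), snd p)%C) Y = to_half (weighted_nodes b w n)).
  rewrite Ey; unfold to_half, weighted_nodes; rewrite !map_map; reflexivity.
rewrite EY, hgram_weighted_nodes in Hres by exact Hw.
set (b' j := (b j * cexpn (u j) 0 / (1 + u j))%C) in *.
change (fun j => (b j * cexpn (cayley (w j)) 0 / (1 + cayley (w j)))%C) with b' in Hres.
assert (HR := HM b').
(* A bound for |th + u_j| |1 + u_j|, the denominator between the residue y_j and the coefficient
   b'_j. *)
set (k := (2 * B + 1) * (B + 1)); assert (Hk : 0 < k) by (unfold k; nra).
assert (Hterm : forall j, In j (seq 1 n) ->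
    / (4 * k ^ 2) * (1 - Cmod (w j) ^ 2) <= Cmod (b' j) ^ 2 / (1 - Cmod (w j) ^ 2)).
  intros j Hj; apply in_seq in Hj; assert (Hj' : (1 <= j <= n)%nat) by lia.
  assert (Hwj := Hw j Hj'); assert (Hw0 := Cmod_ge_0 (w j)).
  set (h := 1 - Cmod (w j) ^ 2); assert (Hh : 0 < h) by (unfold h; nra).
  assert (Hy : h / 2 <= Cmod (y j)).
    assert (H1 : In (y j, u j) Y).
      rewrite Ey; unfold weighted_nodes; apply in_map_iff; exists j; split; [reflexivity|].
      apply in_seq; lia.
    assert (H2 := HY2 _ H1); cbn [fst snd] in H2.
    assert (H3 := Re_cayley_ge _ Hwj); fold h in H3; unfold u in H2; lra.
  assert (Hb' : h / (2 * k) <= Cmod (b' j)).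
    unfold b', b; rewrite cexpn_0, Cmult_1_r.
    assert (N1 := add_cayley_neq0 th _ (Rlt_le _ _ Hth) Hwj).
    assert (N2 := add_cayley_neq0 1 _ Rle_0_1 Hwj).
    assert (P1 := Cmod_add_cayley_le th B _ (Rlt_le _ _ Hth) (HwB j Hj')).
    assert (P2 := Cmod_add_cayley_le 1 B _ Rle_0_1 (HwB j Hj')).
    fold (u j) in *.
    apply Cmod_gt_0 in N1 as N1'; apply Cmod_gt_0 in N2 as N2'.
    rewrite !Cmod_div by assumption.
    apply Rmult_le_reg_r with (Cmod (th + u j) * Cmod (1 + u j)).
      apply Rmult_lt_0_compat; assumption.
    replace (Cmod (y j) / Cmod (th + u j) / Cmod (1 + u j) * (Cmod (th + u j) * Cmod (1 + u j)))
      with (Cmod (y j)) by (field; lra).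
    apply Rle_trans with (h / (2 * k) * k).
      apply Rmult_le_compat_l.
        apply Rmult_le_pos; [lra | left; apply Rinv_0_lt_compat; lra].
      unfold k; apply Rmult_le_compat; try lra; unfold th in *; lra.
    replace (h / (2 * k) * k) with (h / 2) by (field; lra); exact Hy.
  replace (/ (4 * k ^ 2) * h) with ((h / (2 * k)) ^ 2 / h) by (field; lra).
  apply Rmult_le_compat_r; [left; apply Rinv_0_lt_compat, Hh|].
  apply pow_incr; split; [|exact Hb'].
  apply Rmult_le_pos; [lra | left; apply Rinv_0_lt_compat; lra].
apply rsum_le_in in Hterm; rewrite rsum_scal in Hterm.
set (S := rsum (fun j => 1 - Cmod (w j) ^ 2) (seq 1 n)) in *.
assert (Hi : / (2 * th) <= / 2).
  apply Rinv_le_contravar; unfold th; lra.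
assert (H1 : / (4 * k ^ 2) * S <= M ^ 2 * / 4).
  eapply Rle_trans; [exact Hterm|]; eapply Rle_trans; [exact HR|].
  apply Rmult_le_compat_l; [apply pow2_ge_0 | lra].
change (S <= k ^ 2 * M ^ 2).
apply Rmult_le_reg_l with (/ (4 * k ^ 2)).
  apply Rinv_0_lt_compat; nra.
eapply Rle_trans; [exact H1|]; right; field; lra.
Qed.

(** * Elementary estimates for exponentials and their sums *)

Lemma sin_abs_le x : Rabs (sin x) <= Rabs x.
Proof.
assert (Hpos : forall y, 0 <= y -> Rabs (sin y) <= y).
  intros y Hy; destruct (Req_dec y 0) as [-> | N]; [rewrite sin_0, Rabs_R0; lra|].
  assert (H1 := sin_lt_x y ltac:(lra)).
  apply Rabs_le; split; [|lra].
  destruct (Rle_lt_dec y PI) as [H2 | H2].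
    assert (0 <= sin y) by (apply sin_ge_0; lra); lra.
  assert (H3 := SIN_bound y); assert (H4 := PI2_1); lra.
destruct (Rle_lt_dec 0 x) as [Hx | Hx].
  rewrite (Rabs_pos_eq x) by exact Hx; apply Hpos, Hx.
rewrite <- Rabs_Ropp, <- sin_neg, (Rabs_left x) by exact Hx; apply Hpos; lra.
Qed.

(** The left side is 2 |sin(t/2)|. *)
Lemma cis_minus_1 t : Cmod (cis t - 1) <= Rabs t.
Proof.
apply sqr_le_inv; [apply Rabs_pos|].
rewrite Cmod2_alt, pow2_abs; unfold Re, Im, cis; simpl.
assert (E := sin2_cos2 t); unfold Rsqr in E.
assert (H : Rabs (sin (t / 2)) ^ 2 <= Rabs (t / 2) ^ 2).
  apply pow_incr; split; [apply Rabs_pos | apply sin_abs_le].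
rewrite !pow2_abs in H.
assert (Ec : cos t = 1 - 2 * sin (t / 2) * sin (t / 2)).
  replace t with (2 * (t / 2)) at 1 by field; apply cos_2a_sin.
nra.
Qed.

Lemma cexpn_minus_1 u x : 0 <= Re u -> 0 <= x ->
  Cmod (cexpn u x - 1) <= 2 * Cmod u * x.
Proof.
intros Hu Hx.
assert (E : cexpn u x = (exp (- Re u * x) * cis (- (Im u * x)))%C).
  unfold cexpn, cis, RtoC, Cmult; simpl; rewrite cos_neg, sin_neg; f_equal; ring.
rewrite E; set (r := exp (- Re u * x)).
assert (Hr0 : 0 < r) by apply exp_pos.
assert (Hux : 0 <= Re u * x) by (apply Rmult_le_pos; assumption).
assert (Hr1 : r <= 1).
  unfold r; rewrite <- exp_0; destruct (Req_dec (Re u * x) 0) as [E0 | N0].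
    replace (- Re u * x) with 0 by lra; lra.
  left; apply exp_increasing; lra.
assert (Hr2 : 1 - r <= Re u * x).
  assert (H := exp_ineq1_le (- Re u * x)); fold r in H; lra.
replace (r * cis (- (Im u * x)) - 1)%C with
  (r * (cis (- (Im u * x)) - 1) + RtoC (- (1 - r)))%C
  by (rewrite RtoC_opp, RtoC_minus; ring).
eapply Rle_trans; [apply Cmod_triangle|].
rewrite Cmod_mult, !Cmod_R, Rabs_Ropp, (Rabs_pos_eq r), (Rabs_pos_eq (1 - r)) by lra.
assert (H1 := cis_minus_1 (- (Im u * x))).
rewrite Rabs_Ropp, Rabs_mult, (Rabs_pos_eq x) in H1 by exact Hx.
assert (H2 := im_le_Cmod u); assert (H3 := re_le_Cmod u).
rewrite Rabs_pos_eq in H3 by exact Hu.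
assert (H4 := Cmod_ge_0 (cis (- (Im u * x)) - 1)).
assert (H5 : Rabs (Im u) * x <= Cmod u * x) by (apply Rmult_le_compat_r; assumption).
assert (H6 : Re u * x <= Cmod u * x) by (apply Rmult_le_compat_r; assumption).
nra.
Qed.

Lemma ln_INR_ge0 n : (1 <= n)%nat -> 0 <= ln (INR n).
Proof.
intros Hn; rewrite <- ln_1.
destruct (Req_dec (INR n) 1) as [-> | N]; [lra|].
assert (H : 1 <= INR n) by (rewrite <- INR_1; apply le_INR, Hn).
left; apply ln_increasing; lra.
Qed.

(** Along the points log 2^k each exponential is the k-th power of a fixed number of modulus less
    than 1. *)
Lemma hgram_vanishes l : in_disc l ->
  is_lim_seq (fun k => Re (hgram (to_half l) (ln (INR (2 ^ k))))) 0.
Proof.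
intros Hl; set (L := to_half l).
assert (HL : in_half L) by (apply in_half_to_half, Hl).
assert (H : climit (fun k => hgram L (ln (INR (2 ^ k)))) (csum (fun p => csum (fun q =>
    fst p * Cconj (fst q) / (snd p + Cconj (snd q)) * 0) L) L)%C).
  apply (climit_csum (fun p k => csum (fun q =>
    fst p * Cconj (fst q) / (snd p + Cconj (snd q))
    * cexpn (snd p + Cconj (snd q)) (ln (INR (2 ^ k)))) L)%C).
  intros p Hp; apply (climit_csum (fun q k =>
    fst p * Cconj (fst q) / (snd p + Cconj (snd q))
    * cexpn (snd p + Cconj (snd q)) (ln (INR (2 ^ k))))%C).
  intros q Hq; apply climit_scal.
  set (v := (snd p + Cconj (snd q))%C).
  assert (Hv : 0 < Re v).
    unfold v; rewrite re_plus, re_conj; assert (H1 := HL p Hp); assert (H2 := HL q Hq); lra.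
  apply climit_ext with (fun k => cexpn v (ln (INR 2)) ^ k)%C.
    intros k; symmetry; apply (inv_npow_pow2 k v).
  apply climit_pow0; rewrite Cmod_cexpn, <- exp_0; apply exp_increasing.
  assert (0 < ln (INR 2)) by (rewrite <- ln_1; apply ln_increasing; simpl; lra); nra.
apply is_lim_seq_Re in H.
replace (Re (csum _ L)) with 0 in H; [exact H|].
rewrite (csum_ext _ (fun _ => RtoC 0)), csum_0; [reflexivity|].
intros p; transitivity (csum (fun _ : C * C => RtoC 0) L); [|apply csum_0].
apply csum_ext; intros q; ring.
Qed.

(** * Lower bound for the samples beyond log N *)

Section SampledBound.

(** The last hypothesis makes N so large that the error of replacing the integral beyond log N by
    samples stays within a quarter of the lower bound for that integral. *)
Variables (n N : nat) (w b : nat -> C) (B M S : R).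
Hypotheses (HB : 0 < B) (HM : 1 <= M)
  (Hw : forall j, (1 <= j <= n)%nat -> Cmod (w j) < 1)
  (HwB : forall j, (1 <= j <= n)%nat -> Cmod (cayley (w j)) <= B)
  (HR : riesz_bound n w M)
  (HS : rsum (fun j => 1 - Cmod (w j) ^ 2) (seq 1 n) <= S)
  (HN : (2 <= N)%nat)
  (HNS : 16 * B ^ 2 * S * M ^ 2 * (1 + B) ^ 2 <= INR N - 1).

Let u j := cayley (w j).
Let L := to_half (weighted_nodes b w n).
(** The coefficients of G after moving the origin to log N. Energy and error are both measured by
    their weighted mass Q, so the decay before log N is paid for only once, in [sample_Q_lower]. *)
Let gam j := (b j * cexpn (u j) (ln (INR N)))%C.
Let Q := rsum (fun j => Cmod (gam j) ^ 2 / (1 - Cmod (w j) ^ 2)) (seq 1 n).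

Lemma sample_weight j : In j (seq 1 n) -> 0 < 1 - Cmod (w j) ^ 2.
Proof.
intros Hj; apply in_seq in Hj; assert (H := Hw j ltac:(lia)).
assert (H0 := Cmod_ge_0 (w j)); nra.
Qed.

Lemma sample_Q_ge0 : 0 <= Q.
Proof.
apply rsum_ge0_in; intros j Hj; apply Rmult_le_pos; [apply pow2_ge_0|].
left; apply Rinv_0_lt_compat, sample_weight, Hj.
Qed.

(** Cauchy-Schwarz against the weights 1 - |w_j|^2; this is where their total mass enters the
    error. *)
Lemma sample_sum_sqr : rsum (fun j => Cmod (gam j)) (seq 1 n) ^ 2 <= Q * S.
Proof.
rewrite (rsum_ext_in _ (fun j => (Cmod (gam j) / sqrt (1 - Cmod (w j) ^ 2))
  * sqrt (1 - Cmod (w j) ^ 2))).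
2:{ intros j Hj; assert (H := sqrt_lt_R0 _ (sample_weight j Hj)); field; lra. }
eapply Rle_trans; [apply rsum_cauchy|].
rewrite (rsum_ext_in (fun j => sqrt (1 - Cmod (w j) ^ 2) ^ 2) (fun j => 1 - Cmod (w j) ^ 2)).
2:{ intros j Hj; apply pow2_sqrt; left; apply sample_weight, Hj. }
rewrite (rsum_ext_in (fun j => (Cmod (gam j) / sqrt (1 - Cmod (w j) ^ 2)) ^ 2) (fun j => Cmod (gam j) ^ 2 / (1 - Cmod (w j) ^ 2))).
2:{ intros j Hj; assert (H := sample_weight j Hj).
    unfold Rdiv; rewrite Rpow_mult_distr, pow_inv, pow2_sqrt by lra; reflexivity. }
apply Rmult_le_compat_l; [apply sample_Q_ge0 | exact HS].
Qed.

Lemma expsum_weighted_nodes x : expsum L x = csum (fun j => b j * cexpn (u j) x)%C (seq 1 n).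
Proof. unfold expsum, L, to_half, weighted_nodes; rewrite !csum_map; reflexivity. Qed.

(** Over a step of length at most 1/m each exponential changes by at most 2B/m times its size at log
    m, and that size is at most |gam_j| because m >= N. *)
Lemma sample_increment m x : (N <= m)%nat ->
  ln (INR m) <= x <= ln (INR (Datatypes.S m)) ->
  Cmod (expsum L x - expsum L (ln (INR m))) ^ 2 <= 4 * B ^ 2 / INR m ^ 2 * (Q * S).
Proof.
intros Hm Hx; assert (Hm0 : 0 < INR m) by (apply lt_0_INR; lia).
destruct (ln_succ_bounds m ltac:(lia)) as [_ Hln].
assert (HlnN : ln (INR N) <= ln (INR m)).
  destruct (Nat.eq_dec N m) as [-> | Hne]; [lra|].
  left; apply ln_increasing; [apply lt_0_INR | apply lt_INR]; lia.
assert (H : Cmod (expsum L x - expsum L (ln (INR m)))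
    <= 2 * B / INR m * rsum (fun j => Cmod (gam j)) (seq 1 n)).
  rewrite !expsum_weighted_nodes, <- csum_minus.
  eapply Rle_trans; [apply Cmod_csum|]; rewrite <- rsum_scal.
  apply rsum_le_in; intros j Hj; apply in_seq in Hj.
  assert (Hj' : (1 <= j <= n)%nat) by lia.
  assert (Hu := Re_cayley_gt0 _ (Hw j Hj')); fold (u j) in Hu.
  replace (b j * cexpn (u j) x - b j * cexpn (u j) (ln (INR m)))%C with
    (gam j * cexpn (u j) (ln (INR m) - ln (INR N)) * (cexpn (u j) (x - ln (INR m)) - 1))%C.
    rewrite !Cmod_mult, Cmod_cexpn.
    assert (H1 : exp (- Re (u j) * (ln (INR m) - ln (INR N))) <= 1).
      rewrite <- exp_0; destruct (Req_dec (ln (INR m) - ln (INR N)) 0) as [-> | Hne].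
        rewrite Rmult_0_r; lra.
      left; apply exp_increasing; nra.
    assert (H2 : Cmod (cexpn (u j) (x - ln (INR m)) - 1) <= 2 * B / INR m).
      eapply Rle_trans; [apply cexpn_minus_1; lra|].
      assert (H3 := HwB j Hj'); fold (u j) in H3.
      apply Rmult_le_compat; try lra.
      assert (H4 := Cmod_ge_0 (u j)); lra.
    assert (H3 := Cmod_ge_0 (gam j)).
    rewrite (Rmult_comm (2 * B / INR m)).
    apply Rmult_le_compat; [|apply Cmod_ge_0| |exact H2].
      apply Rmult_le_pos; [exact H3 | left; apply exp_pos].
    rewrite <- (Rmult_1_r (Cmod (gam j))) at 2; apply Rmult_le_compat_l; assumption.
  unfold gam.
  replace (ln (INR m)) with (ln (INR N) + (ln (INR m) - ln (INR N))) at 3 by ring.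
  replace x with (ln (INR N) + (ln (INR m) - ln (INR N)) + (x - ln (INR m))) at 2 by ring.
  rewrite !cexpn_add; ring.
apply Rle_trans with ((2 * B / INR m * rsum (fun j => Cmod (gam j)) (seq 1 n)) ^ 2).
  apply pow_incr; split; [apply Cmod_ge_0 | exact H].
rewrite Rpow_mult_distr.
replace ((2 * B / INR m) ^ 2) with (4 * B ^ 2 / INR m ^ 2) by (field; lra).
apply Rmult_le_compat_l; [|apply sample_sum_sqr].
apply Rmult_le_pos; [nra | left; apply Rinv_0_lt_compat; nra].
Qed.

Lemma sample_S_ge0 : 0 <= S.
Proof.
eapply Rle_trans; [|exact HS]; apply rsum_ge0_in; intros j Hj.
left; apply sample_weight, Hj.
Qed.

(** The mean value theorem gives the integral as the block length times |G(c)|^2. Passing from c to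
    the left end doubles the square and adds an error of order m^(-3) after multiplication by the
    length. *)
Lemma sample_block m : (N <= m)%nat ->
  Re (hgram L (ln (INR m))) - Re (hgram L (ln (INR (Datatypes.S m)))) <=
  2 * (/ INR m * Cmod (expsum L (ln (INR m))) ^ 2)
  + 8 * B ^ 2 * (Q * S) * (/ (INR m - 1) - / INR m).
Proof.
intros Hm; assert (Hm0 : 2 <= INR m) by (apply (le_INR 2); lia).
destruct (ln_succ_bounds m ltac:(lia)) as [Hln1 Hln].
assert (HL : in_half L) by (apply in_half_to_half, in_disc_weighted_nodes, Hw).
set (x := ln (INR m)) in *; set (y := ln (INR (Datatypes.S m))) in *.
assert (Hxy : x < y).
  assert (0 < / INR (Datatypes.S m)) by (apply Rinv_0_lt_compat, lt_0_INR; lia); lra.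
destruct (MVT_gen (fun x => Re (hgram L x)) x y (fun x => - Cmod (expsum L x) ^ 2))
  as [c [Hc Ec]].
  intros; apply is_derive_hgram, HL.
  intros t _; apply derivable_continuous_pt.
  exists (- Cmod (expsum L t) ^ 2); apply is_derive_Reals, is_derive_hgram, HL.
rewrite Rmin_left, Rmax_right in Hc by lra; cbv beta in Ec.
assert (Hinc := sample_increment m c Hm Hc); fold x in Hinc.
assert (Hsq : Cmod (expsum L c) ^ 2 <= 2 * Cmod (expsum L x) ^ 2
    + 2 * (4 * B ^ 2 / INR m ^ 2 * (Q * S))).
  assert (H := Cmod_plus_sqr_le 1 (expsum L x) (expsum L c - expsum L x) Rlt_0_1).
  replace (expsum L x + (expsum L c - expsum L x))%C with (expsum L c) in H by ring.
  rewrite Rinv_1 in H; lra.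
assert (HQS : 0 <= Q * S) by (apply Rmult_le_pos; [apply sample_Q_ge0 | apply sample_S_ge0]).
assert (Hi : 0 < / INR m) by (apply Rinv_0_lt_compat; lra).
assert (HX : 0 <= Cmod (expsum L c) ^ 2) by apply pow2_ge_0.
apply Rle_trans with (/ INR m * Cmod (expsum L c) ^ 2).
  replace (Re (hgram L x) - Re (hgram L y)) with ((y - x) * Cmod (expsum L c) ^ 2) by lra.
  apply Rmult_le_compat_r; assumption.
apply Rle_trans with (/ INR m * (2 * Cmod (expsum L x) ^ 2
    + 2 * (4 * B ^ 2 / INR m ^ 2 * (Q * S)))).
  apply Rmult_le_compat_l; lra.
(* The cubic decay is traded for a telescoping difference. *)
assert (Hcub : / INR m * / INR m ^ 2 <= / (INR m - 1) - / INR m).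
  replace (/ (INR m - 1) - / INR m) with (/ INR m * / (INR m - 1)) by (field; lra).
  apply Rmult_le_compat_l; [lra|]; apply Rinv_le_contravar; nra.
assert (H8 : 0 <= 8 * B ^ 2 * (Q * S)) by (apply Rmult_le_pos; [nra | exact HQS]).
replace (/ INR m * (2 * Cmod (expsum L x) ^ 2 + 2 * (4 * B ^ 2 / INR m ^ 2 * (Q * S)))) with
  (2 * (/ INR m * Cmod (expsum L x) ^ 2) + 8 * B ^ 2 * (Q * S) * (/ INR m * / INR m ^ 2))
  by (field; lra).
apply Rplus_le_compat_l, Rmult_le_compat_l; assumption.
Qed.

Lemma sample_blocks len :
  Re (hgram L (ln (INR N))) - Re (hgram L (ln (INR (N + len)))) <=
  2 * rsum (fun k => / INR k * Cmod (expsum L (ln (INR k))) ^ 2) (seq N len)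
  + 8 * B ^ 2 * (Q * S) * (/ (INR N - 1) - / (INR (N + len) - 1)).
Proof.
induction len as [|len IH].
  rewrite Nat.add_0_r; simpl; lra.
rewrite seq_S, rsum_app; simpl (rsum _ (_ :: nil)).
assert (H := sample_block (N + len) ltac:(lia)).
replace (N + Datatypes.S len)%nat with (Datatypes.S (N + len)) by lia.
replace (INR (Datatypes.S (N + len)) - 1) with (INR (N + len)) by (rewrite S_INR; ring).
lra.
Qed.

(** The integral beyond log N is twice a Gram sum on the disc with coefficients gam_j / (1 + u_j).
    The Riesz bound applies to it, and |1 + u_j| <= 1 + B. *)
Lemma sample_energy : 2 / (M ^ 2 * (1 + B) ^ 2) * Q <= Re (hgram L (ln (INR N))).
Proof.
unfold L; rewrite hgram_weighted_nodes by exact Hw.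
set (b' := fun j : nat => _).
assert (H := HR b').
assert (HM2 : 0 < M ^ 2) by nra; assert (HB2 : 0 < (1 + B) ^ 2) by nra.
assert (H1 : / (1 + B) ^ 2 * Q <= rsum (fun j => Cmod (b' j) ^ 2 / (1 - Cmod (w j) ^ 2)) (seq 1 n)).
  unfold Q; rewrite <- rsum_scal; apply rsum_le_in; intros j Hj.
  assert (Hh := sample_weight j Hj); apply in_seq in Hj.
  assert (Hj' : (1 <= j <= n)%nat) by lia.
  unfold Rdiv; rewrite <- Rmult_assoc; apply Rmult_le_compat_r.
    left; apply Rinv_0_lt_compat, Hh.
  assert (N1 := add_cayley_neq0 1 _ Rle_0_1 (Hw j Hj')).
  assert (P1 := Cmod_add_cayley_le 1 B _ Rle_0_1 (HwB j Hj')).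
  unfold b'; fold (u j) in *; fold (gam j).
  rewrite Cmod_div by exact N1.
  unfold Rdiv; rewrite Rpow_mult_distr, Rmult_comm, <- pow_inv.
  apply Rmult_le_compat_l; [apply pow2_ge_0|].
  apply Cmod_gt_0 in N1.
  apply pow_incr; split; [left; apply Rinv_0_lt_compat; lra|].
  apply Rinv_le_contravar; assumption.
replace (2 / (M ^ 2 * (1 + B) ^ 2) * Q) with (2 * (/ M ^ 2 * (/ (1 + B) ^ 2 * Q))) by (field; lra).
apply Rmult_le_compat_l; [lra|].
apply Rmult_le_reg_l with (M ^ 2); [exact HM2|].
rewrite <- Rmult_assoc, Rinv_r, Rmult_1_l by lra; lra.
Qed.

(** |gam_j|^2 = |b_j|^2 N^(-2 Re u_j) and Re u_j <= B, so only a power of N is lost. *)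
Lemma sample_Q_lower :
  Rpower (INR N) (- (2 * B)) * rsum (fun j => Cmod (b j) ^ 2 / (1 - Cmod (w j) ^ 2)) (seq 1 n)
  <= Q.
Proof.
unfold Q; rewrite <- rsum_scal; apply rsum_le_in; intros j Hj.
assert (Hh := sample_weight j Hj); apply in_seq in Hj.
assert (Hj' : (1 <= j <= n)%nat) by lia.
unfold Rdiv; rewrite <- Rmult_assoc; apply Rmult_le_compat_r.
  left; apply Rinv_0_lt_compat, Hh.
unfold gam; rewrite Cmod_mult, Rpow_mult_distr, Rmult_comm.
apply Rmult_le_compat_l; [apply pow2_ge_0|].
rewrite Cmod_cexpn; set (e := - Re (u j) * ln (INR N)).
replace (exp e ^ 2) with (exp (e + e)) by (rewrite exp_plus; ring); unfold Rpower.
assert (Hln := ln_INR_ge0 N ltac:(lia)).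
assert (HuB : Re (u j) <= B).
  eapply Rle_trans; [apply Rle_abs|]; eapply Rle_trans; [apply re_le_Cmod|]; apply HwB, Hj'.
assert (H : - (2 * B) * ln (INR N) <= e + e) by (unfold e; nra).
destruct H as [H | H]; [left; apply exp_increasing; exact H | rewrite H; lra].
Qed.

(** With t = 1/(M^2 (1+B)^2) the integral beyond log N is at least 2 t Q. The remainder beyond log
    2^k and the sampling error take at most t Q / 2 each, and the samples are counted twice in the
    block estimates, which leaves t Q / 2. *)
Lemma sampled_lower_bound : (exists j, (1 <= j <= n)%nat /\ b j <> 0) ->
  exists len, / 2 / (M ^ 2 * (1 + B) ^ 2) * (Rpower (INR N) (- (2 * B)) *
      rsum (fun j => Cmod (b j) ^ 2 / (1 - Cmod (w j) ^ 2)) (seq 1 n))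
    <= rsum (fun k => / INR k * Cmod (expsum L (ln (INR k))) ^ 2) (seq N len).
Proof.
intros [j0 [Hj0 Hb0]].
(* Strict positivity lets a finite window suffice: the remainder tends to 0 and so falls below t Q /
   2. *)
assert (HQ : 0 < Q).
  apply Rlt_le_trans with (Cmod (gam j0) ^ 2 / (1 - Cmod (w j0) ^ 2)).
    apply Rdiv_lt_0_compat; [|apply sample_weight, in_seq; lia].
    apply pow_lt; unfold gam; rewrite Cmod_mult, Cmod_cexpn.
    apply Rmult_lt_0_compat; [apply Cmod_gt_0, Hb0 | apply exp_pos].
  apply (rsum_term_le (fun j => Cmod (gam j) ^ 2 / (1 - Cmod (w j) ^ 2))).
    intros j Hj; apply Rmult_le_pos; [apply pow2_ge_0|].
    left; apply Rinv_0_lt_compat, sample_weight, Hj.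
  apply in_seq; lia.
assert (HN1 : 1 <= INR N - 1).
  assert (2 <= INR N) by (apply (le_INR 2); exact HN); lra.
set (t := / (M ^ 2 * (1 + B) ^ 2)).
assert (HMB : 0 < M ^ 2 * (1 + B) ^ 2) by (apply Rmult_lt_0_compat; nra).
assert (Ht : 0 < t) by (apply Rinv_0_lt_compat, HMB).
assert (He : 0 < / 2 * t * Q) by (repeat apply Rmult_lt_0_compat; lra).
assert (Hlim := hgram_vanishes (weighted_nodes b w n) (in_disc_weighted_nodes b w n Hw)); fold L in Hlim.
apply is_lim_seq_spec in Hlim; destruct (Hlim (mkposreal _ He)) as [K HK]; simpl in HK.
set (k := Nat.max K N); assert (Hk := HK k ltac:(lia)); rewrite Rminus_0_r in Hk.
apply Rabs_def2 in Hk; destruct Hk as [Hk _].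
assert (HkN : (N <= 2 ^ k)%nat).
  assert (H := Nat.pow_gt_lin_r 2 k ltac:(lia)); lia.
exists (2 ^ k - N)%nat.
assert (Hbl := sample_blocks (2 ^ k - N)).
replace (N + (2 ^ k - N))%nat with (2 ^ k)%nat in Hbl by lia.
set (R0 := rsum _ (seq N _)) in *.
assert (Hen := sample_energy).
replace (2 / (M ^ 2 * (1 + B) ^ 2)) with (2 * t) in Hen by (unfold t; field; nra).
assert (HQl := sample_Q_lower).
set (q0 := Rpower _ _ * _) in *.
assert (HQS : 0 <= Q * S) by (apply Rmult_le_pos; [lra | apply sample_S_ge0]).
assert (H8 : 0 <= 8 * B ^ 2 * (Q * S)) by (apply Rmult_le_pos; [nra | exact HQS]).
assert (HkN2 : INR N <= INR (2 ^ k)) by (apply le_INR, HkN).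
assert (Hi2 : 0 < / (INR (2 ^ k) - 1)) by (apply Rinv_0_lt_compat; lra).
assert (Herr : 8 * B ^ 2 * (Q * S) * / (INR N - 1) <= / 2 * t * Q).
  apply Rmult_le_reg_r with (INR N - 1); [lra|].
  rewrite Rmult_assoc, Rinv_l, Rmult_1_r by lra.
  apply Rmult_le_reg_l with (2 * (M ^ 2 * (1 + B) ^ 2)); [lra|].
  replace (2 * (M ^ 2 * (1 + B) ^ 2) * (/ 2 * t * Q * (INR N - 1))) with (Q * (INR N - 1))
    by (unfold t; field; nra).
  replace (2 * (M ^ 2 * (1 + B) ^ 2) * (8 * B ^ 2 * (Q * S))) with
    (Q * (16 * B ^ 2 * S * M ^ 2 * (1 + B) ^ 2)) by ring.
  apply Rmult_le_compat_l; lra.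
assert (Hmain : 2 * t * Q - / 2 * t * Q <= 2 * R0 + / 2 * t * Q).
  rewrite Rmult_minus_distr_l in Hbl.
  assert (0 <= 8 * B ^ 2 * (Q * S) * / (INR (2 ^ k) - 1)) by (apply Rmult_le_pos; lra).
  lra.
replace (/ 2 / (M ^ 2 * (1 + B) ^ 2)) with (/ 2 * t) by (unfold t; field; nra).
apply Rle_trans with (/ 2 * t * Q); [|lra].
apply Rmult_le_compat_l; lra.
Qed.

End SampledBound.

(** * Interpolation and Carleson constants *)

(** Gaussian elimination: the last equation is solved for an unknown j0 with nonzero coefficient and
    substituted into the others; if it has no such coefficient it holds for every b. *)
Lemma homogeneous_solution m : forall (J : list nat) (A : nat -> nat -> C),
  NoDup J -> (m < length J)%nat ->
  exists b : nat -> C, (exists j, In j J /\ b j <> 0) /\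
    forall k, (k < m)%nat -> csum (fun j => b j * A k j)%C J = 0.
Proof.
induction m as [|m IH]; intros J A Hnd Hlen.
  destruct J as [|j J]; [simpl in Hlen; lia|].
  exists (fun _ => RtoC 1); split; [|intros k Hk; lia].
  exists j; split; [left; reflexivity|].
  apply RtoC_neq0; lra.
destruct (classic (exists j, In j J /\ A m j <> 0)) as [[j0 [Hj0 HA]] | Hno].
2:{ destruct (IH J A Hnd ltac:(lia)) as [b [Hb1 Hb2]]; exists b; split; [exact Hb1|].
    intros k Hk; destruct (Nat.eq_dec k m) as [-> | Hkm]; [|apply Hb2; lia].
    rewrite (csum_ext_in _ (fun _ => RtoC 0)), csum_0; [reflexivity|].
    intros j Hj; assert (E : A m j = 0); [|rewrite E; ring].
    apply NNPP; intros HA; apply Hno; exists j; auto. }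
destruct (in_split j0 J Hj0) as [J1 [J2 EJ]]; subst J.
apply NoDup_remove in Hnd; destruct Hnd as [Hnd Hnin].
rewrite length_app in Hlen; simpl in Hlen.
destruct (IH (J1 ++ J2) (fun k j => A k j - A k j0 * A m j / A m j0)%C Hnd) as [b [[j1 [Hj1 Hb1]] Hb2]].
  rewrite length_app; lia.
set (s := csum (fun j => b j * A m j)%C (J1 ++ J2)).
set (b' j := if Nat.eq_dec j j0 then (- s / A m j0)%C else b j).
assert (Eb' : forall j, In j (J1 ++ J2) -> b' j = b j).
  intros j Hj; unfold b'; destruct (Nat.eq_dec j j0) as [-> |]; [contradiction | reflexivity].
assert (Eb0 : b' j0 = (- s / A m j0)%C).
  unfold b'; destruct (Nat.eq_dec j0 j0); [reflexivity | contradiction].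
assert (Esum : forall k, csum (fun j => b' j * A k j)%C (J1 ++ j0 :: J2) =
    (csum (fun j => b j * A k j) (J1 ++ J2) - s / A m j0 * A k j0)%C).
  intros k; rewrite !csum_app; simpl; rewrite Eb0.
  rewrite (csum_ext_in (fun j => b' j * A k j)%C (fun j => b j * A k j)%C J1),
    (csum_ext_in (fun j => b' j * A k j)%C (fun j => b j * A k j)%C J2).
    unfold Cdiv; ring.
  intros j Hj; rewrite Eb'; [reflexivity | apply in_or_app; right; exact Hj].
  intros j Hj; rewrite Eb'; [reflexivity | apply in_or_app; left; exact Hj].
exists b'; split.
  exists j1; split; [|rewrite Eb'; assumption].
  apply in_or_app; apply in_app_or in Hj1; simpl; tauto.
intros k Hk; rewrite Esum.
destruct (Nat.eq_dec k m) as [-> | Hkm]; [fold s; field; exact HA|].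
specialize (Hb2 k ltac:(lia)).
rewrite (csum_ext _ (fun j => b j * A k j - A k j0 / A m j0 * (b j * A m j))%C) in Hb2.
  rewrite csum_minus, csum_scal in Hb2; fold s in Hb2; rewrite <- Hb2; field; exact HA.
intros j; field; exact HA.
Qed.

Lemma sum_n_m_rsum (f : nat -> R) n : sum_n_m f 1 n = rsum f (seq 1 n).
Proof.
induction n as [|n IH].
  rewrite sum_n_m_zero by lia; reflexivity.
rewrite sum_n_Sm, IH, seq_S, rsum_app by lia; simpl; unfold plus; simpl; ring.
Qed.

Definition interpolates (n : nat) (w : nat -> C) (M : R) : Prop :=
  forall a : nat -> C, exists f : HardyH2,
    (forall j, (1 <= j <= n)%nat -> hardy_eval f (w j) = a j) /\
    norm f <= M * sqrt (sum_n_m (fun j => Cmod (a j) ^ 2 * (1 - Cmod (w j) ^ 2)) 1 n).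

Lemma functional_weighted_nodes h b w n :
  functional h (weighted_nodes b w n) = csum (fun j => b j * h (w j))%C (seq 1 n).
Proof. unfold functional, weighted_nodes; rewrite csum_map; reflexivity. Qed.

Lemma node_weight_pos n (w : nat -> C) j : (forall j, (1 <= j <= n)%nat -> Cmod (w j) < 1) ->
  In j (seq 1 n) -> 0 < 1 - Cmod (w j) ^ 2.
Proof.
intros Hw Hj; apply in_seq in Hj; assert (H := Hw j ltac:(lia)).
assert (H0 := Cmod_ge_0 (w j)); nra.
Qed.

(** Interpolating the values conj(b_j) / (1 - |w_j|^2) makes the functional equal to T itself, while
    its norm gives T <= M sqrt(T) sqrt(G). *)
Lemma interpolates_riesz n (w : nat -> C) M :
  (forall j, (1 <= j <= n)%nat -> Cmod (w j) < 1) -> interpolates n w M ->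
  riesz_bound n w M.
Proof.
intros Hw HM b; set (T := rsum _ _); set (G := Re _).
destruct (HM (fun j => Cconj (b j) / RtoC (1 - Cmod (w j) ^ 2))%C) as [f [Hf1 Hf2]].
assert (Hl := in_disc_weighted_nodes b w n Hw).
assert (HG : 0 <= G) by apply gram_ge0, Hl.
assert (HT : 0 <= T).
  apply rsum_ge0_in; intros j Hj; apply Rmult_le_pos; [apply pow2_ge_0|].
  left; apply Rinv_0_lt_compat, (node_weight_pos n w j Hw Hj).
rewrite sum_n_m_rsum, (rsum_ext_in _ (fun j => Cmod (b j) ^ 2 / (1 - Cmod (w j) ^ 2))) in Hf2.
2:{ intros j Hj; assert (H := node_weight_pos n w j Hw Hj).
    rewrite Cmod_div, Cmod_conj, Cmod_R, Rabs_pos_eq by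
      (try apply RtoC_neq0; lra).
    field; lra. }
fold T in Hf2; change (norm f) with (ell2_norm f) in Hf2.
assert (H := comb_bound f _ Hl); fold G in H.
change (csum _ (weighted_nodes b w n)) with (functional (hardy_eval f) (weighted_nodes b w n)) in H.
rewrite functional_weighted_nodes in H.
replace (csum _ (seq 1 n)) with (RtoC T) in H.
2:{ unfold T; rewrite RtoC_rsum; apply csum_ext_in; intros j Hj.
    assert (Hj' := Hj); apply in_seq in Hj'; rewrite Hf1 by lia.
    assert (H0 := node_weight_pos n w j Hw Hj).
    rewrite RtoC_div, Cmod_sqr_mult_conj by lra; unfold Cdiv; ring. }
rewrite Cmod_R, Rabs_pos_eq in H by exact HT.
assert (H1 : T <= M * sqrt T * sqrt G).
  eapply Rle_trans; [exact H|]; apply Rmult_le_compat_r; [apply sqrt_pos | exact Hf2].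
destruct (Req_dec T 0) as [E | N].
  rewrite E; apply Rmult_le_pos; [apply pow2_ge_0 | exact HG].
assert (HsT : 0 < sqrt T) by (apply sqrt_lt_R0; lra).
assert (H2 : sqrt T <= M * sqrt G).
  apply Rmult_le_reg_r with (sqrt T); [exact HsT|].
  rewrite sqrt_sqrt by exact HT; lra.
rewrite <- (pow2_sqrt T) by exact HT; rewrite <- (pow2_sqrt G) by exact HG.
rewrite <- Rpow_mult_distr; apply pow_incr; lra.
Qed.

Lemma shift_exists (f : ell2) : exists g : ell2,
  forall w, Cmod w < 1 -> hardy_eval g w = (w * hardy_eval f w)%C.
Proof.
set (x m := match m with O => RtoC 0 | S k => coef f k end).
destruct (ell2_make x (ell2_norm f) (ell2_norm_ge0 f)) as [g [Hg _]].
  intros [|m].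
    simpl; rewrite Rmult_1_r; apply Rmult_le_pos; apply ell2_norm_ge0.
  eapply Rle_trans; [|apply (ell2_partial f m)].
  simpl seq; cbn [rsum fold_right]; rewrite <- seq_shift.
  change (fold_right _ 0 (map S (seq 0 m))) with
    (rsum (fun k => Cmod (x k) ^ 2) (map S (seq 0 m))).
  rewrite rsum_map; unfold x at 1; rewrite Cmod_0; simpl; lra.
exists g; intros w Hw.
refine (climit_unique _ _ _ (hardy_series g w Hw) _).
apply (is_lim_seq_incr_1 (fun m => Cmod (csum (fun k => g k * w ^ k) (seq 0 m)
  - w * hardy_eval f w)%C)).
apply (climit_ext (fun m => w * csum (fun k => f k * w ^ k) (seq 0 m))%C
  (fun m => csum (fun k => g k * w ^ k) (seq 0 (S m)))%C).
  intros m; rewrite csum_seq_S_l, <- seq_shift, csum_map, <- csum_scal, Hg; simpl x.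
  rewrite Cmult_0_l, Cplus_0_l; apply csum_ext; intros k; rewrite Hg; simpl; ring.
apply climit_scal, hardy_series, Hw.
Qed.

Lemma hardy_eval_delta0 : exists e : ell2, ell2_norm e <= 1 /\
  forall w, Cmod w < 1 -> hardy_eval e w = 1.
Proof.
destruct (ell2_make (delta_seq 0) 1 Rle_0_1) as [e [He Hn]].
  intros [|m]; [simpl; lra|].
  simpl seq; cbn [rsum fold_right]; rewrite <- seq_shift.
  change (fold_right _ 0 (map S (seq 0 m))) with
    (rsum (fun k => Cmod (delta_seq 0 k) ^ 2) (map S (seq 0 m))).
  rewrite rsum_map; unfold delta_seq; simpl Nat.eqb; cbv iota.
  rewrite Cmod_1, Cmod_0, rsum_const; lra.
exists e; split; [exact Hn|]; intros w Hw; apply cseries_CSeries.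
apply (cseries_ext (fun k => w ^ k * delta_seq 0 k)%C).
  intros k; rewrite He; ring.
apply (cseries_delta (fun k => w ^ k)%C 0).
Qed.

Lemma separating_function (w : C) (ws : list C) : Cmod w < 1 ->
  (forall v, In v ws -> Cmod v < 1) -> ~ In w ws ->
  exists f : ell2, hardy_eval f w = 1 /\ forall v, In v ws -> hardy_eval f v = 0.
Proof.
intros Hw; induction ws as [|v ws IH]; intros Hws Hnin.
  destruct hardy_eval_delta0 as [e [_ He]]; exists e; split; [apply He, Hw | intros v []].
destruct IH as [f [Hf1 Hf2]].
  intros v' Hv'; apply Hws; right; exact Hv'.
  intros H; apply Hnin; right; exact H.
destruct (shift_exists f) as [g Hg].
assert (Hv : Cmod v < 1) by (apply Hws; left; reflexivity).
assert (Hwv : (w - v)%C <> 0) by (apply Cminus_neq0; intros E; apply Hnin; left; auto).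
exists (ell2_scal (/ (w - v))%C (ell2_plus g (ell2_scal (- v)%C f))).
assert (Hev : forall z, Cmod z < 1 -> hardy_eval (ell2_scal (/ (w - v))%C
    (ell2_plus g (ell2_scal (- v)%C f))) z = (/ (w - v) * ((z - v) * hardy_eval f z))%C).
  intros z Hz; rewrite hardy_eval_scal, hardy_eval_plus, hardy_eval_scal, Hg by exact Hz; ring.
split; [rewrite Hev, Hf1 by exact Hw; field; exact Hwv|].
intros v' [<- | Hv']; rewrite Hev by (apply Hws; simpl; auto); [ring|].
rewrite Hf2 by exact Hv'; ring.
Qed.

(** Lagrange interpolation. It makes [interpolation_constant] the infimum of a nonempty set rather
    than the default value 0. *)
Lemma interpolates_exists n (w : nat -> C) :
  (forall j, (1 <= j <= n)%nat -> Cmod (w j) < 1) -> distinct_points n w ->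
  exists M, interpolates n w M.
Proof.
intros Hw Hd.
assert (Hsep : forall j, { f : ell2 | (1 <= j <= n)%nat ->
    forall i, (1 <= i <= n)%nat -> hardy_eval f (w i) = if Nat.eq_dec i j then 1 else 0 }).
  intros j; apply constructive_indefinite_description.
  destruct (classic (1 <= j <= n)%nat) as [Hj | Hj]; [|exists ell2_zero; intros; contradiction].
  destruct (separating_function (w j)
    (map w (filter (fun i => negb (Nat.eqb i j)) (seq 1 n)))) as [f [Hf1 Hf2]].
  - apply Hw, Hj.
  - intros v Hv; apply in_map_iff in Hv; destruct Hv as [i [<- Hi]].
    apply filter_In in Hi; destruct Hi as [Hi _]; apply in_seq in Hi; apply Hw; lia.
  - intros Hin; apply in_map_iff in Hin; destruct Hin as [i [E Hi]].
    apply filter_In in Hi; destruct Hi as [Hi Hne]; apply in_seq in Hi.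
    apply Hd in E; [|lia|lia]; subst i; rewrite Nat.eqb_refl in Hne; discriminate.
  - exists f; intros _ i Hi; destruct (Nat.eq_dec i j) as [-> | Hij]; [exact Hf1|].
    apply Hf2, in_map, filter_In; split; [apply in_seq; lia|].
    apply Nat.eqb_neq in Hij; rewrite Hij; reflexivity.
set (f j := proj1_sig (Hsep j)).
assert (Hf : forall j, (1 <= j <= n)%nat -> forall i, (1 <= i <= n)%nat ->
    hardy_eval (f j) (w i) = if Nat.eq_dec i j then 1 else 0).
  intros j; exact (proj2_sig (Hsep j)).
exists (rsum (fun j => ell2_norm (f j) / sqrt (1 - Cmod (w j) ^ 2)) (seq 1 n)); intros a.
set (T := sum_n_m _ 1 n).
assert (ET : T = rsum (fun j => Cmod (a j) ^ 2 * (1 - Cmod (w j) ^ 2)) (seq 1 n))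
  by apply sum_n_m_rsum.
assert (Hterm : forall j, In j (seq 1 n) -> Cmod (a j) * sqrt (1 - Cmod (w j) ^ 2) <= sqrt T).
  intros j Hj; assert (H := node_weight_pos n w j Hw Hj).
  rewrite <- (sqrt_pow2 (Cmod (a j))) by apply Cmod_ge_0.
  rewrite <- sqrt_mult by (try apply pow2_ge_0; lra).
  apply sqrt_le_1_alt; rewrite ET.
  apply (rsum_term_le (fun j => Cmod (a j) ^ 2 * (1 - Cmod (w j) ^ 2))); [|exact Hj].
  intros i Hi; apply Rmult_le_pos; [apply pow2_ge_0|].
  left; apply (node_weight_pos n w i Hw Hi).
assert (Hcomb : forall J, (forall j, In j J -> In j (seq 1 n)) -> exists g : ell2,
    (forall z, Cmod z < 1 -> hardy_eval g z = csum (fun j => a j * hardy_eval (f j) z)%C J) /\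
    ell2_norm g <= rsum (fun j => ell2_norm (f j) / sqrt (1 - Cmod (w j) ^ 2)) J * sqrt T).
  induction J as [|j J IH]; intros HJ.
    exists (ell2_scal 0%C ell2_zero); split.
      intros z Hz; rewrite hardy_eval_scal by exact Hz; simpl; ring.
    rewrite ell2_norm_scal, Cmod_0; simpl; lra.
  destruct IH as [g [Hg1 Hg2]]; [intros i Hi; apply HJ; right; exact Hi|].
  assert (Hj := HJ j (or_introl eq_refl)).
  exists (ell2_plus (ell2_scal (a j) (f j)) g); split.
    intros z Hz; rewrite hardy_eval_plus, hardy_eval_scal, Hg1 by exact Hz; reflexivity.
  eapply Rle_trans; [apply ell2_norm_triangle|]; rewrite ell2_norm_scal.
  change (rsum _ (j :: J)) with (ell2_norm (f j) / sqrt (1 - Cmod (w j) ^ 2)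
    + rsum (fun j => ell2_norm (f j) / sqrt (1 - Cmod (w j) ^ 2)) J).
  rewrite Rmult_plus_distr_r; apply Rplus_le_compat; [|exact Hg2].
  assert (Hs := sqrt_lt_R0 _ (node_weight_pos n w j Hw Hj)).
  apply Rmult_le_reg_r with (sqrt (1 - Cmod (w j) ^ 2)); [exact Hs|].
  replace (ell2_norm (f j) / sqrt (1 - Cmod (w j) ^ 2) * sqrt T * sqrt (1 - Cmod (w j) ^ 2))
    with (ell2_norm (f j) * sqrt T) by (field; lra).
  assert (H := Hterm j Hj); assert (H0 := ell2_norm_ge0 (f j)); nra.
destruct (Hcomb (seq 1 n) (fun j Hj => Hj)) as [g [Hg1 Hg2]].
exists g; split; [|exact Hg2].
intros i Hi; rewrite Hg1 by (apply Hw, Hi).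
rewrite (csum_ext_in _ (fun j => a j * delta_seq i j)%C).
  assert (E : forall m s, csum (fun j => a j * delta_seq i j)%C (seq s m) =
      if (Nat.leb s i && Nat.ltb i (s + m))%bool then a i else 0).
    induction m as [|m IH]; intros s.
      simpl; destruct (Nat.leb_spec s i), (Nat.ltb_spec i (s + 0)); simpl; auto; lia.
    change (csum _ (seq s (S m))) with (a s * delta_seq i s
      + csum (fun j => a j * delta_seq i j) (seq (S s) m))%C.
    rewrite IH; unfold delta_seq.
    destruct (Nat.eqb_spec s i), (Nat.leb_spec (S s) i), (Nat.leb_spec s i),
      (Nat.ltb_spec i (S s + m)), (Nat.ltb_spec i (s + S m)); simpl; subst; try lia; ring.
  rewrite E; destruct (Nat.leb_spec 1 i), (Nat.ltb_spec i (1 + n)); simpl; auto; lia.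
intros j Hj; apply in_seq in Hj; rewrite Hf by lia; unfold delta_seq.
destruct (Nat.eq_dec i j), (Nat.eqb_spec j i); subst; congruence.
Qed.

Lemma re_gram_point w : Cmod w < 1 -> Re (gram ((RtoC 1, w) :: nil)) = / (1 - Cmod w ^ 2).
Proof.
intros Hw; assert (H0 := Cmod_ge_0 w).
rewrite <- (re_RtoC (/ _)); f_equal.
rewrite RtoC_inv, RtoC_minus, Cmod_sqr_mult_conj by nra.
unfold gram; cbn [csum fold_right fst snd]; rewrite Cconj_1; unfold Cdiv; ring.
Qed.

(** Tested on the value 1 at the first node and 0 at the others: |f(w_1)| is at most the norm of f
    divided by sqrt(1 - |w_1|^2). *)
Lemma interpolates_ge1 n (w : nat -> C) M : (1 <= n)%nat ->
  (forall j, (1 <= j <= n)%nat -> Cmod (w j) < 1) -> interpolates n w M -> 1 <= M.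
Proof.
intros Hn Hw HM.
destruct (HM (fun j => if Nat.eq_dec j 1 then RtoC 1 else RtoC 0)) as [f [Hf1 Hf2]].
rewrite sum_n_m_rsum in Hf2; change (norm f) with (ell2_norm f) in Hf2.
set (h := 1 - Cmod (w 1%nat) ^ 2).
assert (Hh : 0 < h) by (apply (node_weight_pos n w 1 Hw); apply in_seq; lia).
replace (rsum _ (seq 1 n)) with h in Hf2.
2:{ destruct n as [|n]; [lia|]; cbn [seq rsum fold_right].
    change (fold_right _ 0 (seq 2 n)) with (rsum (fun j => Cmod (if Nat.eq_dec j 1
      then RtoC 1 else RtoC 0) ^ 2 * (1 - Cmod (w j) ^ 2)) (seq 2 n)).
    rewrite (rsum_ext_in _ (fun _ => 0) (seq 2 n)), rsum_const.
      simpl Nat.eq_dec; cbv iota; rewrite Cmod_1; unfold h; ring.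
    intros j Hj; apply in_seq in Hj; destruct (Nat.eq_dec j 1); [lia|].
    rewrite Cmod_0; ring. }
assert (Hl : in_disc ((RtoC 1, w 1%nat) :: nil)).
  intros p [<- | []]; apply Hw; lia.
assert (H := comb_bound f _ Hl); cbn [csum fold_right fst snd] in H.
assert (E1 : hardy_eval f (w 1%nat) = 1) by (rewrite Hf1 by lia; reflexivity).
rewrite E1 in H.
assert (Eg : Re (gram ((RtoC 1, w 1%nat) :: nil)) = / h).
  apply re_gram_point, Hw; lia.
rewrite Eg in H.
replace (1 * 1 + 0)%C with (RtoC 1) in H by ring; rewrite Cmod_1 in H.
assert (Hs : 0 < sqrt h) by (apply sqrt_lt_R0, Hh).
rewrite sqrt_inv in H.
assert (H1 : sqrt h <= ell2_norm f).
  apply Rmult_le_reg_r with (/ sqrt h); [apply Rinv_0_lt_compat, Hs|].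
  rewrite Rinv_r by lra; exact H.
apply Rmult_le_reg_r with (sqrt h); [exact Hs | lra].
Qed.

Lemma interpolates_twice n (w : nat -> C) : (1 <= n)%nat ->
  (forall j, (1 <= j <= n)%nat -> Cmod (w j) < 1) -> distinct_points n w ->
  1 <= interpolation_constant n w /\ interpolates n w (2 * interpolation_constant n w).
Proof.
intros Hn Hw Hd; set (M := interpolation_constant n w).
assert (Hex := interpolates_exists n w Hw Hd).
assert (Hge := fun M HM => interpolates_ge1 n w M Hn Hw HM).
assert (H1 : 1 <= M) by (apply infimum_ge; assumption).
split; [exact H1|].
destruct (infimum_approx (interpolates n w) 1 (2 * M) Hex Hge) as [x [Hx Hlt]].
  change (M < 2 * M); lra.
intros a; destruct (Hx a) as [f [Hf1 Hf2]]; exists f; split; [exact Hf1|].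
eapply Rle_trans; [exact Hf2|]; apply Rmult_le_compat_r; [apply sqrt_pos | lra].
Qed.

(** For fixed f the inequality is closed in M, so the infimum satisfies it. The constant function 1
    keeps the infimum above 1 - |z_1|^2, and point evaluations show that M = n is admissible. *)
Lemma carleson_bound n (z : nat -> C) : (1 <= n)%nat ->
  (forall j, (1 <= j <= n)%nat -> Cmod (z j) < 1) ->
  0 < carleson_norm n z /\ forall f : ell2,
    rsum (fun j => (1 - Cmod (z j) ^ 2) * Cmod (hardy_eval f (z j)) ^ 2) (seq 1 n)
    <= carleson_norm n z * ell2_norm f ^ 2.
Proof.
intros Hn Hz; set (E := fun M => forall f : HardyH2,
  sum_n_m (fun j => (1 - Cmod (z j) ^ 2) * Cmod (hardy_eval f (z j)) ^ 2) 1 n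
    <= M * norm f ^ 2).
change (carleson_norm n z) with (infimum E).
set (h := 1 - Cmod (z 1%nat) ^ 2).
assert (Hh : 0 < h) by (apply (node_weight_pos n z 1 Hz); apply in_seq; lia).
assert (Hlow : forall M, E M -> h <= M).
  intros M HM; destruct hardy_eval_delta0 as [e [He1 He2]].
  assert (H := HM e); rewrite sum_n_m_rsum in H; change (norm e) with (ell2_norm e) in H.
  assert (H1 : h <= M * ell2_norm e ^ 2).
    eapply Rle_trans; [|exact H].
    replace h with ((1 - Cmod (z 1%nat) ^ 2) * Cmod (hardy_eval e (z 1%nat)) ^ 2).
      apply (rsum_term_le (fun j => (1 - Cmod (z j) ^ 2) * Cmod (hardy_eval e (z j)) ^ 2)).
        intros j Hj; apply Rmult_le_pos; [|apply pow2_ge_0].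
        left; apply (node_weight_pos n z j Hz Hj).
      apply in_seq; lia.
    rewrite He2 by (apply Hz; lia); rewrite Cmod_1; unfold h; ring.
  assert (H2 := ell2_norm_ge0 e).
  assert (H3 : 0 <= ell2_norm e ^ 2 <= 1) by nra.
  revert H1 H3; generalize (ell2_norm e ^ 2); intros t H1 H3.
  destruct (Rle_lt_dec 0 M); nra.
assert (Hex : exists M, E M).
  exists (INR n); intros f; rewrite sum_n_m_rsum; change (norm f) with (ell2_norm f).
  rewrite <- (length_seq n 1) at 2; rewrite <- rsum_const.
  apply rsum_le_in; intros j Hj; assert (Hw := node_weight_pos n z j Hz Hj).
  assert (Hl : in_disc ((RtoC 1, z j) :: nil)).
    intros p [<- | []]; apply in_seq in Hj; apply Hz; lia.
  assert (H := comb_bound f _ Hl); simpl csum in H; cbn [fst snd] in H.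
  replace (1 * hardy_eval f (z j) + 0)%C with (hardy_eval f (z j)) in H by ring.
  assert (Eg : Re (gram ((RtoC 1, z j) :: nil)) = / (1 - Cmod (z j) ^ 2)).
    apply re_gram_point; apply in_seq in Hj; apply Hz; lia.
  rewrite Eg, sqrt_inv in H.
  apply Rle_trans with ((1 - Cmod (z j) ^ 2) * (ell2_norm f * / sqrt (1 - Cmod (z j) ^ 2)) ^ 2).
    apply Rmult_le_compat_l; [lra|]; apply pow_incr; split; [apply Cmod_ge_0 | exact H].
  assert (Hs := sqrt_lt_R0 _ Hw).
  rewrite Rpow_mult_distr, pow_inv, pow2_sqrt by lra; right; field; lra.
assert (Hinf : h <= infimum E) by (apply infimum_ge; assumption).
split; [lra|]; intros f.
rewrite <- sum_n_m_rsum; apply Rnot_lt_le; intros Hlt.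
assert (Hf0 := ell2_norm_ge0 f).
destruct (Req_dec (ell2_norm f) 0) as [E0 | N0].
  destruct Hex as [M HM]; assert (H := HM f); change (norm f) with (ell2_norm f) in H.
  rewrite E0, pow_ne_zero, Rmult_0_r in H, Hlt by lia; lra.
assert (Hf2 : 0 < ell2_norm f ^ 2) by nra.
set (s := sum_n_m _ 1 n) in *.
destruct (infimum_approx E h (s / ell2_norm f ^ 2) Hex Hlow) as [x [Hx Hlt2]].
  apply Rmult_lt_reg_r with (ell2_norm f ^ 2); [exact Hf2|].
  unfold Rdiv; rewrite Rmult_assoc, Rinv_l, Rmult_1_r by lra; exact Hlt.
assert (H := Hx f); change (norm f) with (ell2_norm f) in H; fold s in H.
apply (Rmult_lt_compat_r (ell2_norm f ^ 2)) in Hlt2; [|exact Hf2].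
unfold Rdiv in Hlt2; rewrite Rmult_assoc, Rinv_l, Rmult_1_r in Hlt2 by lra; lra.
Qed.

(** * Lower bounds for approximation numbers *)

Definition node_mass (n : nat) (b w : nat -> C) : R :=
  rsum (fun j => Cmod (b j) ^ 2 / (1 - Cmod (w j) ^ 2)) (seq 1 n).

(** Index m stands for the frequency m + 1, as in [dirichlet_eval]; the samples from N on start at P
    = N - 1. *)
Definition sample_energy_sum (n : nat) (b w : nat -> C) (P len : nat) : R :=
  rsum (fun m => / INR (S m) *
    Cmod (expsum (to_half (weighted_nodes b w n)) (ln (INR (S m)))) ^ 2) (seq P len).

Lemma sampled_interpolation_bound (B : R) : 0 < B ->
  exists c A, 0 < c /\ 0 < A /\ forall n (w b : nat -> C), (1 <= n)%nat ->
    (forall j, (1 <= j <= n)%nat -> Cmod (w j) < 1) ->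
    (forall j, (1 <= j <= n)%nat -> Cmod (cayley (w j)) <= B) ->
    distinct_points n w -> (exists j, (1 <= j <= n)%nat /\ b j <> 0) ->
    exists P len, (c * Rpower (interpolation_constant n w) (- A)) ^ 2 * node_mass n b w
      <= sample_energy_sum n b w P len.
Proof.
intros HB.
set (C1 := ((2 * B + 1) * (B + 1)) ^ 2).
set (C3 := 16 * B ^ 2 * C1 * (1 + B) ^ 2).
assert (HC1 : 0 <= C1) by apply pow2_ge_0.
assert (HC3 : 0 <= C3) by (unfold C3; repeat apply Rmult_le_pos; try lra; apply pow2_ge_0).
set (C2 := 16 * (C3 + 2)).
(* The part of the sampled bound that does not depend on M: the 4 comes from the Riesz constant
   (2M)^2, and [C2] from N <= C2 M^4 inside N^(-2B). *)
set (c1 := / 2 / (1 + B) ^ 2 / 4 * Rpower C2 (- (2 * B))).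
assert (HBB : 0 < (1 + B) ^ 2) by nra.
assert (Hc1 : 0 < c1).
  unfold c1; apply Rmult_lt_0_compat; [|apply exp_pos].
  apply Rdiv_lt_0_compat; [|lra]; apply Rdiv_lt_0_compat; lra.
exists (sqrt c1), (1 + 4 * B).
split; [apply sqrt_lt_R0, Hc1|]; split; [lra|].
intros n w b Hn Hw HwB Hd Hb.
destruct (interpolates_twice n w Hn Hw Hd) as [HM1 HM2].
set (M := interpolation_constant n w) in *.
assert (HR := interpolates_riesz n w (2 * M) Hw HM2).
assert (HS := riesz_mass n w B (2 * M) HB Hw HwB Hd HR); fold C1 in HS.
set (x := C3 * (2 * M) ^ 4).
assert (HM4 : 1 <= (2 * M) ^ 4) by (apply pow_R1_Rle; lra).
assert (Hx : 0 <= x) by (apply Rmult_le_pos; lra).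
destruct (nfloor_ex x Hx) as [N0 [HN1 HN2]].
(* Two more than the integer part of x: then N - 1 > x, as the sampled bound requires, and N >=
   2. *)
set (N := S (S N0)).
assert (HNx : INR N = INR N0 + 2) by (unfold N; rewrite !S_INR; ring).
destruct (sampled_lower_bound n N w b B (2 * M) (C1 * (2 * M) ^ 2) HB ltac:(lra) Hw HwB HR HS
  ltac:(unfold N; lia)) with (2 := Hb) as [len Hlen].
  replace (16 * B ^ 2 * (C1 * (2 * M) ^ 2) * (2 * M) ^ 2 * (1 + B) ^ 2) with x
    by (unfold x, C3; ring); lra.
exists (S N0), len.
assert (Hmass : 0 <= node_mass n b w).
  apply rsum_ge0_in; intros j Hj; apply Rmult_le_pos; [apply pow2_ge_0|].
  left; apply Rinv_0_lt_compat, (node_weight_pos n w j Hw Hj).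
unfold sample_energy_sum.
replace (rsum _ (seq (S N0) len)) with (rsum (fun k => / INR k *
    Cmod (expsum (to_half (weighted_nodes b w n)) (ln (INR k))) ^ 2) (seq N len)).
2:{ unfold N; rewrite <- seq_shift, rsum_map; reflexivity. }
eapply Rle_trans; [|exact Hlen]; fold (node_mass n b w).
rewrite <- Rmult_assoc; apply Rmult_le_compat_r; [exact Hmass|].
rewrite Rpow_mult_distr, pow2_sqrt by lra.
assert (Hpow : Rpower (C2 * M ^ 4) (- (2 * B)) <= Rpower (INR N) (- (2 * B))).
  assert (HN0 : 0 < INR N) by (apply lt_0_INR; unfold N; lia).
  rewrite !Rpower_Ropp; apply Rinv_le_contravar; [apply exp_pos|].
  apply Rle_Rpower_l; [lra|]; split; [exact HN0|].
  rewrite HNx; unfold C2.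
  replace (16 * (C3 + 2) * M ^ 4) with (x + 2 * (2 * M) ^ 4) by (unfold x; ring); lra.
assert (HM0 : 0 < M) by lra.
assert (HM40 : 0 < M ^ 4) by (apply pow_lt, HM0).
assert (E : c1 * Rpower M (- (1 + 4 * B)) ^ 2 =
    / 2 / ((2 * M) ^ 2 * (1 + B) ^ 2) * Rpower (C2 * M ^ 4) (- (2 * B))).
  rewrite <- Rpower_mult_distr;
    [|unfold C2; lra | exact HM40].
  rewrite <- (Rpower_pow 2 (Rpower M _)), Rpower_mult by apply exp_pos.
  rewrite <- (Rpower_pow 4 M), Rpower_mult by exact HM0.
  simpl INR.
  replace (- (1 + 4 * B) * (1 + 1)) with (- (2) + (1 + 1 + 1 + 1) * - (2 * B)) by ring.
  rewrite Rpower_plus, Rpower_Ropp.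
  replace (Rpower M 2) with (M ^ 2).
    unfold c1; field; lra.
  rewrite <- (Rpower_pow 2 M HM0); simpl INR; f_equal.
rewrite E; apply Rmult_le_compat_l; [|exact Hpow].
apply Rmult_le_pos; [lra | left; apply Rinv_0_lt_compat; nra].
Qed.

Definition window (P len : nat) (x : nat -> C) (m : nat) : C :=
  if (Nat.leb P m && Nat.ltb m (P + len))%bool then x m else 0.

Lemma window_in P len x m : In m (seq P len) -> window P len x m = x m.
Proof.
intros H; apply in_seq in H; unfold window.
destruct (Nat.leb_spec P m), (Nat.ltb_spec m (P + len)); simpl; auto; lia.
Qed.

Lemma window_out P len x m : (m < P \/ P + len <= m)%nat -> window P len x m = 0.
Proof.
intros H; unfold window.
destruct (Nat.leb_spec P m), (Nat.ltb_spec m (P + len)); simpl; auto; lia.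
Qed.

Lemma window_ell2 P len x : exists D : ell2, (forall m, coef D m = window P len x m) /\
  ell2_norm D <= sqrt (rsum (fun m => Cmod (x m) ^ 2) (seq P len)).
Proof.
apply ell2_make; [apply sqrt_pos|]; intros K.
rewrite pow2_sqrt by (apply rsum_ge0; intros; apply pow2_ge_0).
eapply Rle_trans; [apply rsum_seq_mono with (m := (P + (len + K))%nat);
  [intros; apply pow2_ge_0 | lia]|].
rewrite !seq_app, !rsum_app, Nat.add_0_l.
rewrite (rsum_ext_in _ (fun _ => 0) (seq 0 P)), (rsum_ext_in _ (fun _ => 0) (seq (P + len) K)),
  (rsum_ext_in _ (fun m => Cmod (x m) ^ 2) (seq P len)), !rsum_const.
- lra.
- intros m Hm; rewrite window_in by exact Hm; reflexivity.
- intros m Hm; apply in_seq in Hm; rewrite window_out by lia; rewrite Cmod_0; ring.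
- intros m Hm; apply in_seq in Hm; rewrite window_out by lia; rewrite Cmod_0; ring.
Qed.

Lemma cseries_window P len (x y : nat -> C) :
  cseries (fun m => window P len x m * y m)%C (csum (fun m => x m * y m)%C (seq P len)).
Proof.
apply climit_ext_from with (P + len)%nat
  (fun _ => csum (fun m => x m * y m)%C (seq P len)); [|apply climit_const].
intros K HK; replace K with (P + (len + (K - P - len)))%nat by lia.
rewrite !seq_app, !csum_app, Nat.add_0_l.
rewrite (csum_ext_in (fun m => window P len x m * y m)%C (fun _ => RtoC 0) (seq 0 P)),
  (csum_ext_in (fun m => window P len x m * y m)%C (fun _ => RtoC 0) (seq (P + len) _)),
  (csum_ext_in (fun m => window P len x m * y m)%C (fun m => x m * y m)%C (seq P len)), !csum_0.
- ring.
- intros m Hm; rewrite window_in by exact Hm; reflexivity.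
- intros m Hm; apply in_seq in Hm; rewrite window_out by lia; ring.
- intros m Hm; apply in_seq in Hm; rewrite window_out by lia; ring.
Qed.

(* The extremal Dirichlet polynomial for the functional [f |-> sum b_j f(T w_j)]
   restricted to the frequencies [P < k <= P + len]. *)
Lemma sampling_polynomial n (b w : nat -> C) P len :
  exists D : ell2, ell2_norm D <= sqrt (sample_energy_sum n b w P len) /\
    csum (fun j => b j * dirichlet_eval D (Tmap (w j)))%C (seq 1 n)
    = sample_energy_sum n b w P len.
Proof.
set (G m := expsum (to_half (weighted_nodes b w n)) (ln (INR (S m)))).
(* The conjugate aligns the phases: each term of the functional becomes |G|^2 / (m+1), which is also
   |x_m|^2, so one sum serves as the value and as a bound for the squared norm. *)
set (x m := (RtoC (/ sqrt (INR (S m))) * Cconj (G m))%C).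
assert (Hs : forall m, 0 < sqrt (INR (S m)) /\ 0 < INR (S m)).
  intros m; assert (H : 0 < INR (S m)) by (apply lt_0_INR; lia).
  split; [apply sqrt_lt_R0|]; exact H.
assert (Hx : forall m, Cmod (x m) ^ 2 = / INR (S m) * Cmod (G m) ^ 2).
  intros m; destruct (Hs m) as [H1 H2].
  unfold x; rewrite Cmod_mult, Cmod_conj, Cmod_R, Rpow_mult_distr, pow2_abs, pow_inv,
    pow2_sqrt by lra; reflexivity.
destruct (window_ell2 P len x) as [D [HD1 HD2]]; exists D; split.
  rewrite (rsum_ext _ _ _ Hx) in HD2; exact HD2.
rewrite (csum_ext _ (fun j => csum (fun m => b j * (x m * inv_npow (S m) (Tmap (w j))))
  (seq P len))%C).
2:{ intros j; rewrite csum_scal; f_equal; apply cseries_CSeries.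
    apply (cseries_ext (fun m => window P len x m * inv_npow (S m) (Tmap (w j)))%C).
      intros m; rewrite HD1; reflexivity.
    apply cseries_window. }
rewrite csum_switch; unfold sample_energy_sum; rewrite RtoC_rsum; apply csum_ext; intros m.
fold (G m); destruct (Hs m) as [H1 H2].
rewrite (csum_ext _ (fun j => (x m * RtoC (/ sqrt (INR (S m)))) *
  (b j * cexpn (cayley (w j)) (ln (INR (S m)))))%C).
2:{ intros j; rewrite Tmap_cayley, inv_npow_half by lia; ring. }
rewrite csum_scal.
replace (csum _ (seq 1 n)) with (G m).
2:{ unfold G, expsum, to_half, weighted_nodes; rewrite !csum_map; reflexivity. }
unfold x; rewrite RtoC_mult, Cmod_sqr_mult_conj.
replace (RtoC (/ INR (S m))) with (RtoC (/ sqrt (INR (S m))) * RtoC (/ sqrt (INR (S m))))%C.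
  ring.
rewrite <- RtoC_mult; f_equal; rewrite <- Rinv_mult, sqrt_sqrt by lra; reflexivity.
Qed.

Lemma functional_minus (f g : HardyH2) l : in_disc l ->
  functional (hardy_eval (minus f g)) l =
  (functional (hardy_eval f) l - functional (hardy_eval g) l)%C.
Proof.
intros Hl; unfold functional; rewrite <- csum_minus; apply csum_ext_in; intros p Hp.
change (minus f g) with (ell2_plus f (ell2_scal (- (1))%C g)).
rewrite hardy_eval_plus, hardy_eval_scal by (apply Hl, Hp); ring.
Qed.

Lemma functional_sum_0 (c : nat -> C) (v : nat -> HardyH2) l m : in_disc l ->
  (forall k, (1 <= k <= m)%nat -> functional (hardy_eval (v k)) l = 0) ->
  functional (hardy_eval (sum_n_m (fun k => scal (c k) (v k)) 1 m)) l = 0.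
Proof.
intros Hl; induction m as [|m IH]; intros Hv.
  rewrite sum_n_m_zero by lia; unfold functional.
  rewrite (csum_ext_in _ (fun _ => RtoC 0)), csum_0; [reflexivity|].
  intros p Hp; change (fst p * hardy_eval ell2_zero (snd p) = 0)%C.
  replace ell2_zero with (ell2_scal 0%C ell2_zero).
    rewrite hardy_eval_scal by (apply Hl, Hp); ring.
  apply ell2_ext; intros k; simpl; ring.
rewrite sum_n_Sm by lia.
change (functional (hardy_eval (ell2_plus (sum_n_m (fun k => scal (c k) (v k)) 1 m)
  (ell2_scal (c (S m)) (v (S m))))) l = 0).
transitivity (functional (hardy_eval (sum_n_m (fun k => scal (c k) (v k)) 1 m)) l
  + c (S m) * functional (hardy_eval (v (S m))) l)%C.
  unfold functional; rewrite <- csum_scal, <- csum_plus; apply csum_ext_in; intros p Hp.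
  rewrite hardy_eval_plus, hardy_eval_scal by (apply Hl, Hp); ring.
rewrite Hv, IH by (try (intros; apply Hv); lia); ring.
Qed.

(** Cauchy-Schwarz with the weights sqrt(1 - |z_j|^2) splits off the Carleson sum of f. *)
Lemma functional_carleson n (b z : nat -> C) (f : ell2) : (1 <= n)%nat ->
  (forall j, (1 <= j <= n)%nat -> Cmod (z j) < 1) ->
  Cmod (functional (hardy_eval f) (weighted_nodes b z n)) ^ 2
    <= node_mass n b z * (carleson_norm n z * ell2_norm f ^ 2).
Proof.
intros Hn Hz; destruct (carleson_bound n z Hn Hz) as [_ HC].
rewrite functional_weighted_nodes.
rewrite (csum_ext_in _ (fun j => (b j / RtoC (sqrt (1 - Cmod (z j) ^ 2)))
  * (RtoC (sqrt (1 - Cmod (z j) ^ 2)) * hardy_eval f (z j)))%C).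
2:{ intros j Hj; assert (H := sqrt_lt_R0 _ (node_weight_pos n z j Hz Hj)).
    field; apply RtoC_neq0; lra. }
eapply Rle_trans; [apply csum_cauchy|].
apply Rmult_le_compat; try (apply rsum_ge0; intros; apply pow2_ge_0).
  right; apply rsum_ext_in; intros j Hj; assert (Hw := node_weight_pos n z j Hz Hj).
  assert (H := sqrt_lt_R0 _ Hw).
  rewrite Cmod_div, Cmod_R, Rabs_pos_eq by (try apply RtoC_neq0; lra).
  unfold Rdiv; rewrite Rpow_mult_distr, pow_inv, pow2_sqrt by lra; reflexivity.
eapply Rle_trans; [|apply HC].
right; apply rsum_ext_in; intros j Hj; assert (Hw := node_weight_pos n z j Hz Hj).
rewrite Cmod_mult, Rpow_mult_distr, Cmod_R, pow2_abs, pow2_sqrt by lra; reflexivity.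
Qed.

Definition weight_ratio_inf (n : nat) (z w : nat -> C) : R :=
  infimum (fun x => exists j, (1 <= j <= n)%nat /\
    x = sqrt ((1 - Cmod (z j) ^ 2) / (1 - Cmod (w j) ^ 2))).

Lemma weight_ratio_inf_bound n z w : (1 <= n)%nat -> 0 <= weight_ratio_inf n z w /\
  forall j, (1 <= j <= n)%nat ->
    weight_ratio_inf n z w <= sqrt ((1 - Cmod (z j) ^ 2) / (1 - Cmod (w j) ^ 2)).
Proof.
intros Hn; set (E := fun x => exists j, (1 <= j <= n)%nat /\
    x = sqrt ((1 - Cmod (z j) ^ 2) / (1 - Cmod (w j) ^ 2))).
assert (Hlow : forall x, E x -> 0 <= x) by (intros x [j [_ ->]]; apply sqrt_pos).
split.
  apply (infimum_ge E); [|exact Hlow]; eexists; exists 1%nat; split; [lia | reflexivity].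
intros j Hj; apply (infimum_le E 0); [exact Hlow | exists j; auto].
Qed.

Lemma node_mass_ratio n (b z w : nat -> C) : (1 <= n)%nat ->
  (forall j, (1 <= j <= n)%nat -> Cmod (z j) < 1) ->
  (forall j, (1 <= j <= n)%nat -> Cmod (w j) < 1) ->
  weight_ratio_inf n z w ^ 2 * node_mass n b z <= node_mass n b w.
Proof.
intros Hn Hz Hw; destruct (weight_ratio_inf_bound n z w Hn) as [H0 H1].
unfold node_mass; rewrite <- rsum_scal; apply rsum_le_in; intros j Hj.
assert (Hzj := node_weight_pos n z j Hz Hj); assert (Hwj := node_weight_pos n w j Hw Hj).
apply in_seq in Hj; specialize (H1 j ltac:(lia)).
assert (H2 : weight_ratio_inf n z w ^ 2 <= (1 - Cmod (z j) ^ 2) / (1 - Cmod (w j) ^ 2)).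
  assert (Hq : 0 <= (1 - Cmod (z j) ^ 2) / (1 - Cmod (w j) ^ 2)).
    left; apply Rdiv_lt_0_compat; assumption.
  rewrite <- (pow2_sqrt _ Hq); apply pow_incr; lra.
apply Rle_trans with ((1 - Cmod (z j) ^ 2) / (1 - Cmod (w j) ^ 2)
    * (Cmod (b j) ^ 2 / (1 - Cmod (z j) ^ 2))).
  apply Rmult_le_compat_r; [|exact H2].
  apply Rmult_le_pos; [apply pow2_ge_0 | left; apply Rinv_0_lt_compat, Hzj].
right; field; lra.
Qed.

(** For an approximant L at distance d, take b annihilating the range of L at the points z_j. On
    (C_phi - L) D the functional equals the sample sum R0, while the Carleson bound makes it at most
    d sqrt(R0) times sqrt(C0 [node_mass]). Hence R0 <= d^2 C0 [node_mass], which is compared with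
    the sampled lower bound through the ratios of the weights. *)
Lemma approximation_lower_bound (omega : C -> C) (C_T C_omega : ell2_NormedModule -> ell2_NormedModule)
    n (z : nat -> C) (kappa : R) :
  is_composition_operator dirichlet_eval hardy_eval unit_disc Tmap C_T ->
  is_composition_operator hardy_eval hardy_eval unit_disc omega C_omega ->
  (forall z, unit_disc z -> unit_disc (omega z)) ->
  (1 <= n)%nat -> (forall j, (1 <= j <= n)%nat -> unit_disc (z j)) -> 0 <= kappa ->
  (forall b : nat -> C, (exists j, (1 <= j <= n)%nat /\ b j <> 0) -> exists P len,
    kappa ^ 2 * node_mass n b (fun j => omega (z j))
      <= sample_energy_sum n b (fun j => omega (z j)) P len) ->
  kappa * / sqrt (carleson_norm n z) * weight_ratio_inf n z (fun j => omega (z j))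
    <= approximation_number n (fun f => powers_of_2 (C_omega (C_T f))).
Proof.
intros [HTlin HT] [Holin Ho] Hself Hn Hz Hk Hsamp.
set (w j := omega (z j)) in *.
assert (Hw : forall j, (1 <= j <= n)%nat -> Cmod (w j) < 1) by (intros j Hj; apply Hself, Hz, Hj).
destruct (carleson_bound n z Hn Hz) as [HC0 _]; set (C0 := carleson_norm n z) in *.
destruct (weight_ratio_inf_bound n z w Hn) as [Hi0 _]; set (i0 := weight_ratio_inf n z w) in *.
set (C_phi := fun f => powers_of_2 (C_omega (C_T f))).
assert (HPlin : is_linear C_phi).
  apply (is_linear_comp (fun f => C_omega (C_T f)) powers_of_2);
    [apply (is_linear_comp C_T C_omega); assumption | apply powers_of_2_linear].
apply infimum_ge; [apply approximation_set_nonempty, Hn|].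
intros d [L [HL [[m [v [Hm Hv]]] ->]]].
set (d := operator_norm _).
assert (Hd0 : 0 <= d) by (apply operator_norm_ge0, linear_minus_bounded; assumption).
(* The functional [sum b_j f(z_j)] kills the range of [L]. *)
destruct (homogeneous_solution m (seq 1 n) (fun k j => hardy_eval (dyadic (v (S k))) (z j)))
  as [b [[j0 [Hj0 Hb0]] Hb]].
  apply seq_NoDup.
  rewrite length_seq; exact Hm.
assert (Hbne : exists j, (1 <= j <= n)%nat /\ b j <> 0).
  exists j0; split; [apply in_seq in Hj0; lia | exact Hb0].
destruct (Hsamp b Hbne) as [P [len HPl]].
set (R0 := sample_energy_sum n b w P len) in *.
destruct (sampling_polynomial n b w P len) as [D [HD1 HD2]]; fold R0 in HD1, HD2.
assert (Hl : in_disc (weighted_nodes b z n)) by (apply in_disc_weighted_nodes, Hz).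
assert (Hmz : 0 < node_mass n b z).
  assert (Hj0z := node_weight_pos n z j0 Hz Hj0).
  apply Rlt_le_trans with (Cmod (b j0) ^ 2 / (1 - Cmod (z j0) ^ 2)).
    apply Rdiv_lt_0_compat; [apply pow_lt, Cmod_gt_0, Hb0 | exact Hj0z].
  apply (rsum_term_le (fun j => Cmod (b j) ^ 2 / (1 - Cmod (z j) ^ 2))); [|exact Hj0].
  intros j Hj; apply Rmult_le_pos; [apply pow2_ge_0|].
  left; apply Rinv_0_lt_compat, (node_weight_pos n z j Hz Hj).
assert (Hratio := node_mass_ratio n b z w Hn Hz Hw); fold i0 in Hratio.
set (g := minus (C_phi D) (L D)).
assert (Hval : functional (hardy_eval (dyadic g)) (weighted_nodes b z n) = R0).
  unfold g; rewrite (linear_minus dyadic _ _ dyadic_linear).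
  rewrite functional_minus by exact Hl.
  unfold C_phi; rewrite dyadic_powers_of_2.
  destruct (Hv D) as [c Hc]; rewrite Hc.
  rewrite (linear_sum_n_m dyadic c v 1 m dyadic_linear), functional_sum_0.
  - rewrite <- HD2, functional_weighted_nodes.
    transitivity (csum (fun j => b j * dirichlet_eval D (Tmap (w j)))%C (seq 1 n) - 0)%C; [|ring].
    f_equal; apply csum_ext_in; intros j Hj; apply in_seq in Hj.
    assert (Hzj := Hz j ltac:(lia)).
    rewrite Ho by exact Hzj; rewrite HT by (apply Hself, Hzj); reflexivity.
  - exact Hl.
  - intros k Hkm; rewrite functional_weighted_nodes.
    replace k with (S (k - 1)) by lia; apply Hb; lia.
assert (HR0 : 0 <= R0).
  apply rsum_ge0; intros k; apply Rmult_le_pos; [|apply pow2_ge_0].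
  left; apply Rinv_0_lt_compat, lt_0_INR; lia.
assert (Hg : ell2_norm (dyadic g) <= d * sqrt R0).
  eapply Rle_trans; [apply dyadic_norm|].
  apply Rle_trans with (d * ell2_norm D); [|apply Rmult_le_compat_l; assumption].
  apply (operator_norm_bound (fun x => minus (C_phi x) (L x)));
    apply linear_minus_bounded; assumption.
assert (Hcar := functional_carleson n b z (dyadic g) Hn Hz).
rewrite Hval, Cmod_R, pow2_abs in Hcar; fold C0 in Hcar.
assert (Hmain : R0 <= d ^ 2 * C0 * node_mass n b z).
  destruct (Req_dec R0 0) as [E | N].
    rewrite E; repeat apply Rmult_le_pos; try lra.
  apply Rmult_le_reg_r with R0; [lra|].
  replace (R0 * R0) with (R0 ^ 2) by ring.
  eapply Rle_trans; [exact Hcar|].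
  replace (d ^ 2 * C0 * node_mass n b z * R0) with (node_mass n b z * (C0 * (d ^ 2 * R0))) by ring.
  apply Rmult_le_compat_l; [lra|]; apply Rmult_le_compat_l; [lra|].
  replace (d ^ 2 * R0) with ((d * sqrt R0) ^ 2)
    by (rewrite Rpow_mult_distr, pow2_sqrt by exact HR0; reflexivity).
  apply pow_incr; split; [apply ell2_norm_ge0 | exact Hg].
assert (Hfin : (kappa * i0) ^ 2 <= d ^ 2 * C0).
  apply Rmult_le_reg_r with (node_mass n b z); [exact Hmz|].
  eapply Rle_trans; [|exact Hmain]; eapply Rle_trans; [|exact HPl].
  replace ((kappa * i0) ^ 2 * node_mass n b z) with (kappa ^ 2 * (i0 ^ 2 * node_mass n b z)) by ring.
  apply Rmult_le_compat_l; [apply pow2_ge_0 | exact Hratio].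
assert (Hs : 0 < sqrt C0) by (apply sqrt_lt_R0, HC0).
apply Rmult_le_reg_r with (sqrt C0); [exact Hs|].
replace (kappa * / sqrt C0 * i0 * sqrt C0) with (kappa * i0) by (field; lra).
apply sqr_le_inv; [apply Rmult_le_pos; lra|].
rewrite Rpow_mult_distr with (x := d), pow2_sqrt by lra; exact Hfin.
Qed.

(** * The two-sided estimate and compactness *)

Theorem theorem9p1 (omega : C -> C)
  (omega_analytic : analytic_on unit_disc omega)
  (omega_self_map : forall z, unit_disc z -> unit_disc (omega z))
  (omega_distance : exists delta, 0 < delta /\
     forall z, unit_disc z -> delta <= Cmod (omega z - RtoC (-1))%C) :
  let phi := fun s => Tmap (omega (Imap s)) in
  exists (C_T : DirichletH2 -> HardyH2)
         (C_omega : HardyH2 -> HardyH2)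
         (C_phi : DirichletH2 -> DirichletH2),
    is_composition_operator dirichlet_eval hardy_eval unit_disc Tmap C_T /\
    is_composition_operator hardy_eval hardy_eval unit_disc omega C_omega /\
    is_composition_operator dirichlet_eval dirichlet_eval half_plane phi C_phi /\
    (exists c A : R, 0 < c /\ 0 < A /\
      forall (n : nat) (z : nat -> C), (1 <= n)%nat ->
        (forall j, (1 <= j <= n)%nat -> unit_disc (z j)) ->
        distinct_points n z ->
        distinct_points n (fun j => omega (z j)) ->
        c * Rpower (interpolation_constant n (fun j => omega (z j))) (- A)
          * / sqrt (carleson_norm n z)
          * infimum (fun x => exists j, (1 <= j <= n)%nat /\
              x = sqrt ((1 - Cmod (z j) ^ 2) / (1 - Cmod (omega (z j)) ^ 2)))
        <= approximation_number n C_phi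
        <= operator_norm C_T * approximation_number n C_omega) /\
    (compact_operator C_omega -> compact_operator C_phi).
Proof.
intros phi.
destruct embedding_exists as [C_T HT].
destruct (composition_exists omega omega_analytic omega_self_map) as [C_omega Ho].
destruct omega_distance as [delta [Hdelta Hdist]].
exists C_T, C_omega, (fun f => powers_of_2 (C_omega (C_T f))).
(* |1 - w| <= 2 and |1 + w| >= delta bound the Cayley transforms of the points of omega(D) by
   2/delta. *)
assert (HB : 0 < 2 / delta) by (apply Rdiv_lt_0_compat; lra).
destruct (sampled_interpolation_bound (2 / delta) HB) as [c [A [Hc [HA Hsamp]]]].
split; [exact HT|]; split; [exact Ho|]; split; [|split].
- destruct HT as [HTlin HT]; destruct Ho as [Holin Ho]; split.
    apply (is_linear_comp (fun f => C_omega (C_T f)) powers_of_2);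
      [apply (is_linear_comp C_T C_omega); assumption | apply powers_of_2_linear].
  intros f s Hs; rewrite powers_of_2_eval by exact Hs.
  assert (Hi := Imap_unit_disc s Hs).
  rewrite Ho by exact Hi; rewrite HT by (apply omega_self_map, Hi); reflexivity.
- exists c, A; split; [exact Hc|]; split; [exact HA|].
  intros n z Hn Hz Hdz Hdw; split.
  + apply (approximation_lower_bound omega C_T C_omega n z); auto.
      apply Rmult_le_pos; [lra | left; apply exp_pos].
    intros b Hb; apply Hsamp; auto.
      intros j Hj; apply omega_self_map, Hz, Hj.
    intros j Hj; assert (Hw := omega_self_map _ (Hz j Hj)).
    assert (H1 := Hdist _ (Hz j Hj)); unfold unit_disc in Hw.
    replace (omega (z j) - RtoC (-1))%C with (1 + omega (z j))%C in H1
      by (replace (RtoC (-1)) with (- RtoC 1)%C by (rewrite <- RtoC_opp; f_equal; ring); ring).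
    unfold cayley; rewrite Cmod_div by (apply one_plus_neq0, Hw).
    apply Rmult_le_compat; [apply Cmod_ge_0 | left; apply Rinv_0_lt_compat; lra | |].
      eapply Rle_trans; [apply Cmod_triangle|]; rewrite Cmod_opp, Cmod_1; lra.
    apply Rinv_le_contravar; assumption.
  + destruct HT as [HTlin _]; destruct Ho as [Holin _].
    apply (approximation_number_comp n C_T C_omega powers_of_2); auto.
      apply powers_of_2_linear.
    apply powers_of_2_norm.
- destruct HT as [HTlin _]; destruct Ho as [Holin _].
  apply (compact_operator_comp C_T C_omega powers_of_2); auto.
  apply powers_of_2_linear.
Qed.
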